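(* Let $q>0$, let $h$ be a function, and put $f(x)=h(x^4)$ for $x\ge 0$. Assume: (1) $h$ is a regular (holomorphic) function on a domain containing $[0,\infty)$, with Taylor series at $z=0$ written in the form $$h(z)=\sum_{m=0}^\infty \frac{\bar h^{(m)}(0)}{m!}\,(-z)^m ;$$ (2) $h(z)=\mathrm{O}(z^{-d})$ as $z\to\infty$ (along the positive real axis), for some $d>1/8$; (3) there is a regular (single-valued holomorphic) function $s\mapsto \bar h^{(s)}(0)$ defined on the half-plane $H(\delta)=\{s\in\mathbb{C}:\ \mathrm{Re}\,s\ge -\delta\}$, for some $1/8<\delta<1/2$, which takes at $s=m=0,1,2,\dots$ the values $\bar h^{(m)}(0)$ appearing in (1), and which satisfies the growth condition $$|\bar h^{(s)}(0)|<C\,e^{Pv+B|w|}\qquad\text{for all } s=v+iw\in H(\delta)\ (v,w\in\mathbb{R}),$$ for some real constants $C$, $P$ and $B$ with $B<\pi/2$. Then the zero-order Hankel transform $$A(q)=\int_0^\infty J_0(qx)\,f(x)\,x\,dx$$ may be expressed, for $-1/2<\alpha<0$, in the form $$A(q)=\frac{1}{q^2\sqrt{\pi}\,i}\int_{\alpha-i\infty}^{\alpha+i\infty}\bar h^{(s)}(0)\,\frac{\Gamma(2s+1)}{\Gamma(1/2-s)}\,2^{6s+1}\,q^{-4s}\,ds .$$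
   Context: $J_0$ is the Bessel function of the first kind of order zero and $\Gamma$ is the Gamma function. The integral over $(0,\infty)$ is an improper integral, $\lim_{R\to\infty}\int_0^R$. For an integer $m\ge0$ the notation $\bar h^{(m)}(0)$ means $(-1)^m h^{(m)}(0)$, where $h^{(m)}$ is the $m$-th derivative; for complex $s$, $\bar h^{(s)}(0)$ denotes the holomorphic interpolation of these values described in condition (3). The contour integral is along the vertical line $\mathrm{Re}\,s=\alpha$, oriented upwards.
   Formalization: The formula is stated for -1/2 < α < 0 with also α ≥ -δ, because the interpolating function is given only on the half-plane Re s ≥ -δ with δ < 1/2, so the contour integral is undefined for α < -δ. *)

(* Defs.v *)
From Stdlib Require Import Reals Factorial ZArith.
From Coquelicot Require Import Coquelicot.

Open Scope R_scope.

Definition Cexp (z : C) : C :=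
  (exp (Re z) * cos (Im z), exp (Re z) * sin (Im z)).

(* Principal value of [a ^ s]; only meaningful for [0 < a]. *)
Definition Rcpow (a : R) (s : C) : C := Cexp (s * RtoC (ln a))%C.

Definition bessel_J0 (x : R) : R :=
  PSeries (fun k => (-1) ^ k / (INR (fact k)) ^ 2) ((x / 2) ^ 2).

Definition euler_integral (z : C) : C :=
  RInt_gen (V := C_R_CompleteNormedModule)
    (fun t : R => (Rcpow t (z - 1) * RtoC (exp (- t)))%C)
    (at_right 0) (Rbar_locally p_infty).

Fixpoint rising (z : C) (n : nat) : C :=
  match n with
  | O => RtoC 1
  | S k => (rising z k * (z + RtoC (INR k)))%C
  end.

(* Euler's integral where [0 < Re z] (there [n = 0]), and elsewhere its
   continuation [Gamma (z + n) / (z (z + 1) ... (z + n - 1))] with the least [n]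
   such that [0 < Re (z + n)].  The values at the poles are junk. *)
Definition Gamma (z : C) : C :=
  let n := Z.to_nat (up (- Re z)) in
  (euler_integral (z + RtoC (INR n)) / rising z n)%C.

(* On a set [S] that is not open, this is holomorphy on a neighbourhood of [S]. *)
Definition regular_on (S : C -> Prop) (f : C -> C) : Prop :=
  forall z : C, S z ->
    locally (T := C_UniformSpace) z
      (fun u : C => ex_derive (K := C_AbsRing) (V := C_NormedModule) f u).

Definition connected_set (U : C -> Prop) : Prop :=
  forall V W : C -> Prop,
    open (T := C_UniformSpace) V -> open (T := C_UniformSpace) W ->
    (forall z, U z -> V z \/ W z) ->
    (exists z, U z /\ V z) -> (exists z, U z /\ W z) ->
    exists z, U z /\ V z /\ W z.

Definition is_domain (U : C -> Prop) : Prop :=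
  open (T := C_UniformSpace) U /\ connected_set U /\ exists z, U z.

Definition hbar (h : C -> C) (m : nat) : C :=
  (RtoC ((-1) ^ m) * Nat.iter m C_derive h (RtoC 0))%C.

Definition halfplane (delta : R) (s : C) : Prop := - delta <= Re s.

Definition is_hankel0 (f : R -> C) (q : R) (A : C) : Prop :=
  is_RInt_gen (V := C_R_NormedModule)
    (fun x : R => (RtoC (bessel_J0 (q * x)) * f x * RtoC x)%C)
    (at_point 0) (Rbar_locally p_infty) A.

(* Contour integral of [F] upwards along [Re s = alpha], with [s = alpha + i w]
   and [ds = i dw]. *)
Definition is_vertical_int (F : C -> C) (alpha : R) (I : C) : Prop :=
  is_RInt_gen (V := C_R_NormedModule)
    (fun w : R => (F (alpha, w) * Ci)%C)
    (Rbar_locally m_infty) (Rbar_locally p_infty) I.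

(* Main.v *)
Require Import Defs.
From Stdlib Require Import Reals Factorial ZArith Lra Lia FunctionalExtensionality.
From Coquelicot Require Import Coquelicot.
Open Scope R_scope.

(** Ramanujan's master theorem represents [h] on the half-line by the
    Mellin-Barnes integral of [phi s * Gamma (- s) * y ^ s] over a line
    [Re s = alpha < 0]: moving the line across the poles [0, 1, 2, ...] of
    [Gamma (- s)] produces the Taylor series, and [B < PI / 2] makes everything
    converge because [Gamma] decays like [exp (- theta |Im s|)] for every
    [theta < PI / 2].  By the identity theorem the Taylor series represents [h]
    on all of [[0, oo)].  Integrating the Hankel transform once by parts replaces
    [J_0] by [J_1], after which the double integral converges absolutely on
    [Re s = - delta] because [delta > 1 / 8].  Exchanging the integrals leaves
    Weber's integral, the Mellin transform of [J_1]; the duplication formula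
    turns the result into the stated quotient of Gamma functions, and the
    reflection formula bounds that quotient well enough to move the line. *)

(** Since [J_0 x] is only O(x ^ (- 1 / 2)) and the contour on [Re s = - delta] gives [f x] = O(x ^
    (- 4 delta)), the double integral for [x J_0 (q x) f x] would converge absolutely only for
    [delta > 3 / 8]. After one integration by parts the integrand is of order x ^ (- 1 / 2 - 4
    delta) and the boundary term of order x ^ (1 / 2 - 4 delta); both are harmless exactly when
    [delta > 1 / 8]. The derivative is cheap on the Mellin side: [x h' x] belongs to [s * phi s],
    which stays in the growth class with a slightly larger [B]. All Mellin-type integrals are
    written in the variable [u = ln t]. Powers become exponentials, so one notion, a continuous
    function on the line with exponential decay, serves Euler's integral, the contours, the Bessel
    transform and Fubini's theorem. Contours are rectangles and vertical lines only, and Gamma is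
    evaluated only on the right half-plane, where Euler's integral represents it; a pole of
    [Gamma (- s)] is exposed by writing [Gamma (- s) = - Gamma (1 - s) / s]. *)

Arguments Cmod x%_C.
Arguments Cexp z%_C.
Arguments Re z%_C.
Arguments Im z%_C.
Arguments Rmax_Cmod x%_C.
Arguments Cmod_ge_0 x%_C.
Arguments Cmod_triangle (x y)%_C.

(** * Norm, balls and continuity of complex-valued functions *)

Lemma C_norm (z : C) : norm (z : C_R_NormedModule) = Cmod z.
Proof.
  unfold norm; simpl; unfold prod_norm, Cmod, norm; simpl; unfold abs; simpl.
  f_equal. rewrite !Rmult_1_r.
  assert (E : forall x, Rabs x * Rabs x = x * x)
    by (intros x; generalize (pow2_abs x); simpl; rewrite !Rmult_1_r; auto).
  rewrite !E; reflexivity.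
Qed.

Lemma Cmod_ball (x y : C) (e : R) :
  Cmod (y - x) < e -> ball (M := C_UniformSpace) x e y.
Proof.
  intros H. generalize (Rmax_Cmod (y - x)). intros H1.
  split; unfold ball; simpl; unfold AbsRing_ball, abs, minus, plus, opp; simpl.
  - eapply Rle_lt_trans; [|exact H]. eapply Rle_trans; [apply Rmax_l|exact H1].
  - eapply Rle_lt_trans; [|exact H]. eapply Rle_trans; [apply Rmax_r|exact H1].
Qed.

(** Balls of the product structure are squares, so the Euclidean distance can exceed the radius by a
    factor [sqrt 2], rounded up to 2. *)
Lemma ball_Cmod (x y : C) (e : R) :
  ball (M := C_UniformSpace) x e y -> Cmod (y - x) < 2 * e.
Proof.
  intros [H1 H2].
  unfold ball in H1, H2; simpl in H1, H2;
    unfold AbsRing_ball, abs, minus, plus, opp in H1, H2; simpl in H1, H2.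
  assert (He : 0 < e) by (eapply Rle_lt_trans; [apply Rabs_pos|exact H1]).
  eapply Rle_lt_trans; [apply Cmod_2Rmax|].
  assert (Rmax (Rabs (fst (y - x)%C)) (Rabs (snd (y - x)%C)) < e)
    by (apply Rmax_lub_lt; simpl; assumption).
  assert (sqrt 2 < 2).
  { rewrite <- (sqrt_square 2) at 2 by lra. apply sqrt_lt_1; lra. }
  assert (0 <= Rmax (Rabs (fst (y - x)%C)) (Rabs (snd (y - x)%C)))
    by (eapply Rle_trans; [apply Rabs_pos|apply Rmax_l]).
  assert (0 <= sqrt 2) by apply sqrt_pos. nra.
Qed.

Lemma continuous_pairC {T : UniformSpace} (f : T -> C) (x : T) :
  continuous (fun t => Re (f t)) x -> continuous (fun t => Im (f t)) x ->
  continuous (U := C_UniformSpace) f x.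
Proof.
  intros H1 H2. apply filterlim_locally. intros eps.
  generalize (filter_and _ _ (proj1 (filterlim_locally _ _) H1 eps)
                             (proj1 (filterlim_locally _ _) H2 eps)).
  apply filter_imp. intros t [A B]. split; assumption.
Qed.

Lemma continuous_Re {T : UniformSpace} (f : T -> C) (x : T) :
  continuous (U := C_UniformSpace) f x -> continuous (fun t => Re (f t)) x.
Proof.
  intros H. apply filterlim_locally. intros eps.
  generalize (proj1 (filterlim_locally _ _) H eps). apply filter_imp.
  intros t [A _]. exact A.
Qed.

Lemma continuous_Im {T : UniformSpace} (f : T -> C) (x : T) :
  continuous (U := C_UniformSpace) f x -> continuous (fun t => Im (f t)) x.
Proof.
  intros H. apply filterlim_locally. intros eps.
  generalize (proj1 (filterlim_locally _ _) H eps). apply filter_imp.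
  intros t [_ A]. exact A.
Qed.

Lemma continuous_Rplus {T : UniformSpace} (f g : T -> R) (x : T) :
  continuous f x -> continuous g x -> continuous (fun t => f t + g t) x.
Proof. intros; apply (continuous_plus (V := R_NormedModule)); assumption. Qed.

Lemma continuous_Ropp {T : UniformSpace} (f : T -> R) (x : T) :
  continuous f x -> continuous (fun t => - f t) x.
Proof. intros; apply (continuous_opp (V := R_NormedModule)); assumption. Qed.

Lemma continuous_Rmult {T : UniformSpace} (f g : T -> R) (x : T) :
  continuous f x -> continuous g x -> continuous (fun t => f t * g t) x.
Proof. intros; apply (continuous_mult (K := R_AbsRing)); assumption. Qed.

Lemma continuous_Rcomp {T : UniformSpace} (g : R -> R) (f : T -> R) (x : T) :
  continuous f x -> continuous g (f x) -> continuous (fun t => g (f t)) x.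
Proof. intros; apply continuous_comp; assumption. Qed.

Lemma continuous_Cplus {T : UniformSpace} (f g : T -> C) (x : T) :
  continuous (U := C_UniformSpace) f x -> continuous (U := C_UniformSpace) g x ->
  continuous (U := C_UniformSpace) (fun t => (f t + g t)%C) x.
Proof.
  intros Hf Hg; apply continuous_pairC; simpl.
  - apply (continuous_Rplus (fun t => Re (f t)) (fun t => Re (g t)));
      apply continuous_Re; assumption.
  - apply (continuous_Rplus (fun t => Im (f t)) (fun t => Im (g t)));
      apply continuous_Im; assumption.
Qed.

Lemma continuous_Copp {T : UniformSpace} (f : T -> C) (x : T) :
  continuous (U := C_UniformSpace) f x ->
  continuous (U := C_UniformSpace) (fun t => (- f t)%C) x.
Proof.
  intros Hf; apply continuous_pairC; simpl.
  - apply (continuous_Ropp (fun t => Re (f t))), continuous_Re; assumption.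
  - apply (continuous_Ropp (fun t => Im (f t))), continuous_Im; assumption.
Qed.

Lemma continuous_Cminus {T : UniformSpace} (f g : T -> C) (x : T) :
  continuous (U := C_UniformSpace) f x -> continuous (U := C_UniformSpace) g x ->
  continuous (U := C_UniformSpace) (fun t => (f t - g t)%C) x.
Proof.
  intros; apply continuous_Cplus; [|apply continuous_Copp]; assumption.
Qed.

Lemma continuous_Cmult {T : UniformSpace} (f g : T -> C) (x : T) :
  continuous (U := C_UniformSpace) f x -> continuous (U := C_UniformSpace) g x ->
  continuous (U := C_UniformSpace) (fun t => (f t * g t)%C) x.
Proof.
  intros Hf Hg. generalize (continuous_Re _ _ Hf) (continuous_Im _ _ Hf)
    (continuous_Re _ _ Hg) (continuous_Im _ _ Hg). intros.
  apply continuous_pairC; simpl.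
  - apply continuous_Rplus; [|apply continuous_Ropp];
      apply continuous_Rmult; assumption.
  - apply continuous_Rplus; apply continuous_Rmult; assumption.
Qed.

Lemma continuous_RtoC {T : UniformSpace} (f : T -> R) (x : T) :
  continuous f x -> continuous (U := C_UniformSpace) (fun t => RtoC (f t)) x.
Proof.
  intros; apply continuous_pairC; simpl; [assumption|apply continuous_const].
Qed.

Lemma Cmod_sqr (z : C) : Cmod z * Cmod z = Re z * Re z + Im z * Im z.
Proof.
  unfold Cmod. rewrite sqrt_sqrt; [unfold Re, Im; ring|].
  generalize (pow2_ge_0 (fst z)) (pow2_ge_0 (snd z)); lra.
Qed.

Lemma continuous_Cinv {T : UniformSpace} (f : T -> C) (x : T) :
  continuous (U := C_UniformSpace) f x -> f x <> 0%C ->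
  continuous (U := C_UniformSpace) (fun t => (/ f t)%C) x.
Proof.
  intros Hf Hn. generalize (continuous_Re _ _ Hf) (continuous_Im _ _ Hf). intros HR HI.
  assert (Hne : Re (f x) ^ 2 + Im (f x) ^ 2 <> 0).
  { intros E. apply Hn. apply Cmod_eq_0. generalize (Cmod_sqr (f x)) (Cmod_ge_0 (f x)).
    nra. }
  assert (HD : continuous (fun t => / (Re (f t) ^ 2 + Im (f t) ^ 2)) x).
  { apply (continuous_Rcomp Rinv).
    - apply continuous_Rplus; simpl; apply continuous_Rmult; try assumption;
      apply continuous_Rmult; try assumption; apply continuous_const.
    - apply continuous_Rinv. exact Hne. }
  apply continuous_pairC; simpl; unfold Rdiv; apply continuous_Rmult; try assumption.
  apply continuous_Ropp; assumption.
Qed.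

Lemma continuous_Cexp {T : UniformSpace} (f : T -> C) (x : T) :
  continuous (U := C_UniformSpace) f x ->
  continuous (U := C_UniformSpace) (fun t => Cexp (f t)) x.
Proof.
  intros Hf. generalize (continuous_Re _ _ Hf) (continuous_Im _ _ Hf). intros HR HI.
  apply continuous_pairC; simpl; apply continuous_Rmult.
  - apply (continuous_Rcomp exp); [assumption|apply continuous_exp].
  - apply (continuous_Rcomp cos); [assumption|apply continuous_cos].
  - apply (continuous_Rcomp exp); [assumption|apply continuous_exp].
  - apply (continuous_Rcomp sin); [assumption|apply continuous_sin].
Qed.

(** * The complex exponential and complex derivatives *)

Lemma Cexp_plus (a b : C) : Cexp (a + b) = (Cexp a * Cexp b)%C.
Proof.
  destruct a as [a1 a2], b as [b1 b2].
  unfold Cexp; apply injective_projections; simpl;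
    rewrite exp_plus, ?cos_plus, ?sin_plus; ring.
Qed.

Lemma Cexp_R (x : R) : Cexp (RtoC x) = RtoC (exp x).
Proof.
  unfold Cexp; apply injective_projections; simpl;
    rewrite ?cos_0, ?sin_0; ring.
Qed.

Lemma Cexp_0 : Cexp 0 = 1%C.
Proof. rewrite Cexp_R, exp_0. reflexivity. Qed.

Lemma Cmod_Cexp (z : C) : Cmod (Cexp z) = exp (Re z).
Proof.
  apply Rsqr_inj; [apply Cmod_ge_0|left; apply exp_pos|]. unfold Rsqr.
  rewrite Cmod_sqr. unfold Cexp; simpl.
  generalize (sin2_cos2 (Im z)). unfold Rsqr. intros E.
  replace (exp (Re z) * exp (Re z)) with (exp (Re z) * exp (Re z) * 1) by ring.
  rewrite <- E. ring.
Qed.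

Lemma Cexp_neq_0 (z : C) : Cexp z <> 0%C.
Proof.
  intros E. generalize (Cmod_Cexp z). rewrite E, Cmod_0.
  generalize (exp_pos (Re z)); lra.
Qed.

Lemma Cexp_opp (z : C) : Cexp (- z) = (/ Cexp z)%C.
Proof.
  assert (H := Cexp_neq_0 z).
  assert (E : (Cexp z * Cexp (- z))%C = 1%C).
  { rewrite <- Cexp_plus. replace (z + - z)%C with (RtoC 0) by ring. apply Cexp_0. }
  replace (Cexp (- z)) with ((Cexp z * Cexp (- z)) / Cexp z)%C by (field; exact H).
  rewrite E. field. exact H.
Qed.

Lemma Cmod_le_ReIm (z : C) : Cmod z <= Rabs (Re z) + Rabs (Im z).
Proof.
  replace z with (RtoC (Re z) + Ci * RtoC (Im z))%C at 1
    by (destruct z; apply injective_projections; simpl; ring).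
  eapply Rle_trans; [apply Cmod_triangle|].
  rewrite Cmod_mult, Cmod_R, Cmod_R.
  assert (E : Cmod Ci = 1) by (unfold Cmod; simpl; transitivity (sqrt 1); [f_equal; ring|apply sqrt_1]).
  rewrite E, Rmult_1_l. right. reflexivity.
Qed.

Lemma Re_le_Cmod (z : C) : Rabs (Re z) <= Cmod z.
Proof. eapply Rle_trans; [apply Rmax_l|apply Rmax_Cmod]. Qed.

Lemma Im_le_Cmod (z : C) : Rabs (Im z) <= Cmod z.
Proof. eapply Rle_trans; [apply Rmax_r|apply Rmax_Cmod]. Qed.

Lemma Cmod_Ci : Cmod Ci = 1.
Proof. unfold Cmod; simpl; transitivity (sqrt 1); [f_equal; ring|apply sqrt_1]. Qed.

Lemma Cmod_minus_sym (a b : C) : Cmod (a - b) = Cmod (b - a).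
Proof. rewrite <- Cmod_opp. f_equal. ring. Qed.

Lemma Cmod_diff_ge (a b : C) : Cmod a - Cmod b <= Cmod (a - b).
Proof.
  assert (H := Cmod_triangle (a - b) b). replace (a - b + b)%C with a in H by ring. lra.
Qed.

(* Caratheodory's form of the derivative, which reduces the differentiation
   rules to continuity. *)
Definition cder (f : C -> C) (z l : C) : Prop :=
  exists p : C -> C, continuous (T := C_UniformSpace) (U := C_UniformSpace) p z
    /\ p z = l /\ forall w, f w = (f z + p w * (w - z))%C.

Lemma continuous_C_eps (f : C -> C) (z : C) :
  continuous (T := C_UniformSpace) (U := C_UniformSpace) f z <->
  forall eps, 0 < eps -> exists d, 0 < d /\
    forall w, Cmod (w - z) < d -> Cmod (f w - f z) < eps.
Proof.
  split.
  - intros H eps He. assert (He2 : 0 < eps / 2) by lra.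
    destruct (proj1 (filterlim_locally _ _) H (mkposreal _ He2)) as [d Hd].
    exists d; split; [apply cond_pos|]. intros w Hw.
    specialize (Hd w (Cmod_ball _ _ _ Hw)). apply ball_Cmod in Hd. simpl in Hd. lra.
  - intros H. apply filterlim_locally. intros eps.
    destruct (H eps (cond_pos eps)) as [d [Hd Hw]].
    assert (Hd2 : 0 < d / 2) by lra. exists (mkposreal _ Hd2). intros w Hb.
    apply Cmod_ball. apply Hw. apply ball_Cmod in Hb. simpl in Hb. lra.
Qed.

Lemma cder_eps (f : C -> C) (z l : C) : cder f z l ->
  forall eps, 0 < eps -> exists d, 0 < d /\ forall w, Cmod (w - z) < d ->
    Cmod (f w - f z - l * (w - z)) <= eps * Cmod (w - z).
Proof.
  intros [p [Hp [Hl Hf]]] eps He.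
  destruct (proj1 (continuous_C_eps p z) Hp eps He) as [d [Hd Hw]].
  exists d; split; [exact Hd|]. intros w Hwd. rewrite (Hf w), <- Hl.
  replace (f z + p w * (w - z) - f z - p z * (w - z))%C with ((p w - p z) * (w - z))%C
    by ring.
  rewrite Cmod_mult. apply Rmult_le_compat_r; [apply Cmod_ge_0|].
  left; apply Hw; exact Hwd.
Qed.

Lemma cder_of_eps (f : C -> C) (z l : C) :
  (forall eps, 0 < eps -> exists d, 0 < d /\ forall w, Cmod (w - z) < d ->
    Cmod (f w - f z - l * (w - z)) <= eps * Cmod (w - z)) -> cder f z l.
Proof.
  intros H.
  exists (fun w => if Ceq_dec w z then l else ((f w - f z) / (w - z))%C).
  split; [|split].
  - apply continuous_C_eps. intros eps He.
    assert (He2 : 0 < eps / 2) by lra.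
    destruct (H _ He2) as [d [Hd Hw]]. exists d; split; [exact Hd|]. intros w Hwd.
    destruct (Ceq_dec z z) as [_|n]; [|contradiction n; reflexivity].
    destruct (Ceq_dec w z) as [e|n].
    + replace (l - l)%C with (RtoC 0) by ring. rewrite Cmod_0. exact He.
    + assert (Hn : (w - z)%C <> 0%C) by (intros E; apply n; replace w with (w - z + z)%C by ring; rewrite E; ring).
      replace ((f w - f z) / (w - z) - l)%C with ((f w - f z - l * (w - z)) / (w - z))%C
        by (field; exact Hn).
      rewrite Cmod_div by exact Hn.
      assert (Hp : 0 < Cmod (w - z)) by (apply Cmod_gt_0; exact Hn).
      apply Rle_lt_trans with (eps / 2); [|lra].
      apply Rmult_le_reg_r with (Cmod (w - z)); [exact Hp|].
      unfold Rdiv at 1. rewrite Rmult_assoc, Rinv_l, Rmult_1_r by lra.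
      apply Hw; exact Hwd.
  - destruct (Ceq_dec z z) as [_|n]; [reflexivity|contradiction n; reflexivity].
  - intros w. destruct (Ceq_dec w z) as [e|n].
    + rewrite e. ring.
    + assert (Hn : (w - z)%C <> 0%C) by (intros E; apply n; replace w with (w - z + z)%C by ring; rewrite E; ring).
      field. exact Hn.
Qed.

Lemma cder_of_derive (f : C -> C) (z : C) :
  ex_derive (K := C_AbsRing) (V := C_NormedModule) f z -> exists l, cder f z l.
Proof.
  intros [l [_ Hd]]. exists l. apply cder_of_eps. intros eps He.
  assert (Hz : is_filter_lim (locally (T := AbsRing_UniformSpace C_AbsRing) z) z)
    by (intros P HP; exact HP).
  destruct (Hd z Hz (mkposreal _ He)) as [d Hdd].
  exists d; split; [apply cond_pos|]. intros w Hw.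
  specialize (Hdd w Hw). simpl in Hdd.
  replace (f w - f z - l * (w - z))%C with (f w - f z - (w - z) * l)%C by ring.
  exact Hdd.
Qed.

Lemma cder_continuous (f : C -> C) (z l : C) : cder f z l ->
  continuous (T := C_UniformSpace) (U := C_UniformSpace) f z.
Proof.
  intros [p [Hp [Hl Hf]]].
  apply continuous_ext with (f := fun w => (f z + p w * (w - z))%C).
  { intros w; symmetry; apply Hf. }
  apply continuous_Cplus; [apply continuous_const|].
  apply continuous_Cmult; [exact Hp|].
  apply continuous_Cminus; [apply continuous_id|apply continuous_const].
Qed.

Lemma cder_const (c z : C) : cder (fun _ => c) z 0%C.
Proof.
  exists (fun _ => 0%C). split; [apply continuous_const|]. split; [reflexivity|].
  intros; ring.
Qed.

Lemma cder_id (z : C) : cder (fun w => w) z 1%C.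
Proof.
  exists (fun _ => 1%C). split; [apply continuous_const|]. split; [reflexivity|].
  intros; ring.
Qed.

Lemma cder_plus (f g : C -> C) (z l m : C) : cder f z l -> cder g z m ->
  cder (fun w => (f w + g w)%C) z (l + m)%C.
Proof.
  intros [p [Hp [Hl Hf]]] [r [Hr [Hm Hg]]]. exists (fun w => (p w + r w)%C).
  split; [apply continuous_Cplus; assumption|]. split; [rewrite Hl, Hm; reflexivity|].
  intros w. rewrite (Hf w), (Hg w). ring.
Qed.

Lemma cder_mult (f g : C -> C) (z l m : C) : cder f z l -> cder g z m ->
  cder (fun w => (f w * g w)%C) z (l * g z + f z * m)%C.
Proof.
  intros Df Dg. assert (Cg := cder_continuous _ _ _ Dg).
  destruct Df as [p [Hp [Hl Hf]]]; destruct Dg as [r [Hr [Hm Hg]]].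
  exists (fun w => (p w * g w + f z * r w)%C).
  split; [|split; [rewrite Hl, Hm; reflexivity|]].
  - apply continuous_Cplus; apply continuous_Cmult; try assumption; apply continuous_const.
  - intros w. rewrite (Hf w), (Hg w). ring.
Qed.

Lemma cder_comp (f g : C -> C) (z l m : C) : cder f (g z) l -> cder g z m ->
  cder (fun w => f (g w)) z (l * m)%C.
Proof.
  intros Df Dg. assert (Cg := cder_continuous _ _ _ Dg).
  destruct Df as [p [Hp [Hl Hf]]]; destruct Dg as [r [Hr [Hm Hg]]].
  exists (fun w => (p (g w) * r w)%C).
  split; [|split; [rewrite Hl, Hm; reflexivity|]].
  - apply continuous_Cmult; [|assumption].
    apply (continuous_comp (U := C_UniformSpace) (V := C_UniformSpace) (W := C_UniformSpace) g p); assumption.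
  - intros w. rewrite (Hf (g w)), (Hg w). ring.
Qed.

Lemma cder_ext (f g : C -> C) (z l : C) :
  (forall w, f w = g w) -> cder f z l -> cder g z l.
Proof.
  intros E [p [Hp [Hl Hf]]]. exists p. split; [exact Hp|]. split; [exact Hl|].
  intros w. rewrite <- !E. apply Hf.
Qed.

(** [cder] asks for a factorisation on all of [C], so agreement on a disc has to be transferred
    through the epsilon form. *)
Lemma cder_ext_loc (f g : C -> C) (z l : C) (r : R) : 0 < r ->
  (forall w, Cmod (w - z) < r -> f w = g w) -> cder f z l -> cder g z l.
Proof.
  intros Hr E H. apply cder_of_eps. intros eps He.
  destruct (cder_eps _ _ _ H eps He) as [d [Hd Hw]].
  exists (Rmin d r). split; [apply Rmin_pos; assumption|]. intros w Hwd.
  rewrite <- (E w), <- (E z).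
  - apply Hw. eapply Rlt_le_trans; [exact Hwd|apply Rmin_l].
  - replace (z - z)%C with (RtoC 0) by ring. rewrite Cmod_0; exact Hr.
  - eapply Rlt_le_trans; [exact Hwd|apply Rmin_r].
Qed.

(** * Complex-valued functions of a real variable; Taylor bounds for the exponential *)

Lemma is_derive_pairC (f : R -> C) (x : R) (l : C) :
  is_derive (fun t => Re (f t)) x (Re l) -> is_derive (fun t => Im (f t)) x (Im l) ->
  is_derive (V := C_R_NormedModule) f x l.
Proof.
  intros H1 H2.
  assert (H : is_derive (V := C_R_NormedModule)
    (fun t : R => (Re (f t), Im (f t))) x l).
  { unfold is_derive in *.
    apply (filterdiff_ext_lin _ (fun t : R => (scal t (Re l), scal t (Im l)) : C_R_NormedModule)).
    - apply (filterdiff_comp_2 (fun t => Re (f t)) (fun t => Im (f t))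
        (fun a b => (a, b) : C_R_NormedModule)); try assumption.
      apply filterdiff_linear. split.
      + intros [a b] [c d]. reflexivity.
      + intros k [a b]. reflexivity.
      + exists 1; split; [lra|]. intros [a b]. rewrite Rmult_1_l. right. reflexivity.
    - intros t. reflexivity. }
  apply (is_derive_ext (V := C_R_NormedModule) (fun t => (Re (f t), Im (f t)))); [|exact H].
  intros t. destruct (f t); reflexivity.
Qed.

Lemma is_derive_Re (f : R -> C) (x : R) (l : C) :
  is_derive (V := C_R_NormedModule) f x l -> is_derive (fun t => Re (f t)) x (Re l).
Proof.
  intros H. unfold is_derive in *.
  apply (filterdiff_ext_lin _ (fun y : R => fst (scal y (l : C_R_NormedModule)))).
  - apply (filterdiff_comp' f (fun z : C_R_NormedModule => fst z)); [exact H|].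
    apply filterdiff_linear. apply (is_linear_fst (U := R_NormedModule) (V := R_NormedModule)).
  - intros y. reflexivity.
Qed.

Lemma is_derive_Im (f : R -> C) (x : R) (l : C) :
  is_derive (V := C_R_NormedModule) f x l -> is_derive (fun t => Im (f t)) x (Im l).
Proof.
  intros H. unfold is_derive in *.
  apply (filterdiff_ext_lin _ (fun y : R => snd (scal y (l : C_R_NormedModule)))).
  - apply (filterdiff_comp' f (fun z : C_R_NormedModule => snd z)); [exact H|].
    apply filterdiff_linear. apply (is_linear_snd (U := R_NormedModule) (V := R_NormedModule)).
  - intros y. reflexivity.
Qed.

Lemma is_derive_RtoC (f : R -> R) (x l : R) :
  is_derive f x l -> is_derive (V := C_R_NormedModule) (fun t => RtoC (f t)) x (RtoC l).
Proof.
  intros H. apply is_derive_pairC; simpl; [exact H|].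
  apply (is_derive_const (V := R_NormedModule)).
Qed.

Lemma is_derive_Cmult (f g : R -> C) (x : R) (l m : C) :
  is_derive (V := C_R_NormedModule) f x l -> is_derive (V := C_R_NormedModule) g x m ->
  is_derive (V := C_R_NormedModule) (fun t => (f t * g t)%C) x (l * g x + f x * m)%C.
Proof.
  intros Hf Hg.
  assert (Fr := is_derive_Re _ _ _ Hf). assert (Fi := is_derive_Im _ _ _ Hf).
  assert (Gr := is_derive_Re _ _ _ Hg). assert (Gi := is_derive_Im _ _ _ Hg).
  apply is_derive_pairC.
  - replace (Re (l * g x + f x * m)) with
      ((Re l * Re (g x) + Re (f x) * Re m) - (Im l * Im (g x) + Im (f x) * Im m))
      by (simpl; unfold Re, Im; ring).
    apply (is_derive_minus (V := R_NormedModule) (fun t => Re (f t) * Re (g t))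
      (fun t => Im (f t) * Im (g t)));
      apply (is_derive_mult (K := R_AbsRing)); try assumption; intros; apply Rmult_comm.
  - replace (Im (l * g x + f x * m)) with
      ((Re l * Im (g x) + Re (f x) * Im m) + (Im l * Re (g x) + Im (f x) * Re m))
      by (simpl; unfold Re, Im; ring).
    apply (is_derive_plus (V := R_NormedModule) (fun t => Re (f t) * Im (g t))
      (fun t => Im (f t) * Re (g t)));
      apply (is_derive_mult (K := R_AbsRing)); try assumption; intros; apply Rmult_comm.
Qed.

Lemma is_derive_Cscal (c : C) (f : R -> C) (x : R) (l : C) :
  is_derive (V := C_R_NormedModule) f x l ->
  is_derive (V := C_R_NormedModule) (fun t => (c * f t)%C) x (c * l)%C.
Proof.
  intros H. replace (c * l)%C with (0 * f x + c * l)%C by ring.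
  apply (is_derive_Cmult (fun _ => c) f); [|exact H].
  apply (is_derive_const (V := C_R_NormedModule)).
Qed.

(** The mean value theorem fails for complex values; the inequality comes from integrating the
    derivative. *)
Lemma Cmvt (f f' : R -> C) (M : R) :
  (forall t, 0 <= t <= 1 -> is_derive (V := C_R_NormedModule) f t (f' t)) ->
  (forall t, 0 <= t <= 1 -> continuous (U := C_UniformSpace) f' t) ->
  (forall t, 0 <= t <= 1 -> Cmod (f' t) <= M) -> Cmod (f 1 - f 0) <= M.
Proof.
  intros Hd Hc HM.
  assert (H : is_RInt (V := C_R_NormedModule) f' 0 1 (minus (f 1) (f 0))).
  { apply (is_RInt_derive (V := C_R_CompleteNormedModule) f f');
      rewrite Rmin_left, Rmax_right by lra; assumption. }
  rewrite <- C_norm. replace M with ((1 - 0) * M) by ring.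
  apply (norm_RInt_le_const (V := C_R_NormedModule) f' 0 1 _ M Rle_0_1); [|exact H].
  intros x Hx. rewrite C_norm. apply HM. exact Hx.
Qed.

Lemma is_derive_Cexp_ray (w : C) (t : R) :
  is_derive (V := C_R_NormedModule) (fun t : R => Cexp (RtoC t * w)) t
    (w * Cexp (RtoC t * w))%C.
Proof.
  destruct w as [a b]. apply is_derive_pairC; simpl.
  - auto_derive; [trivial|]. unfold Rminus; ring.
  - auto_derive; [trivial|]. unfold Rminus; ring.
Qed.

Lemma Cmod_Cexp_ray_le (w : C) (t : R) : 0 <= t <= 1 ->
  Cmod (Cexp (RtoC t * w)) <= exp (Cmod w).
Proof.
  intros Ht. rewrite Cmod_Cexp.
  assert (H : Re (RtoC t * w) <= Cmod w).
  { simpl. generalize (Re_le_Cmod w). unfold Re. intros H.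
    generalize (Rle_abs (fst w)) (Rabs_pos (fst w)). intros. nra. }
  destruct H as [H|H]; [left; apply exp_increasing; exact H|right; rewrite H; reflexivity].
Qed.

Lemma Cexp_sub1_bound (w : C) : Cmod (Cexp w - 1) <= Cmod w * exp (Cmod w).
Proof.
  replace (Cexp w - 1)%C with (Cexp (RtoC 1 * w) - Cexp (RtoC 0 * w))%C.
  2: { replace (RtoC 1 * w)%C with w by ring. replace (RtoC 0 * w)%C with (RtoC 0) by ring.
       rewrite Cexp_0. reflexivity. }
  apply (Cmvt (fun t => Cexp (RtoC t * w)) (fun t => (w * Cexp (RtoC t * w))%C)).
  - intros; apply is_derive_Cexp_ray.
  - intros. apply continuous_Cmult; [apply continuous_const|]. apply continuous_Cexp.
    apply continuous_Cmult; [apply continuous_RtoC, continuous_id|apply continuous_const].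
  - intros t Ht. rewrite Cmod_mult. apply Rmult_le_compat_l; [apply Cmod_ge_0|].
    apply Cmod_Cexp_ray_le; exact Ht.
Qed.

(** Along the ray [t * w] the derivative of the remainder is [w] times the first-order remainder,
    which [Cexp_sub1_bound] controls. *)
Lemma Cexp_sub2_bound (w : C) :
  Cmod (Cexp w - 1 - w) <= Cmod w * Cmod w * exp (Cmod w).
Proof.
  replace (Cexp w - 1 - w)%C with
    ((Cexp (RtoC 1 * w) - RtoC 1 * w) - (Cexp (RtoC 0 * w) - RtoC 0 * w))%C.
  2: { replace (RtoC 1 * w)%C with w by ring. replace (RtoC 0 * w)%C with (RtoC 0) by ring.
       rewrite Cexp_0. ring. }
  apply (Cmvt (fun t => Cexp (RtoC t * w) - RtoC t * w)%C
              (fun t => (w * (Cexp (RtoC t * w) - 1))%C)).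
  - intros t _. destruct w as [a b]; apply is_derive_pairC; simpl;
      (auto_derive; [trivial|]; unfold Rminus; ring).
  - intros. apply continuous_Cmult; [apply continuous_const|].
    apply continuous_Cminus; [|apply continuous_const]. apply continuous_Cexp.
    apply continuous_Cmult; [apply continuous_RtoC, continuous_id|apply continuous_const].
  - intros t Ht. rewrite Cmod_mult, Rmult_assoc.
    apply Rmult_le_compat_l; [apply Cmod_ge_0|].
    eapply Rle_trans; [apply Cexp_sub1_bound|].
    assert (Hm : Cmod (RtoC t * w) <= Cmod w).
    { rewrite Cmod_mult, Cmod_R, Rabs_pos_eq by lra. generalize (Cmod_ge_0 w); nra. }
    apply Rmult_le_compat; [apply Cmod_ge_0|left; apply exp_pos|exact Hm|].
    destruct Hm as [Hm|Hm]; [left; apply exp_increasing; exact Hm|right; rewrite Hm; reflexivity].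
Qed.

Arguments Cexp_sub2_bound w%_C.

Lemma cder_Cexp (z : C) : cder Cexp z (Cexp z).
Proof.
  apply cder_of_eps. intros eps He.
  (* On the unit disc around [z] the second-order remainder is at most [K * |w - z| ^ 2]. *)
  set (K := exp (Re z) * exp 1). assert (HK : 0 < K) by (apply Rmult_lt_0_compat; apply exp_pos).
  exists (Rmin 1 (eps / K)).
  split; [apply Rmin_pos; [lra|apply Rdiv_lt_0_compat; assumption]|].
  intros w Hw.
  assert (H1 : Cmod (w - z) < 1) by (eapply Rlt_le_trans; [exact Hw|apply Rmin_l]).
  assert (H2 : Cmod (w - z) < eps / K) by (eapply Rlt_le_trans; [exact Hw|apply Rmin_r]).
  replace (Cexp w - Cexp z - Cexp z * (w - z))%C with
    (Cexp z * (Cexp (w - z) - 1 - (w - z)))%C.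
  2: { replace (Cexp w) with (Cexp (z + (w - z))) by (f_equal; ring).
       rewrite Cexp_plus. ring. }
  rewrite Cmod_mult, Cmod_Cexp.
  assert (H3 := Cexp_sub2_bound (w - z)). assert (H4 := Cmod_ge_0 (w - z)).
  assert (H5 : exp (Cmod (w - z)) <= exp 1) by (left; apply exp_increasing; exact H1).
  apply Rle_trans with (exp (Re z) * (Cmod (w - z) * Cmod (w - z) * exp 1)).
  - apply Rmult_le_compat_l; [left; apply exp_pos|].
    eapply Rle_trans; [exact H3|]. apply Rmult_le_compat_l; [nra|exact H5].
  - replace (exp (Re z) * (Cmod (w - z) * Cmod (w - z) * exp 1))
      with (Cmod (w - z) * K * Cmod (w - z)) by (unfold K; ring).
    apply Rmult_le_compat_r; [exact H4|].
    apply Rmult_le_reg_r with (/ K); [apply Rinv_0_lt_compat; exact HK|].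
    rewrite Rmult_assoc, Rinv_r, Rmult_1_r by lra. left; exact H2.
Qed.

(** The slope [- / (w * z)] is exact for [w <> 0]; the disc of radius [Cmod z] around [z] avoids
    0. *)
Lemma cder_Cinv (z : C) : z <> 0%C -> cder Cinv z (- (/ z * / z))%C.
Proof.
  intros Hz. apply (cder_ext_loc (fun w => / z + (- (/ w * / z)) * (w - z))%C _ z _ (Cmod z)).
  - apply Cmod_gt_0; exact Hz.
  - intros w Hw. assert (w <> 0%C).
    { intros E; rewrite E in Hw. replace (0 - z)%C with (- z)%C in Hw by ring.
      rewrite Cmod_opp in Hw. lra. }
    field. split; assumption.
  - exists (fun w => (- (/ w * / z))%C). split; [|split; [reflexivity|intros w; ring]].
    apply continuous_Copp, continuous_Cmult; [|apply continuous_const].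
    apply (continuous_Cinv (fun w => w)); [apply continuous_id|exact Hz].
Qed.

(** * Rules for complex differentiability *)

Definition cdiff (f : C -> C) (z : C) : Prop := exists l, cder f z l.

Lemma cdiff_const (c z : C) : cdiff (fun _ => c) z.
Proof. eexists; apply cder_const. Qed.

Lemma cdiff_id (z : C) : cdiff (fun w => w) z.
Proof. eexists; apply cder_id. Qed.

Lemma cdiff_plus (f g : C -> C) (z : C) : cdiff f z -> cdiff g z ->
  cdiff (fun w => (f w + g w)%C) z.
Proof. intros [l Hl] [m Hm]; eexists; apply cder_plus; eassumption. Qed.

Lemma cdiff_mult (f g : C -> C) (z : C) : cdiff f z -> cdiff g z ->
  cdiff (fun w => (f w * g w)%C) z.
Proof. intros [l Hl] [m Hm]; eexists; apply cder_mult; eassumption. Qed.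

Lemma cdiff_opp (f : C -> C) (z : C) : cdiff f z -> cdiff (fun w => (- f w)%C) z.
Proof.
  intros H. assert (H1 := cdiff_mult _ _ _ (cdiff_const (-1)%C z) H).
  destruct H1 as [l Hl]. exists l. eapply cder_ext; [|exact Hl]. intros w; simpl. ring.
Qed.

Lemma cdiff_minus (f g : C -> C) (z : C) : cdiff f z -> cdiff g z ->
  cdiff (fun w => (f w - g w)%C) z.
Proof. intros; apply cdiff_plus; [|apply cdiff_opp]; assumption. Qed.

Lemma cdiff_comp (f g : C -> C) (z : C) : cdiff f (g z) -> cdiff g z ->
  cdiff (fun w => f (g w)) z.
Proof. intros [l Hl] [m Hm]; eexists; apply cder_comp; eassumption. Qed.

Lemma cdiff_exp (f : C -> C) (z : C) : cdiff f z -> cdiff (fun w => Cexp (f w)) z.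
Proof. intros; apply (cdiff_comp Cexp); [eexists; apply cder_Cexp|assumption]. Qed.

Lemma cdiff_inv (f : C -> C) (z : C) : cdiff f z -> f z <> 0%C ->
  cdiff (fun w => (/ f w)%C) z.
Proof.
  intros; apply (cdiff_comp Cinv); [eexists; apply cder_Cinv; assumption|assumption].
Qed.

Lemma cdiff_continuous (f : C -> C) (z : C) : cdiff f z ->
  continuous (T := C_UniformSpace) (U := C_UniformSpace) f z.
Proof. intros [l H]; eapply cder_continuous; exact H. Qed.

(** * Integrals of complex-valued functions over segments *)

Definition is_Cint (f : R -> C) (a b : R) (l : C) : Prop :=
  is_RInt (V := C_R_NormedModule) f a b l.
Definition Cint (f : R -> C) (a b : R) : C :=
  RInt (V := C_R_CompleteNormedModule) f a b.
Definition ccont (f : R -> C) : Prop :=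
  forall u, continuous (T := R_UniformSpace) (U := C_UniformSpace) f u.

Lemma scal_C (k : R) (z : C) : scal k (z : C_R_NormedModule) = (RtoC k * z)%C.
Proof. destruct z; apply injective_projections; simpl; unfold scal; simpl; unfold mult; simpl; ring. Qed.

Lemma is_Cint_unique (f : R -> C) (a b : R) (l : C) : is_Cint f a b l -> Cint f a b = l.
Proof. apply (is_RInt_unique (V := C_R_CompleteNormedModule)). Qed.

Lemma is_Cint_cont (f : R -> C) (a b : R) :
  (forall u, Rmin a b <= u <= Rmax a b ->
     continuous (T := R_UniformSpace) (U := C_UniformSpace) f u) ->
  is_Cint f a b (Cint f a b).
Proof.
  intros H. apply (RInt_correct (V := C_R_CompleteNormedModule)).
  apply (ex_RInt_continuous (V := C_R_CompleteNormedModule)). exact H.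
Qed.

Lemma Cint_correct (f : R -> C) (a b : R) : ccont f -> is_Cint f a b (Cint f a b).
Proof. intros H. apply is_Cint_cont. intros; apply H. Qed.

Lemma is_Cint_parts (f : R -> C) (a b : R) (l : C) :
  is_RInt (fun t => Re (f t)) a b (Re l) -> is_RInt (fun t => Im (f t)) a b (Im l) ->
  is_Cint f a b l.
Proof.
  intros H1 H2. replace l with (Re l, Im l) by (destruct l; reflexivity).
  apply (is_RInt_fct_extend_pair (U := R_NormedModule) (V := R_NormedModule)); assumption.
Qed.

Lemma is_Cint_Re (f : R -> C) (a b : R) (l : C) :
  is_Cint f a b l -> is_RInt (fun t => Re (f t)) a b (Re l).
Proof.
  intros H. exact (is_RInt_fct_extend_fst (U := R_NormedModule) (V := R_NormedModule) f a b l H).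
Qed.

Lemma is_Cint_Im (f : R -> C) (a b : R) (l : C) :
  is_Cint f a b l -> is_RInt (fun t => Im (f t)) a b (Im l).
Proof.
  intros H. exact (is_RInt_fct_extend_snd (U := R_NormedModule) (V := R_NormedModule) f a b l H).
Qed.

Lemma is_Cint_ext (f g : R -> C) (a b : R) (l : C) :
  (forall x, Rmin a b < x < Rmax a b -> f x = g x) -> is_Cint f a b l -> is_Cint g a b l.
Proof. apply (is_RInt_ext (V := C_R_NormedModule)). Qed.

Lemma is_Cint_plus (f g : R -> C) (a b : R) (l m : C) :
  is_Cint f a b l -> is_Cint g a b m -> is_Cint (fun t => (f t + g t)%C) a b (l + m)%C.
Proof. apply (is_RInt_plus (V := C_R_NormedModule)). Qed.

Lemma is_Cint_scal (c : C) (f : R -> C) (a b : R) (l : C) :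
  is_Cint f a b l -> is_Cint (fun t => (c * f t)%C) a b (c * l)%C.
Proof.
  intros H. generalize (is_Cint_Re _ _ _ _ H) (is_Cint_Im _ _ _ _ H). intros HR HI.
  apply is_Cint_parts; simpl.
  - apply (is_RInt_minus (V := R_NormedModule));
      apply (is_RInt_scal (V := R_NormedModule)); assumption.
  - apply (is_RInt_plus (V := R_NormedModule));
      apply (is_RInt_scal (V := R_NormedModule)); assumption.
Qed.

Lemma is_Cint_minus (f g : R -> C) (a b : R) (l m : C) :
  is_Cint f a b l -> is_Cint g a b m -> is_Cint (fun t => (f t - g t)%C) a b (l - m)%C.
Proof. apply (is_RInt_minus (V := C_R_NormedModule)). Qed.

Lemma is_Cint_Chasles (f : R -> C) (a b c : R) (l m : C) :
  is_Cint f a b l -> is_Cint f b c m -> is_Cint f a c (l + m)%C.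
Proof. apply (is_RInt_Chasles (V := C_R_NormedModule)). Qed.

Lemma is_Cint_swap (f : R -> C) (a b : R) (l : C) : is_Cint f b a l -> is_Cint f a b (- l)%C.
Proof. apply (is_RInt_swap (V := C_R_NormedModule)). Qed.

Lemma is_Cint_shift (f : R -> C) (c a b : R) (l : C) :
  is_Cint f (a + c) (b + c) l -> is_Cint (fun t => f (t + c)) a b l.
Proof.
  intros H. apply is_Cint_ext with (f := fun y => scal 1 (f (1 * y + c) : C_R_NormedModule)).
  - intros x _. rewrite scal_C, Rmult_1_l. ring.
  - apply (is_RInt_comp_lin (V := C_R_NormedModule)). rewrite !Rmult_1_l. exact H.
Qed.

Lemma is_Cint_lin (f : R -> C) (k v a b : R) (l : C) : k <> 0 ->
  is_Cint f (k * a + v) (k * b + v) l -> is_Cint (fun t => f (k * t + v)) a b (RtoC (/ k) * l)%C.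
Proof.
  intros Hk H.
  apply is_Cint_ext with (f := fun y : R => (RtoC (/ k) * scal k (f (k * y + v)%R : C_R_NormedModule))%C).
  - intros x _. rewrite scal_C, Cmult_assoc, <- RtoC_mult, Rinv_l by exact Hk. ring.
  - apply is_Cint_scal. apply (is_RInt_comp_lin (V := C_R_NormedModule)). exact H.
Qed.

Lemma is_Cint_derive (f df : R -> C) (a b : R) :
  (forall x, Rmin a b <= x <= Rmax a b -> is_derive (V := C_R_NormedModule) f x (df x)) ->
  (forall x, Rmin a b <= x <= Rmax a b ->
     continuous (T := R_UniformSpace) (U := C_UniformSpace) df x) ->
  is_Cint df a b (f b - f a)%C.
Proof. apply (is_RInt_derive (V := C_R_CompleteNormedModule)). Qed.

Lemma is_Cint_bound (f : R -> C) (a b : R) (l : C) (g : R -> R) (lg : R) : a <= b ->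
  (forall x, a <= x <= b -> Cmod (f x) <= g x) ->
  is_Cint f a b l -> is_RInt g a b lg -> Cmod l <= lg.
Proof.
  intros Hab H1 H2 H3. rewrite <- C_norm.
  apply (norm_RInt_le (V := C_R_NormedModule) f g a b); try assumption.
  intros; rewrite C_norm; auto.
Qed.

Lemma is_Cint_bound_const (f : R -> C) (a b : R) (l : C) (M : R) : a <= b ->
  (forall x, a <= x <= b -> Cmod (f x) <= M) -> is_Cint f a b l -> Cmod l <= (b - a) * M.
Proof.
  intros Hab H1 H2. rewrite <- C_norm.
  apply (norm_RInt_le_const (V := C_R_NormedModule) f); try assumption.
  intros; rewrite C_norm; auto.
Qed.

Lemma is_Cint_unique2 (f : R -> C) (a b : R) (l m : C) : is_Cint f a b l -> is_Cint f a b m -> l = m.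
Proof. intros H1 H2. rewrite <- (is_Cint_unique _ _ _ _ H1). apply is_Cint_unique; exact H2. Qed.

Lemma Cint_Chasles (f : R -> C) (a b c : R) : ccont f ->
  (Cint f a b + Cint f b c)%C = Cint f a c.
Proof.
  intros H. symmetry. apply is_Cint_unique. apply is_Cint_Chasles with b; apply Cint_correct; exact H.
Qed.

(** * Absolutely convergent integrals over the real line *)

(** The constants stay visible because uniformity in parameters is needed later: the rate [e] must
    be common to a family and the bound must be linear in [M]. *)
Definition edom (f : R -> C) (M e : R) : Prop :=
  ccont f /\ 0 < e /\ forall u, Cmod (f u) <= M * exp (- e * Rabs u).
Definition dexp (f : R -> C) : Prop := exists M e, edom f M e.
Definition line (f : R -> C) : C :=
  RInt_gen (V := C_R_CompleteNormedModule) f (Rbar_locally m_infty) (Rbar_locally p_infty).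
Definition is_line (f : R -> C) (l : C) : Prop :=
  is_RInt_gen (V := C_R_NormedModule) f (Rbar_locally m_infty) (Rbar_locally p_infty) l.

Lemma edom_pos (f : R -> C) (M e : R) : edom f M e -> 0 <= M.
Proof.
  intros [_ [_ H]]. specialize (H 0). rewrite Rabs_R0, Rmult_0_r, exp_0 in H.
  generalize (Cmod_ge_0 (f 0)); lra.
Qed.

Lemma is_RInt_exp_tail (M e a b : R) : e <> 0 ->
  is_RInt (fun u => M * exp (- e * u)) a b (M / e * (exp (- e * a) - exp (- e * b))).
Proof.
  intros He.
  replace (M / e * (exp (- e * a) - exp (- e * b))) with
    (minus (- (M / e) * exp (- e * b)) (- (M / e) * exp (- e * a)))
    by (unfold minus, plus, opp; simpl; ring).
  apply (is_RInt_derive (fun u => - (M / e) * exp (- e * u))).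
  - intros x _. auto_derive; [trivial|]. field. exact He.
  - intros x _. apply (ex_derive_continuous (V := R_NormedModule)). auto_derive. trivial.
Qed.

Lemma edom_tail_pos (f : R -> C) (M e a b : R) : edom f M e -> 0 <= a -> a <= b ->
  Cmod (Cint f a b) <= M / e * exp (- e * a).
Proof.
  intros H Ha Hab. assert (HM := edom_pos _ _ _ H). destruct H as [Hc [He Hb]].
  apply Rle_trans with (M / e * (exp (- e * a) - exp (- e * b))).
  - apply (is_Cint_bound f a b _ (fun u => M * exp (- e * u))); [exact Hab| | |].
    + intros x Hx. eapply Rle_trans; [apply Hb|]. rewrite Rabs_pos_eq by lra. right; reflexivity.
    + apply Cint_correct; exact Hc.
    + apply is_RInt_exp_tail. lra.
  - apply Rmult_le_compat_l.
    + apply Rdiv_le_0_compat; assumption.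
    + generalize (exp_pos (- e * b)); lra.
Qed.

Lemma edom_opp_arg (f : R -> C) (M e : R) : edom f M e -> edom (fun u => f (- u)) M e.
Proof.
  intros [Hc [He Hb]]. split; [|split; [exact He|]].
  - intros u. apply (continuous_comp (U := R_UniformSpace) (V := R_UniformSpace) (W := C_UniformSpace) Ropp f).
    + apply continuous_Ropp, continuous_id.
    + apply Hc.
  - intros u. rewrite <- (Rabs_Ropp u). apply Hb.
Qed.

Lemma Cint_opp_arg (f : R -> C) (a b : R) : ccont f ->
  Cint (fun u => f (- u)) a b = Cint f (- b)%R (- a)%R.
Proof.
  intros Hc. apply is_Cint_unique.
  assert (H := is_RInt_comp_opp (V := C_R_NormedModule) f a b _ (Cint_correct f (- a) (- b) Hc)).
  apply is_Cint_ext with (f := fun y : R => (-1 * - f (- y)%R)%C).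
  - intros; ring.
  - replace (Cint f (- b)%R (- a)%R) with (-1 * Cint f (- a)%R (- b)%R)%C.
    + apply (is_Cint_scal (-1)%C). exact H.
    + symmetry. apply is_Cint_unique.
      replace (-1 * Cint f (- a)%R (- b)%R)%C with (- Cint f (- a)%R (- b)%R)%C by ring.
      apply is_Cint_swap, Cint_correct. exact Hc.
Qed.

Lemma edom_tail_neg (f : R -> C) (M e a b : R) : edom f M e -> 0 <= a -> a <= b ->
  Cmod (Cint f (- b)%R (- a)%R) <= M / e * exp (- e * a).
Proof.
  intros H Ha Hab. rewrite <- Cint_opp_arg by apply H.
  apply edom_tail_pos; try assumption. apply edom_opp_arg; exact H.
Qed.

Lemma edom_tail (f : R -> C) (M e T a b : R) : edom f M e -> 0 <= T -> a <= - T -> T <= b ->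
  Cmod (Cint f a b - Cint f (- T)%R T) <= 2 * M / e * exp (- e * T).
Proof.
  intros H HT Ha Hb. assert (Hc : ccont f) by apply H.
  replace (Cint f a b - Cint f (- T)%R T)%C with (Cint f a (- T)%R + Cint f T b)%C.
  2: { rewrite <- (Cint_Chasles f a (- T) b Hc), <- (Cint_Chasles f (- T) T b Hc). ring. }
  eapply Rle_trans; [apply Cmod_triangle|].
  assert (H1 := edom_tail_pos f M e T b H HT Hb).
  assert (H2 := edom_tail_neg f M e T (- a) H HT ltac:(lra)). rewrite Ropp_involutive in H2.
  unfold Rdiv in *. lra.
Qed.

Lemma exp_small (K e eps : R) : 0 < e -> 0 < eps ->
  exists T, 0 <= T /\ forall t, T <= t -> K * exp (- e * t) < eps.
Proof.
  intros He Heps. set (K' := Rabs K + 1). assert (HK : 0 < K') by (generalize (Rabs_pos K); unfold K'; lra).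
  (* From [exp (- x) * (1 + x) <= 1], the inequality [K' <= e * eps * t] already forces
     [K' * exp (- e * t) < eps]. *)
  exists (K' / (e * eps)). split.
  - left; apply Rdiv_lt_0_compat; [exact HK|apply Rmult_lt_0_compat; assumption].
  - intros t Ht.
    assert (H1 : exp (- e * t) * (1 + e * t) <= 1).
    { assert (H0 := exp_ineq1_le (e * t)).
      replace 1 with (exp (- e * t) * exp (e * t)) at 2.
      - apply Rmult_le_compat_l; [left; apply exp_pos|exact H0].
      - rewrite <- exp_plus. rewrite <- exp_0. f_equal. ring. }
    assert (H2 : K' <= e * eps * t).
    { apply Rmult_le_reg_r with (/ (e * eps)).
      - apply Rinv_0_lt_compat, Rmult_lt_0_compat; assumption.
      - replace (e * eps * t * / (e * eps)) with t by (field; lra). exact Ht. }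
    assert (H3 : K <= K') by (generalize (Rle_abs K); unfold K'; lra).
    assert (H4 := exp_pos (- e * t)).
    assert (H5 : K * exp (- e * t) <= K' * exp (- e * t)) by (apply Rmult_le_compat_r; lra).
    assert (H6 : K' * exp (- e * t) <= e * eps * t * exp (- e * t)) by (apply Rmult_le_compat_r; lra).
    assert (H7 : eps * exp (- e * t) > 0) by (apply Rmult_lt_0_compat; assumption).
    nra.
Qed.

Lemma is_line_unique (f : R -> C) (l : C) : is_line f l -> line f = l.
Proof.
  intros H. unfold line.
  exact (is_RInt_gen_unique (V := C_R_CompleteNormedModule)
    (Fa := Rbar_locally m_infty) (Fb := Rbar_locally p_infty) f l H).
Qed.

(** Convergence is Cauchy's criterion on the pair of end points. The tail estimate then follows by
    comparing [[a, b]] with a larger interval whose integral is close to the limit. *)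
Lemma line_spec (f : R -> C) (M e : R) : edom f M e ->
  is_line f (line f) /\
  forall T a b, 0 <= T -> a <= - T -> T <= b ->
    Cmod (line f - Cint f a b) <= 2 * M / e * exp (- e * T).
Proof.
  intros H. assert (Hc : ccont f) by apply H. assert (He : 0 < e) by apply H.
  assert (HM := edom_pos _ _ _ H).
  destruct (proj1 (filterlim_locally_cauchy (U := C_R_CompleteNormedModule)
    (F := filter_prod (Rbar_locally m_infty) (Rbar_locally p_infty))
    (fun ab => Cint f (fst ab) (snd ab)))) as [l Hl].
  { intros eps. destruct (exp_small (2 * M / e) e (eps / 2) He) as [T [HT HTe]].
    { generalize (cond_pos eps); lra. }
    exists (fun ab => fst ab <= - T /\ T <= snd ab). split.
    - exists (fun a => a < - T) (fun b => T < b).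
      + exists (- T); intros; assumption.
      + exists T; intros; assumption.
      + intros; simpl; lra.
    - intros u v [Hu1 Hu2] [Hv1 Hv2]. apply Cmod_ball.
      replace (Cint f (fst v) (snd v) - Cint f (fst u) (snd u))%C with
        ((Cint f (fst v) (snd v) - Cint f (- T)%R T) + - (Cint f (fst u) (snd u) - Cint f (- T)%R T))%C
        by ring.
      eapply Rle_lt_trans; [apply Cmod_triangle|]. rewrite Cmod_opp.
      generalize (edom_tail f M e T _ _ H HT Hu1 Hu2) (edom_tail f M e T _ _ H HT Hv1 Hv2) (HTe T (Rle_refl T)).
      lra. }
  assert (Hil : is_line f l).
  { intros P HP. specialize (Hl P HP). unfold filtermap in Hl. unfold filtermapi.
    eapply filter_imp; [|exact Hl]. intros ab Hab. exists (Cint f (fst ab) (snd ab)).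
    split; [apply Cint_correct; exact Hc|exact Hab]. }
  assert (El : line f = l).
  { apply is_line_unique. exact Hil. }
  rewrite El. split; [exact Hil|].
  intros T a b HT Ha Hb. apply le_epsilon. intros eps Heps.
  assert (Heps2 : 0 < eps / 2) by lra.
  specialize (proj1 (filterlim_locally _ _) Hl (mkposreal _ Heps2)). intros [Q S HQ HS HQS].
  destruct HQ as [q Hq]. destruct HS as [s Hs].
  (* [[a', b']] contains [[a, b]] and reaches beyond [q] and [s], where the integral is within [eps]
     of [l]. *)
  set (a' := Rmin (q - 1) a). set (b' := Rmax (s + 1) b).
  assert (Ha' : a' < q /\ a' <= a) by (split; [unfold a'; eapply Rle_lt_trans; [apply Rmin_l|lra]|apply Rmin_r]).
  assert (Hb' : s < b' /\ b <= b') by (split; [unfold b'; eapply Rlt_le_trans; [|apply Rmax_l]; lra|apply Rmax_r]).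
  specialize (HQS a' b' (Hq _ (proj1 Ha')) (Hs _ (proj1 Hb'))). simpl in HQS.
  apply ball_Cmod in HQS. simpl in HQS.
  assert (E : Cmod (Cint f a' b' - Cint f a b) <= 2 * M / e * exp (- e * T)).
  { replace (Cint f a' b' - Cint f a b)%C with (Cint f a' a + Cint f b b')%C.
    2: { rewrite <- (Cint_Chasles f a' a b' Hc), <- (Cint_Chasles f a b b' Hc). ring. }
    eapply Rle_trans; [apply Cmod_triangle|].
    assert (H1 := edom_tail_pos f M e b b' H ltac:(lra) ltac:(lra)).
    assert (H2 := edom_tail_neg f M e (- a) (- a') H ltac:(lra) ltac:(lra)).
    rewrite !Ropp_involutive in H2.
    assert (Hx : forall x, T <= x -> M / e * exp (- e * x) <= M / e * exp (- e * T)).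
    { intros x Hx. apply Rmult_le_compat_l; [apply Rdiv_le_0_compat; assumption|].
      destruct (Rle_lt_or_eq_dec _ _ Hx) as [Hl1|Hl1]; [left; apply exp_increasing; nra|rewrite Hl1; lra]. }
    generalize (Hx b Hb) (Hx (- a) ltac:(lra)). unfold Rdiv in *. lra. }
  replace (l - Cint f a b)%C with ((Cint f a' b' - Cint f a b) + - (Cint f a' b' - l))%C by ring.
  eapply Rle_trans; [apply Cmod_triangle|]. rewrite Cmod_opp. lra.
Qed.

Lemma line_is (f : R -> C) : dexp f -> is_line f (line f).
Proof. intros [M [e H]]. apply (line_spec f M e H). Qed.

Lemma line_tail (f : R -> C) (M e T a b : R) : edom f M e -> 0 <= T -> a <= - T -> T <= b ->
  Cmod (line f - Cint f a b) <= 2 * M / e * exp (- e * T).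
Proof. intros H. apply (line_spec f M e H). Qed.

Lemma line_bound (f : R -> C) (M e : R) : edom f M e -> Cmod (line f) <= 2 * M / e.
Proof.
  intros H. assert (H1 := line_tail f M e 0 0 0 H (Rle_refl 0) ltac:(lra) ltac:(lra)).
  rewrite Rmult_0_r, exp_0, Rmult_1_r in H1.
  assert (E : Cint f 0 0 = 0%C) by (apply (RInt_point (V := C_R_CompleteNormedModule))).
  rewrite E in H1. replace (line f - 0)%C with (line f) in H1 by ring. exact H1.
Qed.

Lemma line_lim (f : R -> C) : dexp f -> forall eps, 0 < eps ->
  exists T, 0 <= T /\ forall a b, a <= - T -> T <= b -> Cmod (line f - Cint f a b) < eps.
Proof.
  intros [M [e H]] eps He. assert (He' : 0 < e) by apply H.
  destruct (exp_small (2 * M / e) e eps He' He) as [T [HT HTe]].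
  exists T; split; [exact HT|]. intros a b Ha Hb.
  eapply Rle_lt_trans; [apply (line_tail f M e T); assumption|]. apply HTe. lra.
Qed.

Lemma C_eq_eps (a b : C) : (forall eps, 0 < eps -> Cmod (a - b) <= eps) -> a = b.
Proof.
  intros H. assert (E : Cmod (a - b) = 0).
  { apply Rle_antisym; [|apply Cmod_ge_0]. apply le_epsilon. intros eps He.
    rewrite Rplus_0_l. apply H; exact He. }
  apply Cmod_eq_0 in E. replace a with (a - b + b)%C by ring. rewrite E. ring.
Qed.

(** Decay already gives convergence, so symmetric truncations are enough to identify the value. *)
Lemma line_unique (f : R -> C) (l : C) : dexp f ->
  (forall eps, 0 < eps -> exists T, forall t, T <= t -> Cmod (Cint f (- t)%R t - l) < eps) ->
  line f = l.
Proof.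
  intros Hf H. apply C_eq_eps. intros eps He. assert (He2 : 0 < eps / 2) by lra.
  destruct (line_lim f Hf _ He2) as [T1 [HT1 H1]]. destruct (H _ He2) as [T2 H2].
  set (t := Rmax T1 T2).
  specialize (H1 (- t) t ltac:(generalize (Rmax_l T1 T2); unfold t; lra) (Rmax_l _ _)).
  specialize (H2 t (Rmax_r _ _)).
  replace (line f - l)%C with ((line f - Cint f (- t)%R t) + (Cint f (- t)%R t - l))%C by ring.
  eapply Rle_trans; [apply Cmod_triangle|]. lra.
Qed.

Lemma line_ext (f g : R -> C) : (forall u, f u = g u) -> line f = line g.
Proof.
  intros H. apply (f_equal line), functional_extensionality, H.
Qed.

Lemma edom_ext (f g : R -> C) (M e : R) : (forall u, f u = g u) -> edom f M e -> edom g M e.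
Proof.
  intros E [Hc [He Hb]]. split; [|split; [exact He|]].
  - intros u. apply continuous_ext with f; [exact E|apply Hc].
  - intros u. rewrite <- E. apply Hb.
Qed.

Lemma dexp_ext (f g : R -> C) : (forall u, f u = g u) -> dexp f -> dexp g.
Proof. intros E [M [e H]]. exists M, e. apply edom_ext with f; assumption. Qed.

Lemma dexp_plus (f g : R -> C) : dexp f -> dexp g -> dexp (fun u => (f u + g u)%C).
Proof.
  intros [M [e Hf]] [N [d Hg]].
  assert (HM := edom_pos _ _ _ Hf). assert (HN := edom_pos _ _ _ Hg).
  destruct Hf as [Cf [He Hf]]. destruct Hg as [Cg [Hd Hg]].
  exists (M + N), (Rmin e d). split; [|split; [apply Rmin_pos; assumption|]].
  - intros u. apply continuous_Cplus; [apply Cf|apply Cg].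
  - intros u. eapply Rle_trans; [apply Cmod_triangle|].
    assert (Hx : forall x, Rmin e d <= x -> exp (- x * Rabs u) <= exp (- Rmin e d * Rabs u)).
    { intros x Hx. generalize (Rabs_pos u). intros Hu.
      destruct (Req_dec (x * Rabs u) (Rmin e d * Rabs u)) as [E|E].
      - right; f_equal; lra.
      - left; apply exp_increasing; nra. }
    specialize (Hf u). specialize (Hg u).
    generalize (Hx e (Rmin_l _ _)) (Hx d (Rmin_r _ _)). intros. nra.
Qed.

Lemma line_plus (f g : R -> C) : dexp f -> dexp g ->
  line (fun u => (f u + g u)%C) = (line f + line g)%C.
Proof.
  intros Hf Hg. apply is_line_unique.
  exact (is_RInt_gen_plus (V := C_R_NormedModule)
    (Fa := Rbar_locally m_infty) (Fb := Rbar_locally p_infty) f g _ _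
    (line_is f Hf) (line_is g Hg)).
Qed.

Lemma edom_scal (c : C) (f : R -> C) (M e : R) : edom f M e ->
  edom (fun u => (c * f u)%C) (Cmod c * M) e.
Proof.
  intros [Hc [He Hb]]. split; [|split; [exact He|]].
  - intros u. apply continuous_Cmult; [apply continuous_const|apply Hc].
  - intros u. rewrite Cmod_mult, Rmult_assoc. apply Rmult_le_compat_l; [apply Cmod_ge_0|apply Hb].
Qed.

Lemma dexp_scal (c : C) (f : R -> C) : dexp f -> dexp (fun u => (c * f u)%C).
Proof. intros [M [e H]]. exists (Cmod c * M), e. apply edom_scal; exact H. Qed.

Lemma Cint_scal (c : C) (f : R -> C) (a b : R) : ccont f ->
  Cint (fun u => (c * f u)%C) a b = (c * Cint f a b)%C.
Proof. intros H. apply is_Cint_unique, is_Cint_scal, Cint_correct; exact H. Qed.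

Lemma line_scal (c : C) (f : R -> C) : dexp f ->
  line (fun u => (c * f u)%C) = (c * line f)%C.
Proof.
  intros Hf. apply line_unique; [apply dexp_scal; exact Hf|]. intros eps He.
  assert (Hp : 0 < Cmod c + 1) by (generalize (Cmod_ge_0 c); lra).
  destruct (line_lim f Hf (eps / (Cmod c + 1))) as [T [HT H]].
  { apply Rdiv_lt_0_compat; lra. }
  exists T. intros t Ht. destruct Hf as [M [e Hf]].
  rewrite Cint_scal by apply Hf.
  replace (c * Cint f (- t)%R t - c * line f)%C with (c * - (line f - Cint f (- t)%R t))%C by ring.
  rewrite Cmod_mult, Cmod_opp. specialize (H (- t) t ltac:(lra) Ht).
  apply Rle_lt_trans with (Cmod c * (eps / (Cmod c + 1))).
  - apply Rmult_le_compat_l; [apply Cmod_ge_0|lra].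
  - apply Rmult_lt_reg_r with (Cmod c + 1); [exact Hp|].
    replace (Cmod c * (eps / (Cmod c + 1)) * (Cmod c + 1)) with (Cmod c * eps) by (field; lra).
    generalize (Cmod_ge_0 c). nra.
Qed.

Lemma line_minus (f g : R -> C) : dexp f -> dexp g ->
  line (fun u => (f u - g u)%C) = (line f - line g)%C.
Proof.
  intros Hf Hg. rewrite (line_ext _ (fun u : R => (f u + -1 * g u)%C)) by (intros; ring).
  rewrite line_plus, line_scal; try assumption; [ring|apply dexp_scal; assumption].
Qed.

Lemma dexp_opp_arg (f : R -> C) : dexp f -> dexp (fun u => f (- u)).
Proof. intros [M [e H]]. exists M, e. apply edom_opp_arg; exact H. Qed.

Lemma line_opp_arg (f : R -> C) : dexp f -> line (fun u => f (- u)) = line f.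
Proof.
  intros Hf. apply line_unique; [apply dexp_opp_arg; exact Hf|]. intros eps He.
  destruct (line_lim f Hf eps He) as [T [HT H]]. exists T. intros t Ht.
  rewrite Cint_opp_arg by (destruct Hf as [M [e Hf]]; apply Hf).
  rewrite Ropp_involutive. rewrite Cmod_minus_sym. apply H; lra.
Qed.

Lemma ccont_lin (f : R -> C) (k v : R) : ccont f -> ccont (fun u => f (k * u + v)).
Proof.
  intros Hc u.
  apply (continuous_comp (U := R_UniformSpace) (V := R_UniformSpace) (W := C_UniformSpace) (fun u => k * u + v) f).
  - apply continuous_Rplus; [apply continuous_Rmult; [apply continuous_const|apply continuous_id]|apply continuous_const].
  - apply Hc.
Qed.

Lemma dexp_lin (f : R -> C) (k v : R) : 0 < k -> dexp f -> dexp (fun u => f (k * u + v)).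
Proof.
  intros Hk [M [e H]]. assert (HM := edom_pos _ _ _ H). destruct H as [Hc [He Hb]].
  exists (M * exp (e * Rabs v)), (e * k).
  split; [apply ccont_lin; exact Hc|split; [apply Rmult_lt_0_compat; assumption|]].
  intros u. eapply Rle_trans; [apply Hb|]. rewrite Rmult_assoc, <- exp_plus.
  apply Rmult_le_compat_l; [exact HM|].
  assert (Ht : k * Rabs u - Rabs v <= Rabs (k * u + v)).
  { assert (H1 := Rabs_triang (k * u + v) (- v)). replace (k * u + v + - v) with (k * u) in H1 by ring.
    rewrite Rabs_mult, Rabs_Ropp, (Rabs_pos_eq k) in H1 by lra. lra. }
  assert (Hle : - e * Rabs (k * u + v) <= e * Rabs v + - (e * k) * Rabs u) by nra.
  destruct Hle as [Hle|Hle]; [left; apply exp_increasing; exact Hle|right; rewrite Hle; reflexivity].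
Qed.

Lemma line_lin (f : R -> C) (k v : R) : 0 < k -> dexp f ->
  line (fun u => f (k * u + v)) = (RtoC (/ k) * line f)%C.
Proof.
  intros Hk Hf. apply line_unique; [apply dexp_lin; assumption|]. intros eps He.
  destruct (line_lim f Hf (eps * k)) as [T [HT H]]; [apply Rmult_lt_0_compat; assumption|].
  exists ((T + Rabs v) / k). intros t Ht.
  assert (Hkt : T + Rabs v <= k * t).
  { apply Rmult_le_reg_r with (/ k); [apply Rinv_0_lt_compat; exact Hk|].
    replace (k * t * / k) with t by (field; lra). exact Ht. }
  assert (Hc : ccont f) by (destruct Hf as [M [e Hf]]; apply Hf).
  rewrite (is_Cint_unique _ _ _ _ (is_Cint_lin f k v (- t) t _ (Rgt_not_eq _ _ Hk) (Cint_correct f _ _ Hc))).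
  replace (RtoC (/ k) * Cint f (k * - t + v)%R (k * t + v)%R - RtoC (/ k) * line f)%C with
    (RtoC (/ k) * - (line f - Cint f (k * - t + v)%R (k * t + v)%R))%C by ring.
  rewrite Cmod_mult, Cmod_R, Cmod_opp, Rabs_pos_eq by (left; apply Rinv_0_lt_compat; exact Hk).
  generalize (Rle_abs v) (Rle_abs (- v)). rewrite Rabs_Ropp. intros.
  specialize (H (k * - t + v) (k * t + v) ltac:(lra) ltac:(lra)).
  apply Rmult_lt_reg_l with k; [exact Hk|]. rewrite <- Rmult_assoc, Rinv_r, Rmult_1_l by lra. lra.
Qed.

Lemma line_shift (f : R -> C) (v : R) : dexp f -> line (fun u => f (u + v)) = line f.
Proof.
  intros Hf. rewrite (line_ext _ (fun u => f (1 * u + v))) by (intros; f_equal; ring).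
  rewrite line_lin by (assumption || lra). rewrite Rinv_1. ring.
Qed.

Lemma line_ftc (D w : R -> C) (l1 l2 : C) :
  (forall x, is_derive (V := C_R_NormedModule) D x (w x)) -> dexp w ->
  (forall eps, 0 < eps -> exists T, forall t, T <= t -> Cmod (D (- t)%R - l1) < eps) ->
  (forall eps, 0 < eps -> exists T, forall t, T <= t -> Cmod (D t - l2) < eps) ->
  line w = (l2 - l1)%C.
Proof.
  intros HD Hw H1 H2. apply line_unique; [exact Hw|]. intros eps He. assert (He2 : 0 < eps / 2) by lra.
  destruct (H1 _ He2) as [T1 HT1]. destruct (H2 _ He2) as [T2 HT2].
  exists (Rmax T1 T2). intros t Ht.
  assert (Hc : ccont w) by (destruct Hw as [M [e Hf]]; apply Hf).
  rewrite (is_Cint_unique _ _ _ _ (is_Cint_derive D w (- t) t (fun x _ => HD x) (fun x _ => Hc x))).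
  replace (D t - D (- t)%R - (l2 - l1))%C with ((D t - l2) + - (D (- t)%R - l1))%C by ring.
  eapply Rle_lt_trans; [apply Cmod_triangle|]. rewrite Cmod_opp.
  specialize (HT1 t ltac:(eapply Rle_trans; [apply Rmax_l|exact Ht])).
  specialize (HT2 t ltac:(eapply Rle_trans; [apply Rmax_r|exact Ht])). lra.
Qed.

(** * Integrals depending on a parameter and Fubini's theorem *)

Lemma continuous_RInt_param (F : R -> R -> R) (a b y0 : R) :
  (forall x y, continuity_2d_pt F x y) ->
  continuous (fun y => RInt (fun t => F t y) a b) y0.
Proof.
  intros HF.
  assert (Hc : forall y t, continuous (fun t => F t y) t).
  { intros y t. apply (continuous_comp_2 (U := R_UniformSpace) (fun t => t) (fun _ => y) F).
    - apply continuous_id.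
    - apply continuous_const.
    - apply continuity_2d_pt_filterlim. apply HF. }
  assert (Hi : forall y, is_RInt (fun t => F t y) a b (RInt (fun t => F t y) a b)).
  { intros y. apply (RInt_correct (V := R_CompleteNormedModule)).
    apply (ex_RInt_continuous (V := R_CompleteNormedModule)). intros; apply Hc. }
  apply filterlim_locally. intros eps.
  set (K := Rabs (b - a) + 1).
  assert (HK : 0 < K) by (generalize (Rabs_pos (b - a)); unfold K; lra).
  assert (Hek : 0 < eps / K) by (apply Rdiv_lt_0_compat; [apply cond_pos|exact HK]).
  destruct (uniform_continuity_2d_1d F (Rmin a b) (Rmax a b) y0 (fun x _ => HF x y0)
    (mkposreal _ Hek)) as [d Hd].
  exists d. intros y Hy.
  assert (Hy' : Rabs (y - y0) < d) by exact Hy.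
  change (Rabs (RInt (fun t => F t y) a b - RInt (fun t => F t y0) a b) < eps).
  assert (Hm : is_RInt (fun t => F t y - F t y0) a b
     (RInt (fun t => F t y) a b - RInt (fun t => F t y0) a b))
    by (apply (is_RInt_minus (V := R_NormedModule)); apply Hi).
  apply Rle_lt_trans with (Rabs (b - a) * (eps / K)).
  - apply (norm_RInt_le_const_abs (V := R_NormedModule) (fun t => F t y - F t y0)); [|exact Hm].
    intros t Ht. left. apply Rabs_def2 in Hy'. assert (Hdp := cond_pos d). simpl in Hdp.
    apply Hd; try exact Ht; try lra.
    rewrite Rminus_eq_0, Rabs_R0. exact Hdp.
  - apply Rmult_lt_reg_r with K; [exact HK|].
    replace (Rabs (b - a) * (eps / K) * K) with (Rabs (b - a) * eps) by (field; lra).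
    generalize (cond_pos eps) (Rabs_pos (b - a)). unfold K. nra.
Qed.

Lemma continuity_2d_swap (F : R -> R -> R) :
  (forall x y, continuity_2d_pt F x y) -> forall x y, continuity_2d_pt (fun x y => F y x) x y.
Proof.
  intros H x y eps. destruct (H y x eps) as [d Hd]. exists d. intros u v Hu Hv.
  apply Hd; assumption.
Qed.

(** As functions of the upper limit [b], both sides vanish at [a] and have the same derivative, the
    right-hand one by differentiation under the integral sign. *)
Lemma RInt_fubini (F : R -> R -> R) (a b c d : R) : a <= b ->
  (forall x y, continuity_2d_pt F x y) ->
  RInt (fun x => RInt (fun y => F x y) c d) a b =
  RInt (fun y => RInt (fun x => F x y) a b) c d.
Proof.
  intros Hab HF. assert (HF' := continuity_2d_swap F HF).
  assert (Hc1 : forall y t, continuous (fun t => F t y) t).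
  { intros y t. apply (continuous_comp_2 (U := R_UniformSpace) (fun t => t) (fun _ => y) F);
      [apply continuous_id|apply continuous_const|]. apply continuity_2d_pt_filterlim, HF. }
  assert (Hi1 : forall y u v, ex_RInt (fun t => F t y) u v).
  { intros. apply (ex_RInt_continuous (V := R_CompleteNormedModule)). intros; apply Hc1. }
  set (g := fun x => RInt (fun y => F x y) c d).
  assert (Hg : forall x, continuous g x).
  { intros x. apply (continuous_RInt_param (fun y x => F x y)). exact HF'. }
  assert (Hgi : forall u v, ex_RInt g u v).
  { intros. apply (ex_RInt_continuous (V := R_CompleteNormedModule)). intros; apply Hg. }
  assert (D1 : forall x, is_derive (fun x => RInt g a x) x (g x)).
  { intros x. apply (is_derive_RInt (V := R_NormedModule) g _ a).
    - apply filter_forall. intros t. apply (RInt_correct (V := R_CompleteNormedModule)), Hgi.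
    - apply Hg. }
  assert (D0 : forall x y, is_derive (fun x => RInt (fun t => F t y) a x) x (F x y)).
  { intros x y. apply (is_derive_RInt (V := R_NormedModule) (fun t => F t y) _ a).
    - apply filter_forall. intros t. apply (RInt_correct (V := R_CompleteNormedModule)), Hi1.
    - apply Hc1. }
  assert (D2 : forall x, is_derive (fun x => RInt (fun y => RInt (fun t => F t y) a x) c d) x (g x)).
  { intros x.
    assert (E : g x = RInt (fun y => Derive (fun u => RInt (fun t => F t y) a u) x) c d).
    { unfold g. apply RInt_ext. intros y _. symmetry. apply is_derive_unique, D0. }
    rewrite E.
    apply (is_derive_RInt_param (fun u y => RInt (fun t => F t y) a u)).
    - apply filter_forall. intros u t _. exists (F u t). apply D0.
    - intros t _. apply continuity_2d_pt_ext with F; [|apply HF].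
      intros u v. symmetry. apply is_derive_unique, D0.
    - apply filter_forall. intros u. apply (ex_RInt_continuous (V := R_CompleteNormedModule)).
      intros z _. apply continuous_RInt_param. exact HF. }
  (* [eq_is_derive] needs a proper interval, so [a = b] is settled apart. *)
  destruct (Rle_lt_or_eq_dec _ _ Hab) as [Hlt|E].
  2: { subst b. change (RInt g a a = RInt (fun y => RInt (fun x => F x y) a a) c d).
    rewrite RInt_point. symmetry. rewrite (RInt_ext _ (fun _ => 0)).
    - rewrite RInt_const. unfold scal; simpl; unfold mult; simpl. rewrite Rmult_0_r. reflexivity.
    - intros. apply (RInt_point (V := R_CompleteNormedModule)). }
  assert (Eq := eq_is_derive (V := R_NormedModule)
    (fun x => RInt g a x - RInt (fun y => RInt (fun t => F t y) a x) c d) a b).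
  simpl in Eq. apply Rminus_diag_uniq. rewrite <- Eq; [|clear Eq|exact Hlt].
  - rewrite RInt_point, (RInt_ext _ (fun _ => 0)).
    + rewrite RInt_const. change (0 - (d - c) * 0 = 0). ring.
    + intros. apply (RInt_point (V := R_CompleteNormedModule)).
  - intros t _. assert (DD := is_derive_minus (V := R_NormedModule) _ _ _ _ _ (D1 t) (D2 t)).
    exact (eq_ind _ (fun l : R => is_derive (V := R_NormedModule) (fun x : R =>
      RInt g a x - RInt (fun y : R => RInt (fun t : R => F t y) a x) c d) t l)
      DD _ (Rminus_eq_0 (g t))).
Qed.

Definition ccont2 (F : R -> R -> C) : Prop :=
  forall p : R * R, continuous (T := prod_UniformSpace R_UniformSpace R_UniformSpace)
    (U := C_UniformSpace) (fun p => F (fst p) (snd p)) p.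

Lemma ccont2_swap (F : R -> R -> C) : ccont2 F -> ccont2 (fun x y => F y x).
Proof.
  intros H [x y].
  apply (continuous_comp (U := prod_UniformSpace R_UniformSpace R_UniformSpace)
    (V := prod_UniformSpace R_UniformSpace R_UniformSpace) (W := C_UniformSpace)
    (fun p => (snd p, fst p)) (fun p => F (fst p) (snd p))); [|apply H].
  apply filterlim_locally. intros eps. exists eps. intros [u v] [A B]. split; assumption.
Qed.

Lemma ccont2_l (F : R -> R -> C) (y : R) : ccont2 F -> ccont (fun x => F x y).
Proof.
  intros H x.
  apply (continuous_comp (U := R_UniformSpace)
    (V := prod_UniformSpace R_UniformSpace R_UniformSpace) (W := C_UniformSpace)
    (fun x => (x, y)) (fun p => F (fst p) (snd p))); [|apply H].
  apply filterlim_locally. intros eps. exists eps. intros u A. split; [exact A|apply ball_center].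
Qed.

Lemma ccont2_r (F : R -> R -> C) (x : R) : ccont2 F -> ccont (fun y => F x y).
Proof. intros H. apply (ccont2_l (fun x y => F y x)), ccont2_swap, H. Qed.

Lemma ccont2_Re (F : R -> R -> C) : ccont2 F ->
  forall x y, continuity_2d_pt (fun x y => Re (F x y)) x y.
Proof.
  intros H x y. apply continuity_2d_pt_filterlim.
  apply (continuous_Re (fun p => F (fst p) (snd p)) (x, y) (H (x, y))).
Qed.

Lemma ccont2_Im (F : R -> R -> C) : ccont2 F ->
  forall x y, continuity_2d_pt (fun x y => Im (F x y)) x y.
Proof.
  intros H x y. apply continuity_2d_pt_filterlim.
  apply (continuous_Im (fun p => F (fst p) (snd p)) (x, y) (H (x, y))).
Qed.

Lemma Cint_parts (f : R -> C) (a b : R) : ccont f ->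
  Cint f a b = (RInt (fun t => Re (f t)) a b, RInt (fun t => Im (f t)) a b).
Proof.
  intros H. assert (Hi := Cint_correct f a b H).
  apply injective_projections; simpl; symmetry;
    apply (is_RInt_unique (V := R_CompleteNormedModule));
    [apply is_Cint_Re in Hi|apply is_Cint_Im in Hi]; exact Hi.
Qed.

Lemma ccont_param (F : R -> R -> C) (a b : R) : ccont2 F ->
  ccont (fun x => Cint (fun y => F x y) a b).
Proof.
  intros H x.
  apply continuous_ext with (fun x => (RInt (fun y => Re (F x y)) a b, RInt (fun y => Im (F x y)) a b)).
  - intros t. symmetry. apply Cint_parts, ccont2_r, H.
  - apply continuous_pairC; simpl.
    + apply (continuous_RInt_param (fun y x => Re (F x y))).
      apply (continuity_2d_swap (fun x y => Re (F x y))), ccont2_Re, H.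
    + apply (continuous_RInt_param (fun y x => Im (F x y))).
      apply (continuity_2d_swap (fun x y => Im (F x y))), ccont2_Im, H.
Qed.

Lemma Cint_fubini (F : R -> R -> C) (a b c d : R) : a <= b -> ccont2 F ->
  Cint (fun x => Cint (fun y => F x y) c d) a b = Cint (fun y => Cint (fun x => F x y) a b) c d.
Proof.
  intros Hab H.
  assert (H1 := ccont_param F c d H).
  assert (H2 := ccont_param (fun y x => F x y) a b (ccont2_swap F H)).
  rewrite (Cint_parts _ a b H1), (Cint_parts _ c d H2).
  f_equal.
  - transitivity (RInt (fun x => RInt (fun y => Re (F x y)) c d) a b).
    + apply RInt_ext. intros x _. rewrite Cint_parts by (apply ccont2_r, H). reflexivity.
    + rewrite (RInt_fubini (fun x y => Re (F x y)) a b c d Hab (ccont2_Re F H)).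
      apply RInt_ext. intros y _. rewrite Cint_parts by (apply (ccont2_l F y), H). reflexivity.
  - transitivity (RInt (fun x => RInt (fun y => Im (F x y)) c d) a b).
    + apply RInt_ext. intros x _. rewrite Cint_parts by (apply ccont2_r, H). reflexivity.
    + rewrite (RInt_fubini (fun x y => Im (F x y)) a b c d Hab (ccont2_Im F H)).
      apply RInt_ext. intros y _. rewrite Cint_parts by (apply (ccont2_l F y), H). reflexivity.
Qed.

Definition edom2 (F : R -> R -> C) (M e : R) : Prop :=
  ccont2 F /\ 0 < e /\ forall x y, Cmod (F x y) <= M * exp (- e * Rabs x) * exp (- e * Rabs y).

Lemma edom2_swap (F : R -> R -> C) (M e : R) : edom2 F M e -> edom2 (fun x y => F y x) M e.
Proof.
  intros [H [He Hb]]. split; [apply ccont2_swap, H|split; [exact He|]].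
  intros x y. rewrite Rmult_assoc, (Rmult_comm (exp _)), <- Rmult_assoc. apply Hb.
Qed.

Lemma edom2_inner (F : R -> R -> C) (M e x : R) : edom2 F M e ->
  edom (F x) (M * exp (- e * Rabs x)) e.
Proof.
  intros [H [He Hb]]. split; [apply (ccont2_r F x), H|split; [exact He|intros y; apply Hb]].
Qed.

Lemma edom2_line_tail (F : R -> R -> C) (M e x T : R) : edom2 F M e -> 0 <= T ->
  Cmod (line (F x) - Cint (F x) (- T)%R T) <= (2 * M / e * exp (- e * T)) * exp (- e * Rabs x).
Proof.
  intros H HT.
  assert (H1 := line_tail _ _ _ T (- T) T (edom2_inner F M e x H) HT (Rle_refl _) (Rle_refl _)).
  eapply Rle_trans; [exact H1|]. right. unfold Rdiv. ring.
Qed.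

Lemma edom2_pos (F : R -> R -> C) (M e : R) : edom2 F M e -> 0 <= M.
Proof.
  intros H. assert (H1 := edom_pos _ _ _ (edom2_inner F M e 0 H)).
  rewrite Rabs_R0, Rmult_0_r, exp_0, Rmult_1_r in H1. exact H1.
Qed.

(** Continuity in [x] holds for the integrals over [[- T, T]], and these approximate the line
    integrals uniformly in [x]. *)
Lemma edom2_line (F : R -> R -> C) (M e : R) : edom2 F M e ->
  edom (fun x => line (F x)) (2 * M / e) e.
Proof.
  intros H. assert (Hc : ccont2 F) by apply H. assert (He : 0 < e) by apply H.
  assert (HM := edom2_pos _ _ _ H).
  split; [|split; [exact He|]].
  - intros x0. apply filterlim_locally. intros eps.
    assert (He3 : 0 < eps / 3) by (generalize (cond_pos eps); lra).
    destruct (exp_small (2 * M / e) e (eps / 3) He He3) as [T [HT HTe]].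
    assert (Htail : forall x, Cmod (line (F x) - Cint (F x) (- T)%R T) < eps / 3).
    { intros x. eapply Rle_lt_trans; [apply (edom2_line_tail F M e x T H HT)|].
      eapply Rle_lt_trans; [|apply (HTe T (Rle_refl T))].
      rewrite <- (Rmult_1_r (2 * M / e * exp (- e * T))) at 2.
      apply Rmult_le_compat_l.
      - apply Rmult_le_pos; [apply Rdiv_le_0_compat; lra|left; apply exp_pos].
      - rewrite <- exp_0. generalize (Rabs_pos x). intros Hx.
        destruct (Req_dec (- e * Rabs x) 0) as [E|E]; [right; f_equal; exact E|].
        left; apply exp_increasing. nra. }
    assert (He6 : 0 < eps / 6) by (generalize (cond_pos eps); lra).
    generalize (proj1 (filterlim_locally _ _) (ccont_param F (- T) T Hc x0) (mkposreal _ He6)).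
    apply filter_imp. intros x Hx. apply ball_Cmod in Hx. simpl in Hx.
    apply Cmod_ball.
    replace (line (F x) - line (F x0))%C with
      ((line (F x) - Cint (F x) (- T)%R T) + ((Cint (F x) (- T)%R T - Cint (F x0) (- T)%R T)
        + - (line (F x0) - Cint (F x0) (- T)%R T)))%C by ring.
    eapply Rle_lt_trans; [apply Cmod_triangle|].
    assert (H2 := Cmod_triangle (Cint (F x) (- T)%R T - Cint (F x0) (- T)%R T)
      (- (line (F x0) - Cint (F x0) (- T)%R T))).
    rewrite Cmod_opp in H2. generalize (Htail x) (Htail x0).
    assert (Hx' : Cmod (Cint (F x) (- T) T - Cint (F x0) (- T) T) < 2 * (eps / 6)) by exact Hx.
    lra.
  - intros x. eapply Rle_trans; [apply (line_bound _ _ _ (edom2_inner F M e x H))|].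
    right; unfold Rdiv; ring.
Qed.

(** The error has two parts, each at most [4 * M / e / e * exp (- e * T)]: the outer tail, and the
    inner tail integrated over the outer variable. On squares the order of integration can be
    exchanged, which gives [line_fubini]. *)
Lemma edom2_line_square (F : R -> R -> C) (M e T : R) : edom2 F M e -> 0 <= T ->
  Cmod (line (fun x => line (F x)) - Cint (fun x => Cint (F x) (- T)%R T) (- T)%R T)
    <= 8 * M / e / e * exp (- e * T).
Proof.
  intros H HT. assert (HI := edom2_line F M e H). assert (Hc : ccont2 F) by apply H.
  assert (HM := edom2_pos _ _ _ H). assert (He : 0 < e) by apply H.
  assert (H1 := line_tail _ _ _ T (- T) T HI HT (Rle_refl _) (Rle_refl _)).
  assert (Hd : edom (fun x => (line (F x) - Cint (F x) (- T)%R T)%C) (2 * M / e * exp (- e * T)) e).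
  { split; [|split; [exact He|intros; apply edom2_line_tail; assumption]].
    intros x. apply continuous_Cminus; [apply HI|apply (ccont_param F); exact Hc]. }
  assert (Hi : Cint (fun x => (line (F x) - Cint (F x) (- T)%R T)%C) (- T)%R T =
    (Cint (fun x => line (F x)) (- T)%R T - Cint (fun x => Cint (F x) (- T)%R T) (- T)%R T)%C).
  { apply is_Cint_unique, is_Cint_minus; apply Cint_correct; [apply HI|apply (ccont_param F); exact Hc]. }
  assert (H2 : Cmod (Cint (fun x => (line (F x) - Cint (F x) (- T)%R T)%C) (- T)%R T) <=
    2 * (2 * M / e * exp (- e * T)) / e).
  { rewrite <- (Cint_Chasles _ (- T) 0 T (proj1 Hd)).
    eapply Rle_trans; [apply Cmod_triangle|].
    assert (A := edom_tail_pos _ _ _ 0 T Hd (Rle_refl 0) HT).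
    assert (B := edom_tail_neg _ _ _ 0 T Hd (Rle_refl 0) HT).
    rewrite Ropp_0 in B. rewrite Rmult_0_r, exp_0, Rmult_1_r in A, B.
    unfold Rdiv in *. lra. }
  rewrite Hi in H2.
  replace (line (fun x => line (F x)) - Cint (fun x => Cint (F x) (- T)%R T) (- T)%R T)%C with
    ((line (fun x => line (F x)) - Cint (fun x => line (F x)) (- T)%R T) +
     (Cint (fun x => line (F x)) (- T)%R T - Cint (fun x => Cint (F x) (- T)%R T) (- T)%R T))%C by ring.
  eapply Rle_trans; [apply Cmod_triangle|].
  unfold Rdiv in *. lra.
Qed.

Lemma line_fubini (F : R -> R -> C) (M e : R) : edom2 F M e ->
  line (fun x => line (fun y => F x y)) = line (fun y => line (fun x => F x y)).
Proof.
  intros H. assert (He : 0 < e) by apply H. apply C_eq_eps. intros eps Heps.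
  assert (Heps2 : 0 < eps / 2) by lra.
  destruct (exp_small (8 * M / e / e) e _ He Heps2) as [T [HT HTe]].
  assert (A := edom2_line_square F M e T H HT).
  assert (B := edom2_line_square _ M e T (edom2_swap F M e H) HT).
  change (Cmod (line (fun y => line (fun x => F x y)) -
    Cint (fun y => Cint (fun x => F x y) (- T)%R T) (- T)%R T) <= 8 * M / e / e * exp (- e * T)) in B.
  rewrite <- (Cint_fubini F (- T) T (- T) T) in B by (lra || apply H).
  specialize (HTe T (Rle_refl T)).
  change (line (fun x => line (fun y => F x y))) with (line (fun x => line (F x))).
  change (Cint (fun x => Cint (fun y => F x y) (- T) T) (- T) T) with
    (Cint (fun x => Cint (F x) (- T) T) (- T) T) in B.
  set (X := Cint (fun x => Cint (F x) (- T) T) (- T) T) in *.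
  set (L1 := line (fun x => line (F x))) in *.
  set (L2 := line (fun y => line (fun x => F x y))) in *.
  replace (L1 - L2)%C with ((L1 - X) + - (L2 - X))%C by ring.
  eapply Rle_trans; [apply Cmod_triangle|]. rewrite Cmod_opp.
  lra.
Qed.

(** * Cauchy's theorem for rectangles *)

Definition rect (a b c d : R) (z : C) : Prop := a <= Re z <= b /\ c <= Im z <= d.

Definition Ccont (f : C -> C) (z : C) : Prop :=
  continuous (T := C_UniformSpace) (U := C_UniformSpace) f z.

Definition rect_int (F : C -> C) (a b c d : R) : C :=
  (Cint (fun x => F (x, c)) a b + Ci * Cint (fun y => F (b, y)) c d
   - Cint (fun x => F (x, d)) a b - Ci * Cint (fun y => F (a, y)) c d)%C.

Lemma Ccont_hor (F : C -> C) (x c : R) : Ccont F (x, c) ->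
  continuous (T := R_UniformSpace) (U := C_UniformSpace) (fun x => F (x, c)) x.
Proof.
  intros H. apply (continuous_comp (U := R_UniformSpace) (V := C_UniformSpace)
    (W := C_UniformSpace) (fun x => (x, c)) F); [|exact H].
  apply continuous_pairC; simpl; [apply continuous_id|apply continuous_const].
Qed.

Lemma Ccont_ver (F : C -> C) (x y : R) : Ccont F (x, y) ->
  continuous (T := R_UniformSpace) (U := C_UniformSpace) (fun y => F (x, y)) y.
Proof.
  intros H. apply (continuous_comp (U := R_UniformSpace) (V := C_UniformSpace)
    (W := C_UniformSpace) (fun y => (x, y)) F); [|exact H].
  apply continuous_pairC; simpl; [apply continuous_const|apply continuous_id].
Qed.

Lemma is_Cint_hor (F : C -> C) (a b c : R) : a <= b ->
  (forall x, a <= x <= b -> Ccont F (x, c)) ->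
  is_Cint (fun x => F (x, c)) a b (Cint (fun x => F (x, c)) a b).
Proof.
  intros Hab H. apply is_Cint_cont. rewrite Rmin_left, Rmax_right by exact Hab.
  intros u Hu. apply Ccont_hor, H, Hu.
Qed.

Lemma is_Cint_ver (F : C -> C) (x c d : R) : c <= d ->
  (forall y, c <= y <= d -> Ccont F (x, y)) ->
  is_Cint (fun y => F (x, y)) c d (Cint (fun y => F (x, y)) c d).
Proof.
  intros Hab H. apply is_Cint_cont. rewrite Rmin_left, Rmax_right by exact Hab.
  intros u Hu. apply Ccont_ver, H, Hu.
Qed.

(** Continuity is asked only on the sides and on the cut, because [rect_residue] splits rectangles
    that have a pole inside. *)
Lemma rect_int_split_x (F : C -> C) (a m b c d : R) : a <= m <= b -> c <= d ->
  (forall z, rect a b c d z -> Re z = a \/ Re z = m \/ Re z = b \/ Im z = c \/ Im z = d ->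
     Ccont F z) ->
  rect_int F a b c d = (rect_int F a m c d + rect_int F m b c d)%C.
Proof.
  intros Hm Hcd H. unfold rect_int.
  assert (E : forall y, y = c \/ y = d ->
    Cint (fun x => F (x, y)) a b = (Cint (fun x => F (x, y)) a m + Cint (fun x => F (x, y)) m b)%C).
  { intros y Hy. apply is_Cint_unique, is_Cint_Chasles with m; apply is_Cint_hor; try lra;
      intros x Hx; apply H; unfold rect; simpl; destruct Hy; subst; lra. }
  rewrite (E c), (E d) by auto. ring.
Qed.

Lemma rect_int_split_y (F : C -> C) (a b c m d : R) : a <= b -> c <= m <= d ->
  (forall z, rect a b c d z -> Re z = a \/ Re z = b \/ Im z = c \/ Im z = m \/ Im z = d ->
     Ccont F z) ->
  rect_int F a b c d = (rect_int F a b c m + rect_int F a b m d)%C.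
Proof.
  intros Hab Hm H. unfold rect_int.
  assert (E : forall x, x = a \/ x = b ->
    Cint (fun y => F (x, y)) c d = (Cint (fun y => F (x, y)) c m + Cint (fun y => F (x, y)) m d)%C).
  { intros x Hx. apply is_Cint_unique, is_Cint_Chasles with m; apply is_Cint_ver; try lra;
      intros y Hy; apply H; unfold rect; simpl; destruct Hx; subst; lra. }
  rewrite (E a), (E b) by auto. ring.
Qed.

Definition bdry (a b c d : R) (z : C) : Prop :=
  rect a b c d z /\ (Re z = a \/ Re z = b \/ Im z = c \/ Im z = d).

Lemma rect_int_bound (F : C -> C) (a b c d M : R) : a <= b -> c <= d ->
  (forall z, bdry a b c d z -> Ccont F z /\ Cmod (F z) <= M) ->
  Cmod (rect_int F a b c d) <= 2 * ((b - a) + (d - c)) * M.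
Proof.
  intros Hab Hcd H. unfold rect_int.
  assert (A : forall y, y = c \/ y = d -> Cmod (Cint (fun x => F (x, y)) a b) <= (b - a) * M).
  { intros y Hy. apply (is_Cint_bound_const (fun x => F (x, y))); [exact Hab| |apply is_Cint_hor; [exact Hab|]];
      intros x Hx; apply H; unfold bdry, rect; simpl; destruct Hy; subst; lra. }
  assert (B : forall x, x = a \/ x = b -> Cmod (Ci * Cint (fun y => F (x, y)) c d) <= (d - c) * M).
  { intros x Hx. rewrite Cmod_mult, Cmod_Ci, Rmult_1_l.
    apply (is_Cint_bound_const (fun y => F (x, y))); [exact Hcd| |apply is_Cint_ver; [exact Hcd|]];
      intros y Hy; apply H; unfold bdry, rect; simpl; destruct Hx; subst; lra. }
  generalize (A c (or_introl eq_refl)) (A d (or_intror eq_refl))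
    (B a (or_introl eq_refl)) (B b (or_intror eq_refl)).
  set (z1 := Cint (fun x => F (x, c)) a b). set (z2 := (Ci * Cint (fun y => F (b, y)) c d)%C).
  set (z3 := Cint (fun x => F (x, d)) a b). set (z4 := (Ci * Cint (fun y => F (a, y)) c d)%C).
  intros. unfold Cminus.
  generalize (Cmod_triangle (z1 + z2 + - z3) (- z4)) (Cmod_triangle (z1 + z2) (- z3))
    (Cmod_triangle z1 z2). rewrite !Cmod_opp. lra.
Qed.

Lemma rect_int_minus (F G : C -> C) (a b c d : R) : a <= b -> c <= d ->
  (forall z, bdry a b c d z -> Ccont F z /\ Ccont G z) ->
  rect_int (fun z => (F z - G z)%C) a b c d = (rect_int F a b c d - rect_int G a b c d)%C.
Proof.
  intros Hab Hcd H. unfold rect_int.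
  assert (A : forall y, y = c \/ y = d -> Cint (fun x => (F (x, y) - G (x, y))%C) a b =
    (Cint (fun x => F (x, y)) a b - Cint (fun x => G (x, y)) a b)%C).
  { intros y Hy. apply is_Cint_unique, (is_Cint_minus (fun x => F (x, y)) (fun x => G (x, y))); apply is_Cint_hor; try exact Hab;
      intros x Hx; [refine (proj1 (H (x, y) _))|refine (proj2 (H (x, y) _))];
      unfold bdry, rect; simpl; destruct Hy; subst; lra. }
  assert (B : forall x, x = a \/ x = b -> Cint (fun y => (F (x, y) - G (x, y))%C) c d =
    (Cint (fun y => F (x, y)) c d - Cint (fun y => G (x, y)) c d)%C).
  { intros x Hx. apply is_Cint_unique, (is_Cint_minus (fun y => F (x, y)) (fun y => G (x, y))); apply is_Cint_ver; try exact Hcd;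
      intros y Hy; [refine (proj1 (H (x, y) _))|refine (proj2 (H (x, y) _))];
      unfold bdry, rect; simpl; destruct Hx; subst; lra. }
  rewrite (A c), (A d), (B a), (B b) by auto. ring.
Qed.

Lemma rect_int_scal (k : C) (F : C -> C) (a b c d : R) : a <= b -> c <= d ->
  (forall z, bdry a b c d z -> Ccont F z) ->
  rect_int (fun z => (k * F z)%C) a b c d = (k * rect_int F a b c d)%C.
Proof.
  intros Hab Hcd H. unfold rect_int.
  assert (A : forall y, y = c \/ y = d -> Cint (fun x => (k * F (x, y))%C) a b =
    (k * Cint (fun x => F (x, y)) a b)%C).
  { intros y Hy. apply is_Cint_unique, is_Cint_scal; apply is_Cint_hor; try exact Hab;
      intros x Hx; apply H; unfold bdry, rect; simpl; destruct Hy; subst; lra. }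
  assert (B : forall x, x = a \/ x = b -> Cint (fun y => (k * F (x, y))%C) c d =
    (k * Cint (fun y => F (x, y)) c d)%C).
  { intros x Hx. apply is_Cint_unique, is_Cint_scal; apply is_Cint_ver; try exact Hcd;
      intros y Hy; apply H; unfold bdry, rect; simpl; destruct Hx; subst; lra. }
  rewrite (A c), (A d), (B a), (B b) by auto. ring.
Qed.

Lemma cder_is_derive (G : C -> C) (z0 v : C) (t : R) (l : C) :
  cder G (z0 + RtoC t * v)%C l ->
  is_derive (V := C_R_NormedModule) (fun s : R => G (z0 + RtoC s * v)%C) t (v * l)%C.
Proof.
  intros H. split; [apply (is_linear_scal_l (V := C_R_NormedModule))|].
  intros x Hx. apply (is_filter_lim_locally_unique (V := R_NormedModule)) in Hx. subst x.
  (* Adding 1 keeps the divisor positive when [v = 0]. *)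
  intros eps. set (K := Cmod v + 1).
  assert (HK : 0 < K) by (generalize (Cmod_ge_0 v); unfold K; lra).
  destruct (cder_eps _ _ _ H (eps / K)) as [d [Hd Hw]].
  { apply Rdiv_lt_0_compat; [apply cond_pos|exact HK]. }
  assert (Hdk : 0 < d / K) by (apply Rdiv_lt_0_compat; assumption).
  exists (mkposreal _ Hdk). intros s Hs.
  change (Rabs (s - t) < d / K) in Hs.
  assert (Ev : (z0 + RtoC s * v - (z0 + RtoC t * v))%C = (RtoC (s - t) * v)%C)
    by (rewrite RtoC_minus; ring).
  specialize (Hw (z0 + RtoC s * v)%C). rewrite Ev in Hw.
  rewrite Cmod_mult, Cmod_R in Hw.
  assert (Hs1 : Rabs (s - t) * Cmod v < d).
  { apply Rle_lt_trans with (Rabs (s - t) * K).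
    - apply Rmult_le_compat_l; [apply Rabs_pos|unfold K; lra].
    - apply Rmult_lt_reg_r with (/ K); [apply Rinv_0_lt_compat; exact HK|].
      rewrite Rmult_assoc, Rinv_r, Rmult_1_r by lra. exact Hs. }
  specialize (Hw Hs1).
  rewrite C_norm. rewrite scal_C.
  change (Cmod (G (z0 + RtoC s * v)%C - G (z0 + RtoC t * v)%C - RtoC (s - t) * (v * l))
    <= eps * Rabs (s - t)).
  replace (RtoC (s - t) * (v * l))%C with (l * (RtoC (s - t) * v))%C by ring.
  eapply Rle_trans; [exact Hw|].
  replace (eps / K * (Rabs (s - t) * Cmod v)) with (eps * Rabs (s - t) * (Cmod v / K)) by (field; lra).
  rewrite <- (Rmult_1_r (eps * Rabs (s - t))) at 2.
  apply Rmult_le_compat_l.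
  - apply Rmult_le_pos; [left; apply cond_pos|apply Rabs_pos].
  - apply Rmult_le_reg_r with K; [exact HK|]. unfold Rdiv.
    rewrite Rmult_assoc, Rinv_l by lra. unfold K; lra.
Qed.

Lemma cder_is_derive_hor (G : C -> C) (x c : R) (l : C) : cder G (x, c) l ->
  is_derive (V := C_R_NormedModule) (fun x : R => G (x, c)) x l.
Proof.
  intros H. replace l with (1 * l)%C by ring.
  apply (is_derive_ext (V := C_R_NormedModule) (fun s => G ((0, c) + RtoC s * 1)%C)).
  - intros t. f_equal. apply injective_projections; simpl; ring.
  - apply cder_is_derive.
    replace ((0, c) + RtoC x * 1)%C with ((x, c) : C); [exact H|].
    apply injective_projections; simpl; ring.
Qed.

Lemma cder_is_derive_ver (G : C -> C) (x y : R) (l : C) : cder G (x, y) l ->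
  is_derive (V := C_R_NormedModule) (fun y : R => G (x, y)) y (Ci * l)%C.
Proof.
  intros H.
  apply (is_derive_ext (V := C_R_NormedModule) (fun s => G ((x, 0) + RtoC s * Ci)%C)).
  - intros t. f_equal. apply injective_projections; simpl; ring.
  - apply cder_is_derive.
    replace ((x, 0) + RtoC y * Ci)%C with ((x, y) : C); [exact H|].
    apply injective_projections; simpl; ring.
Qed.

Lemma rect_int_primitive (F G : C -> C) (a b c d : R) : a <= b -> c <= d ->
  (forall z, cder G z (F z)) -> (forall z, Ccont F z) -> rect_int F a b c d = 0%C.
Proof.
  intros Hab Hcd HG HF.
  assert (A : forall y, Cint (fun x => F (x, y)) a b = (G (b, y) - G (a, y))%C).
  { intros y. apply is_Cint_unique, (is_Cint_derive (fun x => G (x, y))); intros x _.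
    - apply cder_is_derive_hor, HG.
    - apply Ccont_hor, HF. }
  assert (B : forall x, (Ci * Cint (fun y => F (x, y)) c d)%C = (G (x, d) - G (x, c))%C).
  { intros x. assert (Hc : ccont (fun y => F (x, y))) by (intros y; apply Ccont_ver, HF).
    rewrite <- Cint_scal by exact Hc.
    apply is_Cint_unique, (is_Cint_derive (fun y => G (x, y))); intros y _.
    - apply cder_is_derive_ver, HG.
    - apply continuous_Cmult; [apply continuous_const|apply Hc]. }
  unfold rect_int. rewrite !A, !B. ring.
Qed.

Lemma rect_int_affine (p q : C) (a b c d : R) : a <= b -> c <= d ->
  rect_int (fun z => (p + q * z)%C) a b c d = 0%C.
Proof.
  intros Hab Hcd.
  apply (rect_int_primitive _ (fun z => (z * (p + / 2 * (q * z)))%C)); try assumption.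
  - intros z.
    assert (E : cder (fun z => (z * (p + / 2 * (q * z)))%C) z
      (1 * (p + / 2 * (q * z)) + z * (0 + (0 * (q * z) + / 2 * (0 * z + q * 1))))%C).
    { apply (cder_mult (fun z => z) (fun z => (p + / 2 * (q * z))%C)); [apply cder_id|].
      apply (cder_plus (fun _ => p) (fun z => (/ 2 * (q * z))%C)); [apply cder_const|].
      apply (cder_mult (fun _ => (/ 2)%C) (fun z => (q * z)%C)); [apply cder_const|].
      apply (cder_mult (fun _ => q) (fun z => z)); [apply cder_const|apply cder_id]. }
    replace (p + q * z)%C with
      (1 * (p + / 2 * (q * z)) + z * (0 + (0 * (q * z) + / 2 * (0 * z + q * 1))))%C; [exact E|].
    field.
  - intros z. apply continuous_Cplus; [apply continuous_const|].
    apply continuous_Cmult; [apply continuous_const|apply continuous_id].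
Qed.

(* The corner of the [n]-th rectangle; its sides are [w / 2 ^ n] and [h / 2 ^ n]. *)
Definition Jn (F : C -> C) (w h : R) (n : nat) (p : R * R) : R :=
  Cmod (rect_int F (fst p) (fst p + w / 2 ^ n) (snd p) (snd p + h / 2 ^ n)).

(** The bisection in Goursat's proof: the chosen quarter carries at least a quarter of the boundary
    integral. The fourth quarter is the default, and [bstep_large] shows that the default is
    legitimate. *)
Definition bstep (F : C -> C) (w h : R) (n : nat) (p : R * R) : R * R :=
  let m := Jn F w h n p / 4 in
  let x' := fst p + w / 2 ^ S n in
  let y' := snd p + h / 2 ^ S n in
  if Rle_dec m (Jn F w h (S n) p) then p
  else if Rle_dec m (Jn F w h (S n) (x', snd p)) then (x', snd p)
  else if Rle_dec m (Jn F w h (S n) (fst p, y')) then (fst p, y')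
  else (x', y').

Fixpoint bseq (F : C -> C) (w h : R) (p : R * R) (n : nat) : R * R :=
  match n with
  | O => p
  | S k => bstep F w h k (bseq F w h p k)
  end.

Lemma bstep_range (F : C -> C) (w h : R) (n : nat) (p : R * R) : 0 <= w -> 0 <= h ->
  fst p <= fst (bstep F w h n p) <= fst p + w / 2 ^ S n /\
  snd p <= snd (bstep F w h n p) <= snd p + h / 2 ^ S n.
Proof.
  intros Hw Hh.
  assert (A : 0 <= w / 2 ^ S n) by (apply Rdiv_le_0_compat; [exact Hw|apply pow_lt; lra]).
  assert (B : 0 <= h / 2 ^ S n) by (apply Rdiv_le_0_compat; [exact Hh|apply pow_lt; lra]).
  unfold bstep. set (u := w / 2 ^ S n) in *. set (v := h / 2 ^ S n) in *. cbv zeta.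
  match goal with |- context [Rle_dec ?r ?s] => destruct (Rle_dec r s) as [_|_] end.
  { lra. }
  match goal with |- context [Rle_dec ?r ?s] => destruct (Rle_dec r s) as [_|_] end.
  { cbn [fst snd]. lra. }
  match goal with |- context [Rle_dec ?r ?s] => destruct (Rle_dec r s) as [_|_] end;
    cbn [fst snd]; lra.
Qed.

Lemma half_pow (w : R) (n : nat) : w / 2 ^ n = w / 2 ^ S n + w / 2 ^ S n.
Proof. simpl. field. apply pow_nonzero; lra. Qed.

Lemma bstep_large (F : C -> C) (w h : R) (n : nat) (p : R * R) : 0 <= w -> 0 <= h ->
  (forall z, rect (fst p) (fst p + w / 2 ^ n) (snd p) (snd p + h / 2 ^ n) z -> Ccont F z) ->
  Jn F w h n p / 4 <= Jn F w h (S n) (bstep F w h n p).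
Proof.
  intros Hw Hh HF.
  assert (A : 0 <= w / 2 ^ S n) by (apply Rdiv_le_0_compat; [exact Hw|apply pow_lt; lra]).
  assert (B : 0 <= h / 2 ^ S n) by (apply Rdiv_le_0_compat; [exact Hh|apply pow_lt; lra]).
  unfold bstep.
  destruct Rle_dec as [H1|H1]; [exact H1|].
  destruct Rle_dec as [H2|H2]; [exact H2|].
  destruct Rle_dec as [H3|H3]; [exact H3|].
  apply Rnot_le_lt in H1. apply Rnot_le_lt in H2. apply Rnot_le_lt in H3.
  (* If the fourth quarter failed too, the four integrals would add up to less than their sum. *)
  apply Rnot_lt_le. intros H4.
  unfold Jn in *. cbn [fst snd] in *.
  destruct p as [x y]. cbn [fst snd] in *.
  rewrite (half_pow w n), (half_pow h n) in *.
  set (u := w / 2 ^ S n) in *. set (v := h / 2 ^ S n) in *.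
  replace (x + u + u) with (x + (u + u)) in * by ring.
  replace (y + v + v) with (y + (v + v)) in * by ring.
  assert (E : rect_int F x (x + (u + u)) y (y + (v + v)) =
    (rect_int F x (x + u) y (y + v) + rect_int F x (x + u) (y + v) (y + (v + v)) +
     (rect_int F (x + u) (x + (u + u)) y (y + v) + rect_int F (x + u) (x + (u + u)) (y + v) (y + (v + v))))%C).
  { rewrite (rect_int_split_x F x (x + u)) by (lra || (intros; apply HF; assumption)).
    rewrite (rect_int_split_y F x (x + u) y (y + v)) by
      (lra || (intros z [Hz1 Hz2] _; apply HF; split; lra)).
    rewrite (rect_int_split_y F (x + u) (x + (u + u)) y (y + v)) by
      (lra || (intros z [Hz1 Hz2] _; apply HF; split; lra)).
    reflexivity. }
  set (j := rect_int F x (x + (u + u)) y (y + (v + v))) in *.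
  set (j1 := rect_int F x (x + u) y (y + v)) in *.
  set (j2 := rect_int F x (x + u) (y + v) (y + (v + v))) in *.
  set (j3 := rect_int F (x + u) (x + (u + u)) y (y + v)) in *.
  set (j4 := rect_int F (x + u) (x + (u + u)) (y + v) (y + (v + v))) in *.
  assert (T : Cmod j <= Cmod j1 + Cmod j2 + (Cmod j3 + Cmod j4)).
  { rewrite E. eapply Rle_trans; [apply Cmod_triangle|]. apply Rplus_le_compat; apply Cmod_triangle. }
  lra.
Qed.

(** The left ends increase and the right ends [x n + w / 2 ^ n] decrease, so the limit of the left
    ends lies in every interval. *)
Lemma nested_corner (x : nat -> R) (w : R) : 0 <= w ->
  (forall n, x n <= x (S n) <= x n + w / 2 ^ S n) ->
  exists l, forall n, x n <= l <= x n + w / 2 ^ n.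
Proof.
  intros Hw H.
  assert (Hmono : forall n m, x n <= x (n + m)%nat).
  { intros n m. induction m as [|m IH]; [rewrite Nat.add_0_r; lra|].
    rewrite Nat.add_succ_r. generalize (H (n + m)%nat); lra. }
  assert (Hup : forall n m, x (n + m)%nat + w / 2 ^ (n + m) <= x n + w / 2 ^ n).
  { intros n m. induction m as [|m IH]; [rewrite Nat.add_0_r; lra|].
    rewrite Nat.add_succ_r. generalize (H (n + m)%nat) (half_pow w (n + m)); lra. }
  assert (Hp : forall n, 0 <= w / 2 ^ n)
    by (intros n; apply Rdiv_le_0_compat; [exact Hw|apply pow_lt; lra]).
  destruct (ex_finite_lim_seq_incr x (x 0%nat + w)) as [l Hl].
  - intros n; apply H.
  - intros n. generalize (Hup 0%nat n) (Hp n). simpl. rewrite Rdiv_1_r. lra.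
  - exists l. intros n. split.
    + apply (is_lim_seq_incr_compare x); [exact Hl|intros; apply H].
    + apply (is_lim_seq_le (fun m => x (n + m)%nat) (fun _ => x n + w / 2 ^ n) l (x n + w / 2 ^ n)).
      * intros m. generalize (Hup n m) (Hp (n + m)%nat); lra.
      * apply (is_lim_seq_ext (fun m => x (m + n)%nat)); [intros; f_equal; lia|].
        apply is_lim_seq_incr_n. exact Hl.
      * apply is_lim_seq_const.
Qed.

Lemma pow2_small (K d : R) : 0 < d -> exists n, K / 2 ^ n < d.
Proof.
  intros Hd. assert (H : is_lim_seq (fun n => K * (/ 2) ^ n) 0).
  { replace (Finite 0) with (Rbar_mult K 0) by (simpl; f_equal; ring).
    apply is_lim_seq_scal_l. apply is_lim_seq_geom. rewrite Rabs_pos_eq; lra. }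
  destruct (proj2 (is_lim_seq_spec _ _) H (mkposreal _ Hd)) as [N HN]. exists N.
  specialize (HN N (Nat.le_refl N)). simpl in HN.
  apply Rabs_def2 in HN. rewrite pow_inv in HN. unfold Rdiv. lra.
Qed.

(** Bisection leads to a point where [F] is affine up to a small multiple of the distance. Affine
    functions have boundary integral 0, so the [n]-th integral is at most [2 * K * K * eta / 4 ^ n],
    while bisection keeps it at least the [4 ^ n]-th part of the original one. *)
Lemma goursat (F : C -> C) (a b c d : R) : a <= b -> c <= d ->
  (forall z, rect a b c d z -> cdiff F z) -> rect_int F a b c d = 0%C.
Proof.
  intros Hab Hcd HF.
  set (w := b - a). set (h := d - c).
  assert (Hw : 0 <= w) by (unfold w; lra). assert (Hh : 0 <= h) by (unfold h; lra).
  set (P := bseq F w h (a, c)).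
  assert (Hp2 : forall n, 0 < 2 ^ n) by (intros; apply pow_lt; lra).
  assert (Hst : forall n,
    (fst (P n) <= fst (P (S n)) <= fst (P n) + w / 2 ^ S n) /\
    (snd (P n) <= snd (P (S n)) <= snd (P n) + h / 2 ^ S n)).
  { intros n. apply (bstep_range F w h n (P n) Hw Hh). }
  assert (Hin : forall n, a <= fst (P n) /\ fst (P n) + w / 2 ^ n <= b /\
                          c <= snd (P n) /\ snd (P n) + h / 2 ^ n <= d).
  { induction n as [|n IH].
    - simpl. unfold Rdiv. rewrite Rinv_1. unfold w, h. lra.
    - generalize (Hst n) (half_pow w n) (half_pow h n). lra. }
  assert (HJ : forall n, Cmod (rect_int F a b c d) / 4 ^ n <= Jn F w h n (P n)).
  { induction n as [|n IH].
    - simpl. unfold Jn, Rdiv. simpl. rewrite Rinv_1, !Rmult_1_r. right.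
      unfold w, h. do 2 f_equal; ring.
    - apply Rle_trans with (Jn F w h n (P n) / 4).
      + assert (E : Cmod (rect_int F a b c d) / 4 ^ S n = Cmod (rect_int F a b c d) / 4 ^ n / 4)
          by (simpl; field; apply pow_nonzero; lra).
        rewrite E. lra.
      + apply (bstep_large F w h n (P n) Hw Hh). intros z [Hz1 Hz2].
        apply cdiff_continuous, HF. generalize (Hin n). split; lra. }
  destruct (nested_corner (fun n => fst (P n)) w Hw (fun n => proj1 (Hst n))) as [X HX].
  destruct (nested_corner (fun n => snd (P n)) h Hh (fun n => proj2 (Hst n))) as [Y HY].
  assert (Hz : rect a b c d (X, Y)).
  { generalize (HX 0%nat) (HY 0%nat) (Hin 0%nat). unfold rect; simpl. lra. }
  destruct (HF _ Hz) as [l Hl].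
  apply Cmod_eq_0. apply Rle_antisym; [|apply Cmod_ge_0]. apply le_epsilon. intros eps Heps.
  rewrite Rplus_0_l.
  set (K := w + h). assert (HK : 0 <= K) by (unfold K; lra).
  (* The final bound is [2 * K * K * eta]; the added 1 covers [K = 0]. *)
  set (eta := eps / (2 * K * K + 1)).
  assert (HKK : 0 < 2 * K * K + 1) by nra.
  assert (Heta : 0 < eta) by (apply Rdiv_lt_0_compat; assumption).
  destruct (cder_eps _ _ _ Hl eta Heta) as [del [Hdel Hc]].
  destruct (pow2_small K del Hdel) as [n Hn].
  set (x := fst (P n)). set (y := snd (P n)).
  assert (Hr : forall z, rect x (x + w / 2 ^ n) y (y + h / 2 ^ n) z -> rect a b c d z).
  { intros z [H1 H2]. generalize (Hin n). fold x y. split; lra. }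
  assert (Hwn : 0 <= w / 2 ^ n) by (apply Rdiv_le_0_compat; auto).
  assert (Hhn : 0 <= h / 2 ^ n) by (apply Rdiv_le_0_compat; auto).
  assert (HKn : w / 2 ^ n + h / 2 ^ n = K / 2 ^ n) by (unfold K; field; generalize (Hp2 n); lra).
  set (G := fun z : C => (F (X, Y) - l * (X, Y) + l * z)%C).
  assert (HG : forall z, Ccont G z).
  { intros z. apply continuous_Cplus; [apply continuous_const|].
    apply continuous_Cmult; [apply continuous_const|apply continuous_id]. }
  assert (EJ : rect_int F x (x + w / 2 ^ n) y (y + h / 2 ^ n) =
    rect_int (fun z => (F z - G z)%C) x (x + w / 2 ^ n) y (y + h / 2 ^ n)).
  { rewrite rect_int_minus; try lra.
    - unfold G. rewrite rect_int_affine by lra. ring.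
    - intros z [Hz1 _]. split; [|apply HG]. apply cdiff_continuous, HF, Hr, Hz1. }
  assert (HB : Jn F w h n (P n) <= 2 * (K / 2 ^ n) * (eta * (K / 2 ^ n))).
  { unfold Jn. fold x y. rewrite EJ.
    replace (2 * (K / 2 ^ n)) with (2 * ((x + w / 2 ^ n - x) + (y + h / 2 ^ n - y)))
      by (rewrite <- HKn; ring).
    apply rect_int_bound; try lra. intros z [Hz1 _].
    assert (Hzc : Cmod (z - (X, Y)) <= K / 2 ^ n).
    { eapply Rle_trans; [apply Cmod_le_ReIm|]. destruct z as [z1 z2]. destruct Hz1 as [Hz1 Hz2].
      simpl in Hz1, Hz2. simpl. generalize (HX n) (HY n). fold x y. simpl. intros.
      rewrite <- HKn. apply Rplus_le_compat; apply Rabs_le; lra. }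
    split.
    - apply continuous_Cminus; [apply cdiff_continuous, HF, Hr, Hz1|apply HG].
    - unfold G. replace (F z - (F (X, Y) - l * (X, Y) + l * z))%C with
        (F z - F (X, Y) - l * (z - (X, Y)))%C by ring.
      eapply Rle_trans; [apply Hc; lra|]. apply Rmult_le_compat_l; lra. }
  assert (H4 : 2 ^ n * 2 ^ n = 4 ^ n) by (rewrite <- Rpow_mult_distr; f_equal; ring).
  assert (H4p : 0 < 4 ^ n) by (apply pow_lt; lra).
  assert (HF1 : Cmod (rect_int F a b c d) <= 2 * K * K * eta).
  { apply Rmult_le_reg_r with (/ 4 ^ n); [apply Rinv_0_lt_compat; exact H4p|].
    eapply Rle_trans; [apply (HJ n)|]. eapply Rle_trans; [exact HB|].
    right. rewrite <- H4. field. generalize (Hp2 n); lra. }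
  eapply Rle_trans; [exact HF1|].
  apply Rmult_le_reg_r with (2 * K * K + 1); [exact HKK|].
  unfold eta. replace (2 * K * K * (eps / (2 * K * K + 1)) * (2 * K * K + 1)) with (2 * K * K * eps)
    by (field; lra). nra.
Qed.

(** * The residue theorem for one pole in a rectangle *)

Lemma is_derive_atan_scal (r t : R) : 0 < r ->
  is_derive (fun t => 4 * atan (t / r)) t (4 * r / (r * r + t * t)).
Proof.
  intros Hr. assert (0 < r * r) by nra. assert (0 <= t * t) by nra.
  auto_derive; [trivial|]. field. split; nra.
Qed.

Lemma square_ne (r t : R) : 0 < r -> ((t, r) : C) <> 0%C /\ ((r, t) : C) <> 0%C /\ ((t, (- r)%R) : C) <> 0%C /\ (((- r)%R, t) : C) <> 0%C.
Proof. intros Hr. repeat split; intros E; inversion E; lra. Qed.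

(** With all four sides parametrised by the same [t] in [[- r, r]], the real parts cancel and the
    sum of the integrands is [4 * r * i / (r ^ 2 + t ^ 2)]. The arctangent integrates it, so no
    complex logarithm is needed. *)
Lemma rect_int_inv_square (p : C) (r : R) : 0 < r ->
  rect_int (fun s => (/ (s - p))%C) (Re p - r) (Re p + r) (Im p - r) (Im p + r) =
  (2 * RtoC PI * Ci)%C.
Proof.
  intros Hr. destruct p as [p1 p2]. simpl Re. simpl Im.
  assert (Hsq : forall t, 0 < r * r + t * t) by (intros; nra).
  assert (Hsh : forall u v : R -> C, (forall t, u t <> 0%C) -> ccont u -> (forall t, u t = v t) ->
    ccont (fun t => (/ v t)%C)).
  { intros u v Hu Hc E t. apply continuous_Cinv; [|rewrite <- E; apply Hu].
    apply continuous_ext with u; [exact E|apply Hc]. }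
  assert (Hid : forall c : R, ccont (fun t => (t, c))).
  { intros c t. apply continuous_pairC; simpl; [apply continuous_id|apply continuous_const]. }
  assert (Hdi : forall c : R, ccont (fun t => (c, t))).
  { intros c t. apply continuous_pairC; simpl; [apply continuous_const|apply continuous_id]. }
  assert (I1 : is_Cint (fun t => (/ ((t, (- r)%R) : C))%C) (- r) r (Cint (fun t => (/ ((t, (- r)%R) : C))%C) (- r)%R r)).
  { apply Cint_correct. apply (Hsh (fun t => (t, - r)) (fun t => (t, - r))); auto.
    intros t; apply (square_ne r t Hr). }
  assert (I2 : is_Cint (fun t => (/ ((r, t) : C))%C) (- r) r (Cint (fun t => (/ ((r, t) : C))%C) (- r)%R r)).
  { apply Cint_correct. apply (Hsh (fun t => (r, t)) (fun t => (r, t))); auto.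
    intros t; apply (square_ne r t Hr). }
  assert (I3 : is_Cint (fun t => (/ ((t, r) : C))%C) (- r) r (Cint (fun t => (/ ((t, r) : C))%C) (- r)%R r)).
  { apply Cint_correct. apply (Hsh (fun t => (t, r)) (fun t => (t, r))); auto.
    intros t; apply (square_ne r t Hr). }
  assert (I4 : is_Cint (fun t => (/ (((- r)%R, t) : C))%C) (- r) r (Cint (fun t => (/ (((- r)%R, t) : C))%C) (- r)%R r)).
  { apply Cint_correct. apply (Hsh (fun t => (- r, t)) (fun t => (- r, t))); auto.
    intros t; apply (square_ne r t Hr). }
  assert (Sx : forall y c, c <> 0 -> y - p2 = c ->
    Cint (fun x => (/ ((x, y) - (p1, p2)))%C) (p1 - r) (p1 + r) = Cint (fun t => (/ ((t, c) : C))%C) (- r)%R r).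
  { intros y c Hc E. apply is_Cint_unique.
    apply is_Cint_ext with (fun x => (/ (((x + - p1)%R, c) : C))%C).
    - intros x _. f_equal. apply injective_projections; simpl; lra.
    - apply (is_Cint_shift (fun t => (/ ((t, c) : C))%C) (- p1)).
      replace (p1 - r + - p1) with (- r) by ring. replace (p1 + r + - p1) with r by ring.
      apply Cint_correct. apply (Hsh (fun t => (t, c)) (fun t => (t, c))); auto.
      intros t E2. inversion E2; auto. }
  assert (Sy : forall x c, c <> 0 -> x - p1 = c ->
    Cint (fun y => (/ ((x, y) - (p1, p2)))%C) (p2 - r) (p2 + r) = Cint (fun t => (/ ((c, t) : C))%C) (- r)%R r).
  { intros x c Hc E. apply is_Cint_unique.
    apply is_Cint_ext with (fun y => (/ ((c, (y + - p2)%R) : C))%C).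
    - intros y _. f_equal. apply injective_projections; simpl; lra.
    - apply (is_Cint_shift (fun t => (/ ((c, t) : C))%C) (- p2)).
      replace (p2 - r + - p2) with (- r) by ring. replace (p2 + r + - p2) with r by ring.
      apply Cint_correct. apply (Hsh (fun t => (c, t)) (fun t => (c, t))); auto.
      intros t E2. inversion E2; auto. }
  unfold rect_int.
  rewrite (Sx (p2 - r) (- r)), (Sx (p2 + r) r), (Sy (p1 + r) r), (Sy (p1 - r) (- r)) by lra.
  assert (I : is_Cint (fun t => (/ ((t, (- r)%R) : C) + Ci * / ((r, t) : C) - / ((t, r) : C) - Ci * / (((- r)%R, t) : C))%C)
    (- r) r (Cint (fun t => (/ ((t, (- r)%R) : C))%C) (- r)%R r + Ci * Cint (fun t => (/ ((r, t) : C))%C) (- r)%R r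
     - Cint (fun t => (/ ((t, r) : C))%C) (- r)%R r - Ci * Cint (fun t => (/ (((- r)%R, t) : C))%C) (- r)%R r)%C).
  { apply (is_Cint_minus (fun t => (/ ((t, (- r)%R) : C) + Ci * / ((r, t) : C) - / ((t, r) : C))%C)
      (fun t => (Ci * / (((- r)%R, t) : C))%C)); [|apply is_Cint_scal; exact I4].
    apply (is_Cint_minus (fun t => (/ ((t, (- r)%R) : C) + Ci * / ((r, t) : C))%C)
      (fun t => (/ ((t, r) : C))%C)); [|exact I3].
    apply (is_Cint_plus (fun t => (/ ((t, (- r)%R) : C))%C) (fun t => (Ci * / ((r, t) : C))%C)); [exact I1|].
    apply is_Cint_scal; exact I2. }
  apply (is_Cint_unique2 _ _ _ _ _ I).
  apply is_Cint_ext with (fun t => (Ci * RtoC (4 * r / (r * r + t * t)))%C).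
  { intros t _. specialize (Hsq t). apply injective_projections; simpl; field; nra. }
  replace (2 * RtoC PI * Ci)%C with (Ci * RtoC (4 * atan (r / r) - 4 * atan (- r / r)))%C.
  - apply is_Cint_scal. apply is_Cint_parts; simpl.
    + apply (is_RInt_derive (V := R_CompleteNormedModule) (fun t => 4 * atan (t / r))); intros t _.
      * apply is_derive_atan_scal; exact Hr.
      * apply (ex_derive_continuous (V := R_NormedModule)). specialize (Hsq t). auto_derive. lra.
    + assert (Z := is_RInt_const (V := R_NormedModule) (- r) r 0).
      assert (E0 : scal (r - - r) (0 : R_NormedModule) = 0) by (apply (scal_zero_r (V := R_ModuleSpace))).
      rewrite E0 in Z. exact Z.
  - replace (r / r) with 1 by (field; lra). replace (- r / r) with (- (1)) by (field; lra).
    rewrite atan_opp, atan_1. apply injective_projections; simpl; field.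
Qed.

(** The residue enters as the limit of [(s - p) * F s], so the value that the total function [F]
    takes at [p] is irrelevant. The rectangle is shrunk to a small square, on which [F] is compared
    with [r / (s - p)]. *)
Lemma rect_residue (F : C -> C) (a b c d : R) (p r : C) :
  a < Re p < b -> c < Im p < d ->
  (forall z, rect a b c d z -> z <> p -> cdiff F z) ->
  (forall eps, 0 < eps -> exists del, 0 < del /\ forall s, s <> p -> Cmod (s - p) < del ->
     Cmod ((s - p) * F s - r) <= eps) ->
  rect_int F a b c d = (2 * RtoC PI * Ci * r)%C.
Proof.
  intros Ha Hc HF Hr. apply C_eq_eps. intros eps Heps.
  (* The square has perimeter [8 * t], and [1 / (s - p)] is at most [1 / t] on it. *)
  assert (He8 : 0 < eps / 8) by lra.
  destruct (Hr _ He8) as [del [Hdel Hlim]].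
  set (m := Rmin (Rmin (Re p - a) (b - Re p)) (Rmin (Im p - c) (d - Im p))).
  assert (Hm : m <= Re p - a /\ m <= b - Re p /\ m <= Im p - c /\ m <= d - Im p).
  { unfold m. generalize (Rmin_l (Rmin (Re p - a) (b - Re p)) (Rmin (Im p - c) (d - Im p)))
     (Rmin_r (Rmin (Re p - a) (b - Re p)) (Rmin (Im p - c) (d - Im p)))
     (Rmin_l (Re p - a) (b - Re p)) (Rmin_r (Re p - a) (b - Re p))
     (Rmin_l (Im p - c) (d - Im p)) (Rmin_r (Im p - c) (d - Im p)). lra. }
  assert (Hm0 : 0 < m) by (unfold m; repeat apply Rmin_pos; lra).
  (* Half the distance to the sides keeps the square inside the rectangle; [del / 4] keeps its
     points, at distance at most [2 * t], inside the disc of radius [del]. *)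
  set (t := Rmin (m / 2) (del / 4)).
  assert (Ht0 : 0 < t) by (unfold t; apply Rmin_pos; lra).
  assert (Htm : t < m) by (generalize (Rmin_l (m / 2) (del / 4)); unfold t; lra).
  assert (Htd : t <= del / 4) by (unfold t; apply Rmin_r).
  set (p1 := Re p) in *. set (p2 := Im p) in *.
  assert (Hne : forall z, Re z <> p1 \/ Im z <> p2 -> z <> p)
    by (intros z Hz E; subst z; unfold p1, p2 in Hz; tauto).
  assert (HC : forall z, rect a b c d z -> Re z <> p1 \/ Im z <> p2 -> Ccont F z).
  { intros z Hz Hn. apply cdiff_continuous, HF; [exact Hz|apply Hne, Hn]. }
  assert (HG : forall a' b' c' d', a <= a' -> b' <= b -> c <= c' -> d' <= d -> a' <= b' -> c' <= d' ->
    b' < p1 \/ p1 < a' \/ d' < p2 \/ p2 < c' -> rect_int F a' b' c' d' = 0%C).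
  { intros. apply goursat; try assumption. intros z [Hz1 Hz2]. apply HF; [split; lra|].
    apply Hne. lra. }
  assert (EJ : rect_int F a b c d = rect_int F (p1 - t) (p1 + t) (p2 - t) (p2 + t)).
  { rewrite (rect_int_split_x F a (p1 - t) b) by (lra || (intros z Hz Hd; apply HC; [exact Hz|lra])).
    rewrite (HG a (p1 - t)) by lra.
    (* Strips to the left, to the right, below and above are cut off in turn; each is free of the
       pole and contributes 0. *)
    rewrite (rect_int_split_x F (p1 - t) (p1 + t) b) by
      (lra || (intros z [Hz1 Hz2] Hd; apply HC; [split; lra|lra])).
    rewrite (HG (p1 + t) b) by lra.
    rewrite (rect_int_split_y F (p1 - t) (p1 + t) c (p2 - t) d) by
      (lra || (intros z [Hz1 Hz2] Hd; apply HC; [split; lra|lra])).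
    rewrite (HG (p1 - t) (p1 + t) c (p2 - t)) by lra.
    rewrite (rect_int_split_y F (p1 - t) (p1 + t) (p2 - t) (p2 + t) d) by
      (lra || (intros z [Hz1 Hz2] Hd; apply HC; [split; lra|lra])).
    rewrite (HG (p1 - t) (p1 + t) (p2 + t) d) by lra. ring. }
  rewrite EJ.
  assert (Hbd : forall z, bdry (p1 - t) (p1 + t) (p2 - t) (p2 + t) z ->
    rect a b c d z /\ z <> p /\ t <= Cmod (z - p) < del).
  { intros z [[H1 H2] H3].
    assert (Hn : z <> p) by (apply Hne; lra).
    split; [split; lra|]. split; [exact Hn|].
    assert (E1 : Re (z - p) = Re z - p1) by reflexivity.
    assert (E2 : Im (z - p) = Im z - p2) by reflexivity.
    split.
    - generalize (Re_le_Cmod (z - p)) (Im_le_Cmod (z - p)). rewrite E1, E2.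
      intros A B. destruct H3 as [H3|[H3|[H3|H3]]]; rewrite H3 in *.
      + rewrite Rabs_left in A by lra. lra.
      + rewrite Rabs_pos_eq in A by lra. lra.
      + rewrite Rabs_left in B by lra. lra.
      + rewrite Rabs_pos_eq in B by lra. lra.
    - eapply Rle_lt_trans; [apply Cmod_le_ReIm|]. rewrite E1, E2.
      assert (Rabs (Re z - p1) <= t) by (apply Rabs_le; lra).
      assert (Rabs (Im z - p2) <= t) by (apply Rabs_le; lra). lra. }
  set (G := fun s => (/ (s - p))%C).
  assert (Hsub : forall z : C, z <> p -> (z - p)%C <> 0%C).
  { intros z Hz E. apply Hz. replace z with (z - p + p)%C by ring. rewrite E. ring. }
  assert (HGc : forall z, z <> p -> Ccont G z).
  { intros z Hz. apply continuous_Cinv; [|apply Hsub, Hz].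
    apply continuous_Cminus; [apply continuous_id|apply continuous_const]. }
  assert (EG : rect_int (fun s => (r * G s)%C) (p1 - t) (p1 + t) (p2 - t) (p2 + t) = (2 * RtoC PI * Ci * r)%C).
  { rewrite rect_int_scal; try lra.
    - unfold G, p1, p2. rewrite rect_int_inv_square by exact Ht0. ring.
    - intros z Hz. apply HGc. apply (Hbd z Hz). }
  rewrite <- EG. rewrite <- rect_int_minus; try lra.
  2: { intros z Hz. destruct (Hbd z Hz) as [H1 [H2 H3]]. split.
    - apply cdiff_continuous, HF; assumption.
    - apply continuous_Cmult; [apply continuous_const|apply HGc; exact H2]. }
  apply Rle_trans with (2 * ((p1 + t - (p1 - t)) + (p2 + t - (p2 - t))) * (eps / 8 / t)).
  - apply rect_int_bound; try lra. intros z Hz. destruct (Hbd z Hz) as [H1 [H2 H3]]. split.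
    + apply continuous_Cminus; [apply cdiff_continuous, HF; assumption|].
      apply continuous_Cmult; [apply continuous_const|apply HGc; exact H2].
    + unfold G. assert (Hn := Hsub z H2).
      replace (F z - r * / (z - p))%C with (((z - p) * F z - r) / (z - p))%C by (field; exact Hn).
      rewrite Cmod_div by exact Hn.
      assert (H4 := Hlim z H2 (proj2 H3)).
      unfold Rdiv. apply Rmult_le_compat; [apply Cmod_ge_0|left; apply Rinv_0_lt_compat; lra|exact H4|].
      apply Rinv_le_contravar; lra.
  - right. field. lra.
Qed.

(** * Moving vertical lines of integration *)

Lemma ccont_bounded (f : R -> C) (a b : R) : ccont f ->
  exists M, forall u, a <= u <= b -> Cmod (f u) <= M.
Proof.
  intros H.
  destruct (bounded_continuity (V := C_R_NormedModule) f a b (fun x _ => H x)) as [M HM].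
  exists M. intros u Hu. left. rewrite <- C_norm. apply HM, Hu.
Qed.

Lemma exp_le (x y : R) : x <= y -> exp x <= exp y.
Proof. intros [H|H]; [left; apply exp_increasing, H|right; rewrite H; reflexivity]. Qed.

(** On [[-1, 1]] a continuous function is bounded, and the factor [exp e] in the constant offsets
    the decay there. *)
Lemma dexp_tail (f : R -> C) (M e : R) : ccont f -> 0 < e ->
  (forall u, 1 <= Rabs u -> Cmod (f u) <= M * exp (- e * Rabs u)) -> dexp f.
Proof.
  intros Hc He Hb. destruct (ccont_bounded f (-1) 1 Hc) as [N HN].
  exists (Rabs M + Rabs N * exp e), e. split; [exact Hc|split; [exact He|]]. intros u.
  assert (P := exp_pos (- e * Rabs u)).
  assert (HM := Rle_abs M). assert (HN2 := Rle_abs N).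
  assert (0 <= Rabs N * exp e) by (apply Rmult_le_pos; [apply Rabs_pos|left; apply exp_pos]).
  destruct (Rle_dec 1 (Rabs u)) as [Hu|Hu].
  - eapply Rle_trans; [apply Hb, Hu|]. apply Rmult_le_compat_r; lra.
  - assert (Hu1 : -1 <= u <= 1) by (apply Rnot_le_lt, Rabs_def2 in Hu; lra).
    apply Rle_trans with (Rabs N * 1); [rewrite Rmult_1_r; eapply Rle_trans; [apply HN, Hu1|apply Rle_abs]|].
    apply Rle_trans with (Rabs N * exp e * exp (- e * Rabs u)).
    + rewrite Rmult_assoc. apply Rmult_le_compat_l; [apply Rabs_pos|].
      rewrite <- exp_plus, <- exp_0. apply exp_le. apply Rnot_le_lt in Hu. nra.
    + apply Rmult_le_compat_r; [lra|]. generalize (Rabs_pos M). lra.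
Qed.

(** The band [|Im z| < 1] is left out since [strip_residue] allows a pole on the real axis inside
    the strip. *)
Definition strip_tail (F : C -> C) (a b M e : R) : Prop :=
  forall z, a <= Re z <= b -> 1 <= Rabs (Im z) -> Cmod (F z) <= M * exp (- e * Rabs (Im z)).

(** The height of the rectangles tends to infinity and the horizontal sides disappear. Here [k] is
    the common value of the boundary integrals: 0 in [strip_shift], the residue in
    [strip_residue]. *)
Lemma strip_lines (F : C -> C) (a b M e : R) (k : C) : a < b -> 0 < e ->
  (forall z, a <= Re z <= b -> Re z = a \/ Re z = b \/ 1 <= Rabs (Im z) -> Ccont F z) ->
  strip_tail F a b M e ->
  (forall T, 1 <= T -> rect_int F a b (- T) T = k) ->
  dexp (fun y => F (a, y)) /\ dexp (fun y => F (b, y)) /\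
  (Ci * line (fun y => F (b, y)) - Ci * line (fun y => F (a, y)))%C = k.
Proof.
  intros Hab He Hc Ht HJ.
  assert (Da : dexp (fun y => F (a, y))).
  { apply dexp_tail with M e; [|exact He|].
    - intros y. apply Ccont_ver, Hc; simpl; lra.
    - intros u Hu. apply (Ht (a, u)); simpl; [lra|exact Hu]. }
  assert (Db : dexp (fun y => F (b, y))).
  { apply dexp_tail with M e; [|exact He|].
    - intros y. apply Ccont_ver, Hc; simpl; lra.
    - intros u Hu. apply (Ht (b, u)); simpl; [lra|exact Hu]. }
  split; [exact Da|split; [exact Db|]].
  apply C_eq_eps. intros eps Heps. assert (He4 : 0 < eps / 4) by lra.
  destruct (line_lim _ Da _ He4) as [T1 [HT1 H1]].
  destruct (line_lim _ Db _ He4) as [T2 [HT2 H2]].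
  destruct (exp_small ((b - a) * M) e _ He He4) as [T3 [HT3 H3]].
  set (T := Rmax 1 (Rmax T1 (Rmax T2 T3))).
  assert (HT : 1 <= T /\ T1 <= T /\ T2 <= T /\ T3 <= T).
  { unfold T. generalize (Rmax_l 1 (Rmax T1 (Rmax T2 T3))) (Rmax_r 1 (Rmax T1 (Rmax T2 T3)))
     (Rmax_l T1 (Rmax T2 T3)) (Rmax_r T1 (Rmax T2 T3)) (Rmax_l T2 T3) (Rmax_r T2 T3). lra. }
  specialize (H1 (- T) T ltac:(lra) ltac:(lra)). specialize (H2 (- T) T ltac:(lra) ltac:(lra)).
  specialize (H3 T ltac:(lra)).
  rewrite <- (HJ T) by lra.
  assert (Hh : forall y, Rabs y = T -> Cmod (Cint (fun x => F (x, y)) a b) <= (b - a) * M * exp (- e * T)).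
  { intros y Hy. rewrite Rmult_assoc. apply (is_Cint_bound_const (fun x => F (x, y))); [lra| |].
    - intros x Hx. rewrite <- Hy. apply (Ht (x, y)); simpl; lra.
    - apply is_Cint_hor; [lra|]. intros x Hx. apply Hc; simpl; lra. }
  assert (A1 := Hh T (Rabs_pos_eq T ltac:(lra))).
  assert (A2 := Hh (- T) ltac:(rewrite Rabs_Ropp; apply Rabs_pos_eq; lra)).
  unfold rect_int.
  set (la := line (fun y => F (a, y))) in *. set (lb := line (fun y => F (b, y))) in *.
  set (ia := Cint (fun y => F (a, y)) (- T) T) in *. set (ib := Cint (fun y => F (b, y)) (- T) T) in *.
  set (h1 := Cint (fun x => F (x, (- T)%R)) a b) in *. set (h2 := Cint (fun x => F (x, T)) a b) in *.
  replace (Ci * lb - Ci * la - (h1 + Ci * ib - h2 - Ci * ia))%C with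
    ((Ci * (lb - ib) + - (Ci * (la - ia))) + (- h1 + h2))%C by ring.
  generalize (Cmod_triangle (Ci * (lb - ib) + - (Ci * (la - ia))) (- h1 + h2))
    (Cmod_triangle (Ci * (lb - ib)) (- (Ci * (la - ia)))) (Cmod_triangle (- h1) h2).
  rewrite !Cmod_opp, !Cmod_mult, Cmod_Ci. lra.
Qed.

Lemma Ci_neq_0 : Ci <> 0%C.
Proof. intros E. inversion E. lra. Qed.

Lemma strip_shift (F : C -> C) (a b M e : R) : a < b -> 0 < e ->
  (forall z, a <= Re z <= b -> cdiff F z) -> strip_tail F a b M e ->
  dexp (fun y => F (a, y)) /\ dexp (fun y => F (b, y)) /\
  line (fun y => F (a, y)) = line (fun y => F (b, y)).
Proof.
  intros Hab He Hc Ht.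
  destruct (strip_lines F a b M e 0%C Hab He) as [Da [Db E]].
  - intros z Hz _. apply cdiff_continuous, Hc, Hz.
  - exact Ht.
  - intros T HT. apply goursat; try lra. intros z [Hz _]. apply Hc, Hz.
  - split; [exact Da|split; [exact Db|]].
    set (la := line (fun y => F (a, y))) in *. set (lb := line (fun y => F (b, y))) in *.
    replace la with (lb - / Ci * (Ci * lb - Ci * la))%C by (field; apply Ci_neq_0).
    rewrite E. ring.
Qed.

(** On vertical lines [dz = i dy], which cancels the [Ci] of the residue theorem. *)
Lemma strip_residue (F : C -> C) (a b M e p : R) (r : C) : a < p < b -> 0 < e ->
  (forall z, a <= Re z <= b -> z <> RtoC p -> cdiff F z) -> strip_tail F a b M e ->
  (forall eps, 0 < eps -> exists del, 0 < del /\ forall s, s <> RtoC p -> Cmod (s - RtoC p) < del ->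
     Cmod ((s - RtoC p) * F s - r) <= eps) ->
  dexp (fun y => F (a, y)) /\ dexp (fun y => F (b, y)) /\
  line (fun y => F (b, y)) = (line (fun y => F (a, y)) + 2 * RtoC PI * r)%C.
Proof.
  intros Hp He Hc Ht Hr.
  destruct (strip_lines F a b M e (2 * RtoC PI * Ci * r)%C ltac:(lra) He) as [Da [Db E]].
  - intros z Hz Hd. apply cdiff_continuous, Hc; [exact Hz|]. intros E. subst z. simpl in *.
    rewrite Rabs_R0 in Hd. lra.
  - exact Ht.
  - intros T HT. apply rect_residue with (RtoC p); simpl; try lra; [|exact Hr].
    intros z [Hz _] Hn. apply Hc; assumption.
  - split; [exact Da|split; [exact Db|]].
    set (la := line (fun y => F (a, y))) in *. set (lb := line (fun y => F (b, y))) in *.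
    replace lb with (la + / Ci * (Ci * lb - Ci * la))%C by (field; apply Ci_neq_0).
    rewrite E. field. apply Ci_neq_0.
Qed.

Lemma Re_Cplus (a b : C) : Re (a + b) = Re a + Re b.
Proof. reflexivity. Qed.
Lemma Re_Cminus (a b : C) : Re (a - b) = Re a - Re b.
Proof. reflexivity. Qed.
Lemma Re_Copp (a : C) : Re (- a) = - Re a.
Proof. reflexivity. Qed.
Lemma Re_RtoC (x : R) : Re (RtoC x) = x.
Proof. reflexivity. Qed.
Lemma Re_Cscal (x : R) (z : C) : Re (RtoC x * z) = x * Re z.
Proof. destruct z; simpl; ring. Qed.
Lemma Im_Cplus (a b : C) : Im (a + b) = Im a + Im b.
Proof. reflexivity. Qed.
Lemma Im_Cminus (a b : C) : Im (a - b) = Im a - Im b.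
Proof. reflexivity. Qed.
Lemma Im_Copp (a : C) : Im (- a) = - Im a.
Proof. reflexivity. Qed.
Lemma Im_RtoC (x : R) : Im (RtoC x) = 0.
Proof. reflexivity. Qed.
Lemma Im_Cscal (x : R) (z : C) : Im (RtoC x * z) = x * Im z.
Proof. destruct z; simpl; ring. Qed.

Ltac reim := rewrite ?Re_Cplus, ?Re_Cminus, ?Re_Copp, ?Re_Cscal, ?Re_RtoC,
  ?Im_Cplus, ?Im_Cminus, ?Im_Copp, ?Im_Cscal, ?Im_RtoC.

(** * The Gamma function *)

(** The factor [c] is 1 for Euler's integral, [cos t] on a rotated path, and [/ 2] when half of the
    decay has been spent on a Bessel series. *)
Lemma gker_bound (a b c : R) : 0 < a -> a <= b -> 0 < c ->
  exists M, 0 < M /\ forall x u, a <= x <= b -> exp (x * u - c * exp u) <= M * exp (- a * Rabs u).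
Proof.
  (* [L] is chosen so that [c * exp u = N * exp (u - L) >= N * (1 + u - L)]; the slope [N = a + b]
     cancels [x * u <= b * u] and leaves [- a * u]. *)
  intros Ha Hab Hc. set (N := a + b). assert (HN : 0 < N) by (unfold N; lra).
  set (L := ln (N / c)). assert (HL : exp L = N / c)
    by (apply exp_ln, Rdiv_lt_0_compat; assumption).
  exists (1 + exp (N * (L - 1))). split; [generalize (exp_pos (N * (L - 1))); lra|].
  intros x u Hx. assert (P := exp_pos u). assert (Q := exp_pos (- a * Rabs u)).
  assert (Q2 := exp_pos (N * (L - 1))).
  destruct (Rle_dec 0 u) as [Hu|Hu].
  - rewrite Rabs_pos_eq in * by exact Hu.
    apply Rle_trans with (exp (N * (L - 1)) * exp (- a * u)); [|nra].
    rewrite <- exp_plus. apply exp_le.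
    assert (E : c * exp u = N * exp (u - L)).
    { unfold Rminus. rewrite exp_plus, exp_Ropp, HL. field. lra. }
    assert (H1 := exp_ineq1_le (u - L)). rewrite E. unfold N in *. nra.
  - apply Rnot_le_lt in Hu. rewrite Rabs_left in * by exact Hu.
    apply Rle_trans with (1 * exp (- a * - u)); [|nra].
    rewrite Rmult_1_l. apply exp_le. nra.
Qed.

(* The integrand of Euler's integral after the substitution [t = exp u]. *)
Definition gker (z : C) (u : R) : C := Cexp (z * RtoC u - RtoC (exp u)).
Definition egamma (z : C) : C := line (gker z).

Lemma Cmod_gker (z : C) (u : R) : Cmod (gker z u) = exp (Re z * u - 1 * exp u).
Proof. unfold gker. rewrite Cmod_Cexp. f_equal. destruct z; simpl. ring. Qed.

Lemma gker_cont (z : C) : ccont (gker z).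
Proof.
  intros u. apply continuous_Cexp, continuous_Cminus.
  - apply continuous_Cmult; [apply continuous_const|apply continuous_RtoC, continuous_id].
  - apply continuous_RtoC, continuous_exp.
Qed.

Lemma gker_edom (a b : R) : 0 < a -> a <= b -> exists M, 0 < M /\
  forall z, a <= Re z <= b -> edom (gker z) M a.
Proof.
  intros Ha Hab. destruct (gker_bound a b 1 Ha Hab Rlt_0_1) as [M [HM H]].
  exists M. split; [exact HM|]. intros z Hz. split; [apply gker_cont|split; [exact Ha|]].
  intros u. rewrite Cmod_gker. apply H, Hz.
Qed.

Lemma gker_dexp (z : C) : 0 < Re z -> dexp (gker z).
Proof.
  intros Hz. destruct (gker_edom (Re z) (Re z) Hz (Rle_refl _)) as [M [_ H]].
  exists M, (Re z). apply H. lra.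
Qed.

Lemma dexp_lim0 (f : R -> C) : dexp f -> forall eps, 0 < eps ->
  exists T, forall t, T <= t -> Cmod (f t) < eps /\ Cmod (f (- t)) < eps.
Proof.
  intros [M [e [Hc [He Hb]]]] eps Heps.
  destruct (exp_small M e eps He Heps) as [T [HT H]]. exists T. intros t Ht.
  specialize (H t Ht). generalize (Hb t) (Hb (- t)). rewrite Rabs_Ropp, Rabs_pos_eq by lra. lra.
Qed.

Lemma gker_derive (z : C) (u : R) :
  is_derive (V := C_R_NormedModule) (gker z) u (z * gker z u - gker (z + 1) u)%C.
Proof.
  replace (gker (z + 1) u) with (RtoC (exp u) * gker z u)%C.
  - destruct z as [x y]. apply is_derive_pairC; simpl.
    + auto_derive; [trivial|]. unfold Rminus; ring.
    + auto_derive; [trivial|]. unfold Rminus; ring.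
  - unfold gker. rewrite <- Cexp_R, <- Cexp_plus. f_equal. ring.
Qed.

(** [gker z] vanishes at both ends and has derivative [z * gker z - gker (z + 1)]: the usual
    integration by parts. *)
Lemma egamma_succ (z : C) : 0 < Re z -> egamma (z + 1) = (z * egamma z)%C.
Proof.
  intros Hz.
  assert (D1 := gker_dexp z Hz).
  assert (D2 : dexp (gker (z + 1))) by (apply gker_dexp; reim; lra).
  assert (D3 := dexp_scal z _ D1).
  assert (D4 : dexp (fun u => (z * gker z u - gker (z + 1) u)%C)).
  { apply dexp_ext with (fun u => (z * gker z u + (-1) * gker (z + 1) u)%C); [intros; ring|].
    apply dexp_plus; [exact D3|apply dexp_scal; exact D2]. }
  assert (H := line_ftc (gker z) _ 0%C 0%C (gker_derive z) D4).
  rewrite line_minus, line_scal in H; try assumption.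
  unfold egamma. replace (line (gker (z + 1))) with (z * line (gker z) - (z * line (gker z) - line (gker (z + 1))))%C by ring.
  rewrite H; [ring| |]; intros eps Heps; destruct (dexp_lim0 _ D1 eps Heps) as [T HT];
    exists T; intros t Ht.
  - replace (gker z (- t) - 0)%C with (gker z (- t)) by ring. apply HT, Ht.
  - replace (gker z t - 0)%C with (gker z t) by ring. apply HT, Ht.
Qed.

Lemma egamma_1 : egamma 1 = 1%C.
Proof.
  assert (D : dexp (gker 1)) by (apply gker_dexp; reim; lra).
  unfold egamma. replace (RtoC 1) with (0 - -1)%C at 2 by ring.
  apply (line_ftc (fun u => RtoC (- exp (- exp u)))); [|exact D| |].
  - intros u. apply is_derive_pairC; simpl.
    + auto_derive; [trivial|]. unfold Rminus.
      replace (1 * u + - (0 * 0) + - exp u) with (u + - exp u) by ring.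
      replace (1 * 0 + 0 * u + - 0) with 0 by ring. rewrite cos_0, exp_plus. ring.
    + replace (1 * 0 + 0 * u + - 0) with 0 by ring. rewrite sin_0, Rmult_0_r.
      apply (is_derive_const (V := R_NormedModule)).
  - intros eps Heps. destruct (exp_small 1 1 eps Rlt_0_1 Heps) as [T [HT H]].
    exists T. intros t Ht. specialize (H t Ht).
    replace (RtoC (- exp (- exp (- t))) - -1)%C with (RtoC (1 - exp (- exp (- t))))
      by (rewrite RtoC_minus, RtoC_opp; ring).
    rewrite Cmod_R.
    assert (H1 := exp_ineq1_le (- exp (- t))). assert (H2 := exp_pos (- t)).
    assert (H3 : exp (- exp (- t)) < 1) by (rewrite <- exp_0; apply exp_increasing; lra).
    rewrite Rabs_pos_eq by lra. replace (- (1) * t) with (- t) in H by ring. lra.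
  - intros eps Heps. destruct (exp_small 1 1 eps Rlt_0_1 Heps) as [T [HT H]].
    exists T. intros t Ht. specialize (H t Ht).
    replace (RtoC (- exp (- exp t)) - 0)%C with (- RtoC (exp (- exp t)))%C
      by (rewrite RtoC_opp; ring).
    rewrite Cmod_opp, Cmod_R, Rabs_pos_eq by (left; apply exp_pos).
    eapply Rle_lt_trans; [|exact H]. rewrite Rmult_1_l. apply exp_le.
    generalize (exp_ineq1_le t); lra.
Qed.

Lemma egamma_fact (n : nat) : egamma (RtoC (INR n) + 1) = RtoC (INR (fact n)).
Proof.
  induction n as [|n IH].
  - simpl INR. replace (RtoC 0 + 1)%C with (RtoC 1) by ring. rewrite egamma_1. reflexivity.
  - rewrite egamma_succ by (rewrite S_INR; reim; generalize (pos_INR n); lra).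
    rewrite S_INR at 2. rewrite RtoC_plus, IH.
    change (fact (S n)) with (S n * fact n)%nat. rewrite mult_INR, RtoC_mult. reflexivity.
Qed.

Lemma sq_le_exp (k t : R) : 0 < k -> 0 <= t -> t * t <= 4 / (k * k) * exp (k * t).
Proof.
  intros Hk Ht. assert (H := exp_ineq1_le (k * t / 2)).
  assert (E2 : exp (k * t) = exp (k * t / 2) * exp (k * t / 2)) by (rewrite <- exp_plus; f_equal; field).
  rewrite E2. assert (0 <= k * t) by (apply Rmult_le_pos; lra).
  assert (H2 : (k * t / 2) * (k * t / 2) <= exp (k * t / 2) * exp (k * t / 2))
    by (apply Rmult_le_compat; lra).
  replace (t * t) with (4 / (k * k) * ((k * t / 2) * (k * t / 2))) by (field; lra).
  apply Rmult_le_compat_l; [|exact H2].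
  apply Rdiv_le_0_compat; nra.
Qed.

Lemma dexp_mult_id (f : R -> C) : dexp f -> dexp (fun u => (RtoC u * f u)%C).
Proof.
  intros [M [e H]]. assert (HM := edom_pos _ _ _ H). destruct H as [Hc [He Hb]].
  exists (2 / e * M), (e / 2). split; [|split; [lra|]].
  - intros u. apply continuous_Cmult; [apply continuous_RtoC, continuous_id|apply Hc].
  - intros u. rewrite Cmod_mult, Cmod_R.
    assert (H1 := exp_ineq1_le (e / 2 * Rabs u)). assert (P := Rabs_pos u).
    assert (H2 : Rabs u <= 2 / e * exp (e / 2 * Rabs u)).
    { apply Rmult_le_reg_l with (e / 2); [lra|].
      replace (e / 2 * (2 / e * exp (e / 2 * Rabs u))) with (exp (e / 2 * Rabs u)) by (field; lra). lra. }
    apply Rle_trans with ((2 / e * exp (e / 2 * Rabs u)) * (M * exp (- e * Rabs u))).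
    + apply Rmult_le_compat; [exact P|apply Cmod_ge_0|exact H2|apply Hb].
    + right. replace (- (e / 2) * Rabs u) with (e / 2 * Rabs u + - e * Rabs u) by field.
      rewrite exp_plus. ring.
Qed.

(** Differentiation under the integral: [gker w] is [gker z] times [Cexp ((w - z) * u)], and the
    second-order remainder of that exponential is still integrable against [gker z]. *)
Lemma egamma_cder (z : C) : 0 < Re z -> cder egamma z (line (fun u => (RtoC u * gker z u)%C)).
Proof.
  intros Hz. set (x := Re z) in *.
  destruct (gker_edom x x Hz (Rle_refl _)) as [M [HM HE]].
  assert (Hzd : edom (gker z) M x) by (apply HE; unfold x; lra).
  assert (D1 : dexp (gker z)) by (exists M, x; exact Hzd).
  assert (D2 := dexp_mult_id _ D1).
  apply cder_of_eps. intros eps Heps.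
  (* Of the decay rate [x], one quarter absorbs [exp (|k| * |u|)] and one quarter absorbs [|u| ^ 2],
     at the price [4 / (x / 4) ^ 2 = 64 / x ^ 2]; the rate [x / 2] remains. *)
  set (K := 2 * (M * (64 / (x * x))) / (x / 2)).
  assert (HK : 0 < K).
  { unfold K. apply Rdiv_lt_0_compat; [|lra]. apply Rmult_lt_0_compat; [lra|].
    apply Rmult_lt_0_compat; [exact HM|apply Rdiv_lt_0_compat; nra]. }
  exists (Rmin (x / 4) (eps / K)). split; [apply Rmin_pos; [lra|apply Rdiv_lt_0_compat; assumption]|].
  intros w Hw.
  assert (Hw1 : Cmod (w - z) < x / 4) by (eapply Rlt_le_trans; [exact Hw|apply Rmin_l]).
  assert (Hw2 : Cmod (w - z) < eps / K) by (eapply Rlt_le_trans; [exact Hw|apply Rmin_r]).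
  assert (Hwr : 0 < Re w).
  { assert (H := Re_le_Cmod (w - z)). rewrite Re_Cminus in H. fold x in H.
    generalize (Rabs_def2 (Re w - x) (x / 4) ltac:(lra)). lra. }
  assert (D3 := gker_dexp w Hwr).
  set (k := (w - z)%C) in *.
  assert (Ew : (egamma w - egamma z - line (fun u => (RtoC u * gker z u)%C) * k)%C =
    line (fun u => (gker z u * (Cexp (k * RtoC u) - 1 - k * RtoC u))%C)).
  { unfold egamma. rewrite Cmult_comm, <- line_scal, <- line_minus, <- line_minus; try assumption.
    - apply line_ext. intros u.
      replace (gker w u) with (gker z u * Cexp (k * RtoC u))%C; [ring|].
      unfold gker. rewrite <- Cexp_plus. f_equal. unfold k. ring.
    - apply dexp_ext with (fun u => (gker w u + (-1) * gker z u)%C); [intros; ring|].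
      apply dexp_plus; [exact D3|apply dexp_scal; exact D1].
    - apply dexp_scal; exact D2. }
  rewrite Ew.
  assert (Hdom : edom (fun u => (gker z u * (Cexp (k * RtoC u) - 1 - k * RtoC u))%C)
     (M * (64 / (x * x)) * (Cmod k * Cmod k)) (x / 2)).
  { split; [|split; [lra|]].
    - intros u. apply continuous_Cmult; [apply gker_cont|].
      assert (Hl : continuous (U := C_UniformSpace) (fun u : R => (k * RtoC u)%C) u)
        by (apply continuous_Cmult; [apply continuous_const|apply continuous_RtoC, continuous_id]).
      apply continuous_Cminus; [apply continuous_Cminus; [apply continuous_Cexp, Hl|apply continuous_const]|exact Hl].
    - intros u. rewrite Cmod_mult.
      assert (H1 := proj2 (proj2 Hzd) u).
      assert (H2 := Cexp_sub2_bound (k * RtoC u)%C). rewrite Cmod_mult, Cmod_R in H2.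
      set (r := Cmod k) in *. assert (Hr : 0 <= r) by apply Cmod_ge_0.
      set (v := Rabs u) in *. assert (Hv : 0 <= v) by apply Rabs_pos.
      assert (H3 : exp (r * v) <= exp (x / 4 * v)) by (apply exp_le; nra).
      assert (H4 := sq_le_exp (x / 4) v ltac:(lra) Hv).
      assert (H5 : r * v * (r * v) * exp (r * v) <=
        (r * r) * (4 / (x / 4 * (x / 4)) * exp (x / 4 * v)) * exp (x / 4 * v)).
      { apply Rmult_le_compat; [nra|left; apply exp_pos| |exact H3].
        replace (r * v * (r * v)) with (r * r * (v * v)) by ring.
        apply Rmult_le_compat_l; [nra|exact H4]. }
      apply Rle_trans with ((M * exp (- x * v)) *
        ((r * r) * (4 / (x / 4 * (x / 4)) * exp (x / 4 * v)) * exp (x / 4 * v))).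
      + apply Rmult_le_compat; [apply Cmod_ge_0|apply Cmod_ge_0|exact H1|].
        eapply Rle_trans; [exact H2|exact H5].
      + right. replace (- (x / 2) * v) with (- x * v + x / 4 * v + x / 4 * v) by field.
        rewrite !exp_plus. field. lra. }
  eapply Rle_trans; [apply (line_bound _ _ _ Hdom)|].
  replace (2 * (M * (64 / (x * x)) * (Cmod k * Cmod k)) / (x / 2)) with (K * Cmod k * Cmod k)
    by (unfold K; field; lra).
  apply Rmult_le_compat_r; [apply Cmod_ge_0|].
  apply Rmult_le_reg_l with (/ K); [apply Rinv_0_lt_compat; exact HK|].
  rewrite <- Rmult_assoc, Rinv_l by lra. rewrite Rmult_1_l, Rmult_comm. left; exact Hw2.
Qed.

Lemma egamma_cdiff (z : C) : 0 < Re z -> cdiff egamma z.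
Proof. intros H. eexists. apply egamma_cder, H. Qed.

Lemma Re_rot (x w : R) (z : C) :
  Re (z * (- Ci * (x, w)) - Cexp (- Ci * (x, w))) = Re z * w + Im z * x - cos x * exp w.
Proof.
  destruct z as [a b]. unfold Cexp; simpl.
  replace (- (0) * x - - (1) * w) with w by ring.
  replace (- (0) * w + - (1) * x) with (- x) by ring. rewrite cos_neg. ring.
Qed.

(* Rotating the path of Euler's integral by the angle [t]. *)
Lemma egamma_rotate (a b t : R) : 0 < a -> a <= b -> - (PI / 2) < t < PI / 2 -> t <> 0 ->
  exists M, 0 < M /\ forall z, a <= Re z <= b -> Cmod (egamma z) <= M * exp (Im z * t).
Proof.
  intros Ha Hab Ht Hn.
  assert (Hc : 0 < cos t) by (apply cos_gt_0; lra).
  destruct (gker_bound a b (cos t) Ha Hab Hc) as [M [HM HB]].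
  exists (2 * M / a). split; [apply Rdiv_lt_0_compat; lra|].
  intros z Hz.
  (* For [s = x + i w] one has [- Ci * s = w - i x]. Multiplying by [- Ci] makes the rotated paths
     vertical lines, with the angle as abscissa and the logarithm of the radius as height. *)
  set (F := fun s : C => Cexp (z * (- Ci * s) - Cexp (- Ci * s))).
  assert (HF : forall x w, Cmod (F (x, w)) = exp (Re z * w + Im z * x - cos x * exp w)).
  { intros x w. unfold F. rewrite Cmod_Cexp, Re_rot. reflexivity. }
  assert (HFd : forall s, cdiff F s).
  { intros s. assert (Hl : cdiff (fun s => (- Ci * s)%C) s)
      by (apply cdiff_mult; [apply cdiff_const|apply cdiff_id]).
    apply cdiff_exp, cdiff_minus; [apply cdiff_mult; [apply cdiff_const|exact Hl]|apply cdiff_exp, Hl]. }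
  (* The damping [cos x * exp w] is weakest at the final angle, so one bound serves the whole
     strip. *)
  assert (Hcos : forall x, Rmin 0 t <= x <= Rmax 0 t -> cos t <= cos x).
  { intros x Hx. unfold Rmin, Rmax in Hx. assert (HP := PI_RGT_0).
    destruct (Rle_dec 0 t).
    - apply cos_decr_1; lra.
    - rewrite <- (cos_neg t), <- (cos_neg x). apply cos_decr_1; lra. }
  assert (Htail : strip_tail F (Rmin 0 t) (Rmax 0 t) (M * exp (Rabs (Im z) * Rabs t)) a).
  { intros [x w] Hx _. simpl in Hx. simpl Im. rewrite HF.
    rewrite (Rmult_comm M), Rmult_assoc.
    replace (Re z * w + Im z * x - cos x * exp w) with
      (Im z * x + (cos t - cos x) * exp w + (Re z * w - cos t * exp w)) by ring.
    rewrite exp_plus. apply Rmult_le_compat; try (left; apply exp_pos).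
    - apply exp_le. assert (H1 := Hcos x Hx). assert (H2 := exp_pos w).
      assert (H3 : Rabs (Im z * x) <= Rabs (Im z) * Rabs t).
      { rewrite Rabs_mult. apply Rmult_le_compat_l; [apply Rabs_pos|].
        unfold Rmin, Rmax in Hx. destruct (Rle_dec 0 t).
        - rewrite !Rabs_pos_eq; lra.
        - rewrite !Rabs_left1; lra. }
      generalize (Rle_abs (Im z * x)). nra.
    - apply HB, Hz. }
  assert (Hmm : Rmin 0 t < Rmax 0 t) by (unfold Rmin, Rmax; destruct (Rle_dec 0 t); lra).
  destruct (strip_shift F _ _ _ _ Hmm Ha (fun s _ => HFd s) Htail) as [D0 [D1 EL]].
  assert (EE : egamma z = line (fun y => F (0, y))).
  { apply line_ext. intros u. unfold gker, F. rewrite <- Cexp_R.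
    replace (- Ci * (0, u))%C with (RtoC u); [reflexivity|].
    apply injective_projections; simpl; ring. }
  assert (ET : egamma z = line (fun y => F (t, y))).
  { rewrite EE. unfold Rmin, Rmax in EL. destruct (Rle_dec 0 t); [|symmetry]; exact EL. }
  rewrite ET.
  replace (2 * M / a * exp (Im z * t)) with (2 * (M * exp (Im z * t)) / a) by (field; lra).
  apply line_bound. split; [intros y; apply Ccont_ver, cdiff_continuous, HFd|split; [exact Ha|]].
  intros u. rewrite HF.
  replace (Re z * u + Im z * t - cos t * exp u) with (Im z * t + (Re z * u - cos t * exp u)) by ring.
  rewrite exp_plus, (Rmult_comm M), Rmult_assoc.
  apply Rmult_le_compat_l; [left; apply exp_pos|apply HB, Hz].
Qed.

(** The path is rotated by [- t] or by [t] according to the sign of [Im z]. *)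
Lemma egamma_decay (a b t : R) : 0 < a -> a <= b -> 0 < t < PI / 2 ->
  exists M, 0 < M /\ forall z, a <= Re z <= b -> Cmod (egamma z) <= M * exp (- t * Rabs (Im z)).
Proof.
  intros Ha Hab Ht.
  destruct (egamma_rotate a b t Ha Hab ltac:(lra) ltac:(lra)) as [M1 [HM1 H1]].
  destruct (egamma_rotate a b (- t) Ha Hab ltac:(lra) ltac:(lra)) as [M2 [HM2 H2]].
  exists (M1 + M2). split; [lra|]. intros z Hz.
  assert (P := exp_pos (- t * Rabs (Im z))).
  destruct (Rle_dec 0 (Im z)) as [Hi|Hi].
  - apply Rle_trans with (M2 * exp (- t * Rabs (Im z))); [|nra].
    rewrite Rabs_pos_eq by exact Hi. rewrite (Rmult_comm (- t)). apply H2, Hz.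
  - apply Rnot_le_lt in Hi.
    apply Rle_trans with (M1 * exp (- t * Rabs (Im z))); [|nra].
    rewrite Rabs_left by exact Hi. replace (- t * - Im z) with (Im z * t) by ring. apply H1, Hz.
Qed.

(** * Products of line integrals as convolutions *)

Lemma edom_weaken (f : R -> C) (M e N d : R) : edom f M e -> M <= N -> 0 < d <= e -> edom f N d.
Proof.
  intros H HMN Hd. assert (HM := edom_pos _ _ _ H). destruct H as [Hc [He Hb]].
  split; [exact Hc|split; [lra|]]. intros u. eapply Rle_trans; [apply Hb|].
  apply Rmult_le_compat; [exact HM|left; apply exp_pos|exact HMN|].
  apply exp_le. generalize (Rabs_pos u); nra.
Qed.

Lemma ccont2_fst (f : R -> C) : ccont f -> ccont2 (fun x _ => f x).
Proof.
  intros H p. apply (continuous_comp (U := prod_UniformSpace R_UniformSpace R_UniformSpace)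
    (V := R_UniformSpace) (W := C_UniformSpace) fst f); [apply continuous_fst|apply H].
Qed.

Lemma ccont2_snd (f : R -> C) : ccont f -> ccont2 (fun _ y => f y).
Proof.
  intros H p. apply (continuous_comp (U := prod_UniformSpace R_UniformSpace R_UniformSpace)
    (V := R_UniformSpace) (W := C_UniformSpace) snd f); [apply continuous_snd|apply H].
Qed.

Lemma ccont2_add (f : R -> C) : ccont f -> ccont2 (fun x y => f (x + y)).
Proof.
  intros H p. apply (continuous_comp (U := prod_UniformSpace R_UniformSpace R_UniformSpace)
    (V := R_UniformSpace) (W := C_UniformSpace) (fun p => fst p + snd p) f); [|apply H].
  apply (continuous_Rplus fst snd); [apply continuous_fst|apply continuous_snd].
Qed.

Lemma ccont2_mult (F G : R -> R -> C) : ccont2 F -> ccont2 G -> ccont2 (fun x y => (F x y * G x y)%C).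
Proof. intros HF HG p. apply continuous_Cmult; [apply HF|apply HG]. Qed.

(** From [|y| <= |u| + |u + y|]: half of the common rate is given to [u] and half to [y]. *)
Lemma conv_edom2 (f g : R -> C) : dexp f -> dexp g ->
  exists M e, edom2 (fun u y => (f u * g (u + y)%R)%C) M e.
Proof.
  intros [M1 [e1 Hf]] [M2 [e2 Hg]].
  assert (HM1 := edom_pos _ _ _ Hf). assert (HM2 := edom_pos _ _ _ Hg).
  assert (He1 : 0 < e1) by apply Hf. assert (He2 : 0 < e2) by apply Hg.
  set (e := Rmin e1 e2). assert (He : 0 < e) by (apply Rmin_pos; assumption).
  assert (Hf' := edom_weaken f M1 e1 M1 e Hf (Rle_refl _) (conj He (Rmin_l _ _))).
  assert (Hg' := edom_weaken g M2 e2 M2 e Hg (Rle_refl _) (conj He (Rmin_r _ _))).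
  exists (M1 * M2), (e / 2). split; [|split; [lra|]].
  - apply ccont2_mult; [apply ccont2_fst, Hf|apply ccont2_add, Hg].
  - intros u y. rewrite Cmod_mult.
    apply Rle_trans with ((M1 * exp (- e * Rabs u)) * (M2 * exp (- e * Rabs (u + y)))).
    + apply Rmult_le_compat; try apply Cmod_ge_0; [apply Hf'|apply Hg'].
    + replace (M1 * exp (- e * Rabs u) * (M2 * exp (- e * Rabs (u + y)))) with
        (M1 * M2 * (exp (- e * Rabs u) * exp (- e * Rabs (u + y)))) by ring.
      rewrite (Rmult_assoc (M1 * M2)). apply Rmult_le_compat_l; [apply Rmult_le_pos; assumption|].
      rewrite <- !exp_plus. apply exp_le.
      assert (H := Rabs_triang (u + y) (- u)). rewrite Rabs_Ropp in H.
      replace (u + y + - u) with y in H by ring.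
      generalize (Rabs_pos u) (Rabs_pos (u + y)). nra.
Qed.

(** In multiplicative variables [s] and [t] this is the substitution [t = s * exp y] in a double
    integral. The reflection formula, the duplication formula and Weber's integral all start from
    it. *)
Lemma line_conv (f g : R -> C) : dexp f -> dexp g ->
  (line f * line g)%C = line (fun y => line (fun u => (f u * g (u + y)%R)%C)).
Proof.
  intros Hf Hg. destruct (conv_edom2 f g Hf Hg) as [M [e H]].
  rewrite <- (line_fubini _ M e H).
  rewrite Cmult_comm, <- line_scal by exact Hf.
  apply line_ext. intros u. rewrite line_scal.
  - rewrite (line_ext (fun y => g (u + y)) (fun y => g (y + u))) by (intros; f_equal; ring).
    rewrite line_shift by exact Hg. ring.
  - apply dexp_ext with (fun y => g (1 * y + u)); [intros; f_equal; ring|].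
    apply dexp_lin; [lra|exact Hg].
Qed.

Lemma conv_inner_dexp (f g : R -> C) (y : R) : dexp f -> dexp g ->
  dexp (fun u => (f u * g (u + y)%R)%C).
Proof.
  intros Hf Hg. destruct (conv_edom2 f g Hf Hg) as [M [e H]].
  eexists; eexists. apply (edom2_inner _ M e y (edom2_swap _ M e H)).
Qed.

(** * Agreement with the Gamma function of the statement *)

Lemma euler_integral_egamma (z : C) : 0 < Re z -> euler_integral z = egamma z.
Proof.
  intros Hz. assert (D := gker_dexp z Hz).
  enough (H : is_RInt_gen (V := C_R_NormedModule)
    (fun t : R => (Rcpow t (z - 1) * RtoC (exp (- t)))%C) (at_right 0)
    (Rbar_locally p_infty) (egamma z))
    by (unfold euler_integral; exact (is_RInt_gen_unique (V := C_R_CompleteNormedModule)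
    (Fa := at_right 0) (Fb := Rbar_locally p_infty) _ _ H)).
  apply (proj2 (filterlimi_locally (U := C_UniformSpace) _ _)). intros eps.
  destruct (line_lim _ D (eps) (cond_pos eps)) as [T [HT H]].
  exists (fun a => 0 < a < exp (- T)) (fun b => exp T < b).
  - exists (mkposreal _ (exp_pos (- T))). intros y Hy Hy0.
    change (Rabs (y - 0) < exp (- T)) in Hy. apply Rabs_def2 in Hy. lra.
  - exists (exp T). intros; assumption.
  - intros a b [Ha1 Ha2] Hb. cbn [fst snd].
    assert (Hb0 : 0 < b) by (generalize (exp_pos T); lra).
    assert (Hla : ln a <= - T).
    { rewrite <- (ln_exp (- T)). left. apply ln_increasing; assumption. }
    assert (Hlb : T <= ln b).
    { rewrite <- (ln_exp T). left. apply ln_increasing; [apply exp_pos|exact Hb]. }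
    exists (Cint (gker z) (ln a) (ln b)). split.
    2: { apply Cmod_ball. rewrite Cmod_minus_sym. apply H; lra. }
    set (f := fun t : R => (Rcpow t (z - 1) * RtoC (exp (- t)))%C).
    assert (Hfc : forall t, 0 < t -> continuous (T := R_UniformSpace) (U := C_UniformSpace) f t).
    { intros t Ht. apply continuous_Cmult.
      - apply continuous_Cexp, continuous_Cmult; [apply continuous_const|].
        apply continuous_RtoC. apply (continuous_Rcomp ln (fun t => t)); [apply continuous_id|].
        apply continuous_ln; exact Ht.
      - apply continuous_RtoC. apply (continuous_Rcomp exp (fun t => - t));
          [apply continuous_Ropp, continuous_id|apply continuous_exp]. }
    assert (Hs := is_RInt_comp (V := C_R_CompleteNormedModule) f exp exp (ln a) (ln b)
      (fun x _ => Hfc (exp x) (exp_pos x))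
      (fun x _ => conj (is_derive_exp x) (continuous_exp x))).
    rewrite !exp_ln in Hs by assumption.
    assert (Ei : Cint (gker z) (ln a) (ln b) = RInt (V := C_R_CompleteNormedModule) f a b).
    { apply is_Cint_unique. revert Hs. apply is_Cint_ext. intros u _.
      rewrite scal_C. unfold f, Rcpow, gker. rewrite ln_exp, <- !Cexp_R, <- !Cexp_plus.
      f_equal. rewrite RtoC_opp, Cexp_R. ring. }
    rewrite Ei. apply is_Cint_cont. intros u Hu. apply Hfc.
    destruct Hu as [Hu _]. eapply Rlt_le_trans; [|exact Hu]. apply Rmin_glb_lt; assumption.
Qed.

Lemma Gamma_egamma (z : C) : 0 < Re z -> Gamma z = egamma z.
Proof.
  intros Hz. unfold Gamma.
  (* [up (- Re z) <= - Re z + 1 < 1], and [Z.to_nat] sends non-positive integers to 0. *)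
  assert (Hn : Z.to_nat (up (- Re z)) = 0%nat).
  { destruct (archimed (- Re z)) as [H1 H2].
    assert (H3 : IZR (up (- Re z)) < 1) by lra. apply lt_IZR in H3. lia. }
  rewrite Hn. simpl INR. simpl rising.
  replace (z + 0)%C with z by ring. rewrite euler_integral_egamma by exact Hz.
  field.
Qed.

(** * The reflection formula *)

Lemma residue_limit (F g : C -> C) (p r : C) : Ccont g p -> g p = r ->
  (forall s, s <> p -> ((s - p) * F s)%C = g s) ->
  forall eps, 0 < eps -> exists del, 0 < del /\ forall s, s <> p -> Cmod (s - p) < del ->
    Cmod ((s - p) * F s - r) <= eps.
Proof.
  intros Hg Hp HF eps He. destruct (proj1 (continuous_C_eps g p) Hg eps He) as [d [Hd H]].
  exists d. split; [exact Hd|]. intros s Hs Hsd. rewrite HF, <- Hp by exact Hs.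
  left. apply H, Hsd.
Qed.

(** Locates the only pole met by [line_exp_frac]: the modulus forces [x = 0], and the cosine is
    strictly monotone on each side of [PI]. *)
Lemma Cexp_eq_opp1 (x y : R) : (1 + Cexp (x, y))%C = 0%C -> 0 <= y <= 2 * PI -> x = 0 /\ y = PI.
Proof.
  intros H Hy. assert (HP := PI_RGT_0).
  assert (Hm : Cmod (Cexp (x, y)) = 1).
  { replace (Cexp (x, y)) with (- (1))%C.
    - rewrite Cmod_opp, Cmod_1. reflexivity.
    - replace (Cexp (x, y)) with (1 + Cexp (x, y) - 1)%C by ring. rewrite H. ring. }
  rewrite Cmod_Cexp in Hm. simpl in Hm.
  assert (Hx : x = 0) by (rewrite <- exp_0 in Hm; apply exp_inv, Hm).
  split; [exact Hx|]. subst x.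
  assert (Hc : cos y = -1).
  { assert (E1 := f_equal Re H). unfold Cexp in E1; simpl in E1. rewrite exp_0 in E1. lra. }
  destruct (Rtotal_order y PI) as [Hl|[He|Hg]]; [|exact He|].
  - assert (C1 := cos_decreasing_1 y PI). rewrite cos_PI in C1. lra.
  - assert (C1 := cos_increasing_1 PI y). rewrite cos_PI in C1. lra.
Qed.

Lemma Cmod_1_plus_exp_ge (z : C) : Rabs (1 - exp (Re z)) <= Cmod (1 + Cexp z).
Proof.
  rewrite <- Cmod_Cexp. apply Rabs_le. split.
  - assert (H := Cmod_diff_ge (Cexp z) (- (1))%C).
    rewrite Cmod_opp, Cmod_1 in H. replace (Cexp z - - (1))%C with (1 + Cexp z)%C in H by ring. lra.
  - assert (H := Cmod_diff_ge 1%C (- Cexp z)%C).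
    rewrite Cmod_opp, Cmod_1 in H. replace (1 - - Cexp z)%C with (1 + Cexp z)%C in H by ring. lra.
Qed.

Lemma Cinv_zero : (/ 0)%C = 0%C.
Proof. apply injective_projections; simpl; unfold Rdiv; ring. Qed.

Lemma exp_1_ge_2 : 2 <= exp 1.
Proof. generalize (exp_ineq1_le 1); lra. Qed.

(* The integrand is multiplied by [Cexp (2 * PI * Ci * w)] when the line is moved
   up by [2 * PI], past the pole at [PI * Ci]. *)
Lemma line_exp_frac (w : C) : 0 < Re w < 1 ->
  dexp (fun y => (Cexp (w * RtoC y) / (1 + Cexp (RtoC y)))%C) /\
  (line (fun y => (Cexp (w * RtoC y) / (1 + Cexp (RtoC y)))%C) *
    (Cexp (w * (Ci * RtoC PI)) - Cexp (- (w * (Ci * RtoC PI)))))%C = (2 * RtoC PI * Ci)%C.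
Proof.
  intros Hw. assert (HP := PI_RGT_0).
  (* Multiplication by [- Ci] turns the horizontal lines at heights 0 and [2 * PI] into the vertical
     lines [Re s = 0] and [Re s = - (2 * PI)]. *)
  set (zz := fun s : C => (- Ci * s)%C).
  set (F := fun s : C => (Cexp (w * zz s) / (1 + Cexp (zz s)))%C).
  assert (Hzd : forall s, cdiff zz s) by (intros s; apply cdiff_mult; [apply cdiff_const|apply cdiff_id]).
  assert (Hz2 : forall x y, zz (x, y) = (y, - x)).
  { intros x y. apply injective_projections; simpl; ring. }
  (* The integrand decays at rate [Re w] on the left and [1 - Re w] on the right. *)
  set (e := Rmin (Re w) (1 - Re w)). assert (He : 0 < e) by (apply Rmin_pos; lra).
  assert (Hel : e <= Re w /\ e <= 1 - Re w) by (split; [apply Rmin_l|apply Rmin_r]).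
  assert (Hpole : forall z, - (2 * PI) <= Re z <= 0 -> (1 + Cexp (zz z))%C = 0%C -> z = RtoC (- PI)).
  { intros [x y] Hx H. simpl in Hx. rewrite Hz2 in H. apply Cexp_eq_opp1 in H; [|lra].
    apply injective_projections; simpl; lra. }
  assert (Hd : forall z, - (2 * PI) <= Re z <= 0 -> z <> RtoC (- PI) -> cdiff F z).
  { intros z Hz Hn. apply cdiff_mult.
    - apply cdiff_exp, cdiff_mult; [apply cdiff_const|apply Hzd].
    - apply cdiff_inv; [apply cdiff_plus; [apply cdiff_const|apply cdiff_exp, Hzd]|].
      intros H0. apply Hn, Hpole; assumption. }
  assert (Ht : strip_tail F (- (2 * PI)) 0 (2 * exp (Rabs (Im w) * (2 * PI))) e).
  { intros [x y] Hx Hy. simpl in Hx, Hy. simpl Im. unfold F. rewrite Hz2.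
    assert (Hden : 0 < Rabs (1 - exp y) /\ exp (Re w * y) / Rabs (1 - exp y) <= 2 * exp (- e * Rabs y)).
    { assert (H2 := exp_1_ge_2). assert (P := exp_pos y).
      destruct (Rle_dec 0 y) as [Hp|Hp].
      - rewrite Rabs_pos_eq in Hy by exact Hp.
        assert (H3 : 2 <= exp y) by (eapply Rle_trans; [exact H2|apply exp_le, Hy]).
        rewrite Rabs_left by lra. rewrite Rabs_pos_eq by exact Hp. split; [lra|].
        apply Rle_trans with (exp (Re w * y) / (exp y / 2)).
        + apply Rmult_le_compat_l; [left; apply exp_pos|]. apply Rinv_le_contravar; lra.
        + replace (exp (Re w * y) / (exp y / 2)) with (2 * (exp (Re w * y) * / exp y)) by (field; lra).
          rewrite <- exp_Ropp, <- exp_plus. apply Rmult_le_compat_l; [lra|]. apply exp_le. nra.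
      - apply Rnot_le_lt in Hp. rewrite Rabs_left in Hy by exact Hp.
        assert (H3 : exp y <= / 2).
        { replace y with (- - y) by ring. rewrite exp_Ropp. apply Rinv_le_contravar; [lra|].
          eapply Rle_trans; [exact H2|apply exp_le, Hy]. }
        rewrite Rabs_pos_eq by lra. rewrite Rabs_left by exact Hp. split; [lra|].
        apply Rle_trans with (exp (Re w * y) / (/ 2)).
        + apply Rmult_le_compat_l; [left; apply exp_pos|]. apply Rinv_le_contravar; lra.
        + replace (exp (Re w * y) / (/ 2)) with (2 * exp (Re w * y)) by field.
          apply Rmult_le_compat_l; [lra|]. apply exp_le. nra. }
    destruct Hden as [Hden1 Hden2].
    assert (Hg := Cmod_1_plus_exp_ge (y, - x)). simpl Re in Hg.
    assert (Hn : (1 + Cexp (y, (- x)%R))%C <> 0%C).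
    { intros H0. rewrite H0, Cmod_0 in Hg. lra. }
    rewrite Cmod_div by exact Hn. rewrite Cmod_Cexp.
    replace (Re (w * (y, (- x)%R))) with (Im w * x + Re w * y) by (destruct w; simpl; ring).
    rewrite exp_plus. unfold Rdiv at 1.
    replace (2 * exp (Rabs (Im w) * (2 * PI)) * exp (- e * Rabs y)) with
      (exp (Rabs (Im w) * (2 * PI)) * (2 * exp (- e * Rabs y))) by ring.
    rewrite Rmult_assoc. apply Rmult_le_compat.
    - left; apply exp_pos.
    - apply Rmult_le_pos; [left; apply exp_pos|left; apply Rinv_0_lt_compat; lra].
    - apply exp_le. assert (A := Rabs_pos (Im w)).
      assert (B : Rabs (Im w * x) <= Rabs (Im w) * (2 * PI)).
      { rewrite Rabs_mult. apply Rmult_le_compat_l; [exact A|]. apply Rabs_le. lra. }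
      generalize (Rle_abs (Im w * x)). lra.
    - eapply Rle_trans; [|exact Hden2]. apply Rmult_le_compat_l; [left; apply exp_pos|].
      apply Rinv_le_contravar; lra. }
  set (W := Cexp (w * (Ci * RtoC PI))) in *.
  assert (HW : W <> 0%C) by apply Cexp_neq_0.
  assert (Hr : forall eps, 0 < eps -> exists del, 0 < del /\ forall s, s <> RtoC (- PI) ->
     Cmod (s - RtoC (- PI)) < del -> Cmod ((s - RtoC (- PI)) * F s - (- (Ci * W))) <= eps).
  (* The slope function [ph] of the exponential at 0 factors the denominator near the pole as
     [- ph (et s) * et s], with [ph] continuous and equal to 1 at 0. *)
  { destruct (cder_Cexp 0%C) as [ph [Hph [Hph1 Hph2]]]. rewrite Cexp_0 in Hph1.
    set (et := fun s : C => (- Ci * (s + RtoC PI))%C).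
    assert (Het : Ccont et (RtoC (- PI))).
    { apply continuous_Cmult; [apply continuous_const|].
      apply continuous_Cplus; [apply continuous_id|apply continuous_const]. }
    assert (Het0 : et (RtoC (- PI)) = 0%C) by (unfold et; rewrite RtoC_opp; ring).
    apply (residue_limit F (fun s => (- (Ci * W * Cexp (w * et s) / ph (et s)))%C)).
    - apply continuous_Copp, continuous_Cmult.
      + apply continuous_Cmult; [apply continuous_const|].
        apply continuous_Cexp, continuous_Cmult; [apply continuous_const|exact Het].
      + apply continuous_Cinv.
        * apply (continuous_comp (U := C_UniformSpace) (V := C_UniformSpace) (W := C_UniformSpace) et ph);
            [exact Het|]. rewrite Het0. exact Hph.
        * rewrite Het0, Hph1. intros E0. inversion E0. lra.
    - rewrite Het0, Hph1. replace (w * 0)%C with (RtoC 0) by ring. rewrite Cexp_0. field.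
    - intros s Hs.
      assert (Hes : et s <> 0%C).
      { intros E0. apply Hs. replace s with (Ci * et s - RtoC PI)%C.
        - rewrite E0, RtoC_opp. ring.
        - unfold et. replace (Ci * (- Ci * (s + RtoC PI)))%C with (- (Ci * Ci) * (s + RtoC PI))%C by ring.
          replace (Ci * Ci)%C with (- (1))%C by (apply injective_projections; simpl; ring). ring. }
      assert (Ez : zz s = (Ci * RtoC PI + et s)%C) by (unfold zz, et; ring).
      assert (E1 : Cexp (Ci * RtoC PI) = (- (1))%C).
      { unfold Cexp. apply injective_projections; simpl.
        - replace (0 * PI - 1 * 0) with 0 by ring. replace (0 * 0 + 1 * PI) with PI by ring.
          rewrite exp_0, cos_PI. ring.
        - replace (0 * 0 + 1 * PI) with PI by ring. rewrite sin_PI. ring. }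
      assert (E2 : Cexp (w * zz s) = (W * Cexp (w * et s))%C).
      { rewrite Ez. unfold W. rewrite <- Cexp_plus. f_equal. ring. }
      assert (E3 : (1 + Cexp (zz s))%C = (- (ph (et s) * et s))%C).
      { rewrite Ez, Cexp_plus, E1. rewrite (Hph2 (et s)), Cexp_0. ring. }
      assert (E4 : (s - RtoC (- PI))%C = (Ci * et s)%C).
      { unfold et. rewrite RtoC_opp.
        replace (Ci * (- Ci * (s + RtoC PI)))%C with (- (Ci * Ci) * (s + RtoC PI))%C by ring.
        replace (Ci * Ci)%C with (- (1))%C by (apply injective_projections; simpl; ring). ring. }
      unfold F. rewrite E2, E3, E4.
      (* Where [ph] vanishes away from the pole, both sides divide by 0 and hence equal 0. *)
      destruct (Ceq_dec (ph (et s)) 0) as [E0|Hp].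
      + rewrite E0. replace (- (0 * et s))%C with (RtoC 0) by ring.
        unfold Cdiv. rewrite Cinv_zero. ring.
      + field. split; assumption. }
  destruct (strip_residue F (- (2 * PI)) 0 _ e (- PI) (- (Ci * W))%C ltac:(lra) He Hd Ht Hr)
    as [_ [D0 EL]].
  assert (E0 : forall y, F (0, y) = (Cexp (w * RtoC y) / (1 + Cexp (RtoC y)))%C).
  { intros y. unfold F. rewrite Hz2.
    replace (y, (- 0)%R) with (RtoC y) by (apply injective_projections; simpl; ring). reflexivity. }
  assert (D : dexp (fun y => (Cexp (w * RtoC y) / (1 + Cexp (RtoC y)))%C))
    by (apply dexp_ext with (2 := D0); exact E0).
  split; [exact D|].
  assert (E1 : forall y, F ((- (2 * PI))%R, y) =
    (W * W * (Cexp (w * RtoC y) / (1 + Cexp (RtoC y))))%C).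
  { intros y. unfold F. rewrite Hz2.
    replace (y, (- - (2 * PI))%R) with (RtoC y + (Ci * RtoC PI + Ci * RtoC PI))%C
      by (apply injective_projections; simpl; ring).
    rewrite (Cexp_plus (RtoC y)).
    replace (Cexp (Ci * RtoC PI + Ci * RtoC PI)) with (RtoC 1).
    - unfold W. rewrite <- Cexp_plus.
      replace (w * (RtoC y + (Ci * RtoC PI + Ci * RtoC PI)))%C with
        ((w * (Ci * RtoC PI) + w * (Ci * RtoC PI)) + w * RtoC y)%C by ring.
      rewrite (Cexp_plus (w * (Ci * RtoC PI) + w * (Ci * RtoC PI))).
      replace (Cexp (RtoC y) * 1)%C with (Cexp (RtoC y)) by ring. unfold Cdiv. ring.
    - unfold Cexp. apply injective_projections; simpl.
      + replace (0 * PI - 1 * 0 + (0 * PI - 1 * 0)) with 0 by ring.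
        replace (0 * 0 + 1 * PI + (0 * 0 + 1 * PI)) with (2 * PI) by ring.
        rewrite exp_0, cos_2PI. ring.
      + replace (0 * 0 + 1 * PI + (0 * 0 + 1 * PI)) with (2 * PI) by ring.
        rewrite sin_2PI. ring. }
  rewrite (line_ext _ _ E0), (line_ext _ _ E1), line_scal in EL by exact D.
  rewrite Cexp_opp. fold W.
  set (K := line (fun y => (Cexp (w * RtoC y) / (1 + Cexp (RtoC y)))%C)) in *.
  replace (K * (W - / W))%C with ((W * W * K - K) / W)%C by (field; exact HW).
  rewrite EL at 2. field. exact HW.
Qed.

(** The integral of [exp (- c * t)] over [t > 0] in the variable [u = ln t]. *)
Lemma line_exp_sub (c : R) : 0 < c ->
  line (fun u => Cexp (RtoC u - RtoC (c * exp u))) = RtoC (/ c).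
Proof.
  intros Hc. assert (D : dexp (gker 1)) by (apply gker_dexp; reim; lra).
  rewrite (line_ext _ (fun u => (RtoC (/ c) * gker 1 (u + ln c)%R)%C)).
  - rewrite line_scal, (line_shift (gker 1)) by (assumption || (apply dexp_ext with (fun u => gker 1 (1 * u + ln c));
      [intros; f_equal; ring|apply dexp_lin; [lra|exact D]])).
    change (line (gker 1)) with (egamma 1). rewrite egamma_1. ring.
  - intros u. unfold gker. rewrite exp_plus, exp_ln by exact Hc.
    replace (RtoC u - RtoC (c * exp u))%C with (- RtoC (ln c) + (1 * RtoC (u + ln c) - RtoC (exp u * c)))%C
      by (rewrite !RtoC_mult, RtoC_plus; ring).
    rewrite Cexp_plus. f_equal. rewrite <- RtoC_opp, Cexp_R, exp_Ropp, exp_ln by exact Hc. reflexivity.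
Qed.

(** In the convolution the [u]-integral is that of [exp (- (1 + exp y) * t)], which leaves
    [exp (z * y) / (1 + exp y)]. The difference of exponentials is [2 * i * sin (PI * z)]. *)
Lemma egamma_reflection (z : C) : 0 < Re z < 1 ->
  (egamma z * egamma (1 - z) * (Cexp (z * (Ci * RtoC PI)) - Cexp (- (z * (Ci * RtoC PI)))))%C = (2 * RtoC PI * Ci)%C.
Proof.
  intros Hz.
  assert (D1 : dexp (gker (1 - z))) by (apply gker_dexp; reim; lra).
  assert (D2 : dexp (gker z)) by (apply gker_dexp; lra).
  rewrite (Cmult_comm (egamma z)). unfold egamma at 1 2. rewrite (line_conv _ _ D1 D2).
  rewrite (line_ext _ (fun y => (Cexp (z * RtoC y) / (1 + Cexp (RtoC y)))%C)).
  - apply line_exp_frac. lra.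
  - intros y. rewrite (line_ext _ (fun u => (Cexp (z * RtoC y) * Cexp (RtoC u - RtoC ((1 + exp y) * exp u)))%C)).
    + assert (Hc : 0 < 1 + exp y) by (generalize (exp_pos y); lra).
      assert (D3 := conv_inner_dexp _ _ y D1 D2).
      rewrite line_scal.
      * rewrite line_exp_sub by exact Hc. unfold Cdiv. f_equal.
        rewrite Cexp_R, <- RtoC_plus, RtoC_inv by lra. reflexivity.
      * apply dexp_ext with (fun u => (Cexp (- (z * RtoC y)) * (gker (1 - z) u * gker z (u + y)%R))%C);
          [|apply dexp_scal; exact D3].
        intros u. unfold gker. rewrite <- !Cexp_plus. f_equal.
        rewrite exp_plus, RtoC_plus, !RtoC_mult, RtoC_plus. ring.
    + intros u. unfold gker. rewrite <- !Cexp_plus. f_equal.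
      rewrite exp_plus, RtoC_plus, !RtoC_mult, RtoC_plus. ring.
Qed.

(** * The Gaussian integral and the duplication formula *)

Definition gauss (p : R) : C := RtoC (exp (- (p * p))).
Definition gauss_prim (p : R) : C := Cint gauss 0 p.

Lemma gauss_cont : ccont gauss.
Proof.
  intros p. apply continuous_RtoC. apply (continuous_Rcomp exp (fun p => - (p * p)));
    [|apply continuous_exp].
  apply continuous_Ropp, (continuous_Rmult (fun p => p) (fun p => p)); apply continuous_id.
Qed.

Lemma gauss_dexp : dexp gauss.
Proof.
  exists (exp 1), 1. split; [apply gauss_cont|split; [lra|]]. intros p.
  unfold gauss. rewrite Cmod_R, Rabs_pos_eq by (left; apply exp_pos).
  rewrite <- exp_plus. apply exp_le. assert (H := Rabs_pos p).
  assert (E2 : p * p = Rabs p * Rabs p) by (rewrite <- Rabs_mult; symmetry; apply Rabs_pos_eq; nra).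
  rewrite E2. nra.
Qed.

Lemma gauss_prim_derive (p : R) : is_derive (V := C_R_NormedModule) gauss_prim p (gauss p).
Proof.
  apply (is_derive_RInt (V := C_R_NormedModule) gauss gauss_prim 0).
  - apply filter_forall. intros t. apply Cint_correct, gauss_cont.
  - apply gauss_cont.
Qed.

Lemma gauss_prim_opp (p : R) : gauss_prim (- p) = (- gauss_prim p)%C.
Proof.
  unfold gauss_prim.
  assert (H : Cint gauss (- p) (- 0) = Cint gauss 0 p).
  { rewrite <- Cint_opp_arg by apply gauss_cont. f_equal.
    apply functional_extensionality. intros t. unfold gauss. do 2 f_equal. ring. }
  rewrite Ropp_0 in H. rewrite <- H. apply is_Cint_unique, is_Cint_swap, Cint_correct, gauss_cont.
Qed.

Lemma gauss_prim_lim : forall eps, 0 < eps ->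
  exists T, forall t, T <= t -> Cmod (gauss_prim t - / 2 * line gauss) < eps.
Proof.
  intros eps He. destruct (line_lim gauss gauss_dexp eps He) as [T [HT H]].
  exists T. intros t Ht. specialize (H (- t) t ltac:(lra) Ht).
  rewrite <- (Cint_Chasles gauss (- t) 0 t gauss_cont) in H.
  assert (E1 : Cint gauss (- t)%R 0 = gauss_prim t).
  { assert (H1 := Cint_opp_arg gauss 0 t gauss_cont). rewrite Ropp_0 in H1. rewrite <- H1.
    unfold gauss_prim. f_equal.
    apply functional_extensionality. intros s. unfold gauss. do 2 f_equal. ring. }
  rewrite E1 in H. fold (gauss_prim t) in H.
  replace (gauss_prim t - / 2 * line gauss)%C with
    (- / 2 * (line gauss - (gauss_prim t + gauss_prim t)))%C by field.
  rewrite Cmod_mult, Cmod_opp.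
  replace (/ 2)%C with (RtoC (/ 2)) by (rewrite RtoC_inv by lra; reflexivity).
  rewrite Cmod_R, Rabs_pos_eq by lra.
  generalize (Cmod_ge_0 (line gauss - (gauss_prim t + gauss_prim t))). lra.
Qed.

(** The left side is [2 * K_{1/2} (2 * X)], an elementary Macdonald function. With
    [s t = 2 * sqrt X * sinh (t / 2)] one has [s ^ 2 = X * (exp t + exp (- t)) - 2 * X], and
    symmetrising in [t] turns [exp (t / 2)] into a multiple of [s'], so the integrand becomes that
    of a Gaussian. *)
Lemma line_cosh_gauss (X : R) : 0 < X ->
  dexp (fun t => RtoC (exp (t / 2 - X * exp (- t) - X * exp t))) ->
  line (fun t => RtoC (exp (t / 2 - X * exp (- t) - X * exp t))) =
    (RtoC (exp (- 2 * X) / sqrt X) * line gauss)%C.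
Proof.
  intros HX D. set (f := fun t => RtoC (exp (t / 2 - X * exp (- t) - X * exp t))) in *.
  assert (Hs : 0 < sqrt X) by (apply sqrt_lt_R0, HX).
  assert (Hss : sqrt X * sqrt X = X) by (apply sqrt_sqrt; lra).
  set (k := exp (- 2 * X) / sqrt X).
  set (s := fun t => sqrt X * (exp (t / 2) - exp (- t / 2))).
  assert (Hsd : forall t, is_derive s t (sqrt X * (exp (t / 2) + exp (- t / 2)) / 2)).
  { intros t. unfold s. auto_derive; [trivial|]. unfold Rdiv; field. }
  assert (Df := dexp_opp_arg f D).
  assert (D2 := dexp_plus _ _ D Df).
  assert (H : line (fun t => (f t + f (- t)%R)%C) = (RtoC (2 * k) * (/ 2 * line gauss) - RtoC (2 * k) * (- (/ 2 * line gauss)))%C).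
  { assert (Hlim : forall eps, 0 < eps -> exists T, forall t, T <= t ->
       Cmod (RtoC (2 * k) * gauss_prim (s t) - RtoC (2 * k) * (/ 2 * line gauss)) < eps).
    { intros eps He. assert (Hk : 0 < 2 * k) by (unfold k; assert (P := exp_pos (- 2 * X));
        assert (0 < exp (- 2 * X) / sqrt X) by (apply Rdiv_lt_0_compat; assumption); lra).
      destruct (gauss_prim_lim (eps / (2 * k))) as [T HT]; [apply Rdiv_lt_0_compat; assumption|].
      exists (Rmax 0 (2 * T / sqrt X)). intros t Ht.
      assert (Ht0 : 0 <= t) by (eapply Rle_trans; [apply Rmax_l|exact Ht]).
      assert (Ht1 : 2 * T / sqrt X <= t) by (eapply Rle_trans; [apply Rmax_r|exact Ht]).
      assert (Hst : T <= s t).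
      { unfold s. assert (H1 := exp_ineq1_le (t / 2)).
        assert (H2 : exp (- t / 2) <= 1) by (rewrite <- exp_0; apply exp_le; lra).
        apply Rle_trans with (sqrt X * (t / 2)); [|apply Rmult_le_compat_l; lra].
        apply Rmult_le_reg_r with (2 / sqrt X); [apply Rdiv_lt_0_compat; lra|].
        replace (sqrt X * (t / 2) * (2 / sqrt X)) with t by (field; lra).
        replace (T * (2 / sqrt X)) with (2 * T / sqrt X) by (field; lra). exact Ht1. }
      specialize (HT _ Hst).
      replace (RtoC (2 * k) * gauss_prim (s t) - RtoC (2 * k) * (/ 2 * line gauss))%C with
        (RtoC (2 * k) * (gauss_prim (s t) - / 2 * line gauss))%C by ring.
      rewrite Cmod_mult, Cmod_R, Rabs_pos_eq by lra.
      apply Rmult_lt_reg_r with (/ (2 * k)); [apply Rinv_0_lt_compat, Hk|].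
      replace (2 * k * Cmod (gauss_prim (s t) - / 2 * line gauss) * / (2 * k)) with
        (Cmod (gauss_prim (s t) - / 2 * line gauss)) by (field; lra). exact HT. }
    apply (line_ftc (fun t => (RtoC (2 * k) * gauss_prim (s t))%C)); [|exact D2| |exact Hlim].
    - intros t.
      replace (f t + f (- t)%R)%C with (RtoC (2 * k) *
        (scal (sqrt X * (exp (t / 2) + exp (- t / 2)) / 2)%R (gauss (s t) : C_R_NormedModule) : C_R_NormedModule))%C.
      + apply is_derive_Cscal.
        apply (is_derive_comp (V := C_R_NormedModule) gauss_prim s); [apply gauss_prim_derive|apply Hsd].
      + rewrite !scal_C. unfold f, gauss. rewrite <- !RtoC_mult, <- RtoC_plus. f_equal.
        unfold s, k.
        assert (E1 : exp (t / 2) * exp (t / 2) = exp t) by (rewrite <- exp_plus; f_equal; field).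
        assert (E2 : exp (- t / 2) * exp (- t / 2) = exp (- t)) by (rewrite <- exp_plus; f_equal; field).
        assert (E3 : exp (t / 2) * exp (- t / 2) = 1) by (rewrite <- exp_plus, <- exp_0; f_equal; field).
        replace (- (sqrt X * (exp (t / 2) - exp (- t / 2)) * (sqrt X * (exp (t / 2) - exp (- t / 2))))) with
          (2 * X * (exp (t / 2) * exp (- t / 2)) - X * (exp (- t / 2) * exp (- t / 2)) - X * (exp (t / 2) * exp (t / 2))).
        2: { rewrite <- Hss at 1 2 3. ring. }
        rewrite E1, E2, E3.
        replace (t / 2 - X * exp (- t) - X * exp t) with (t / 2 + (- X * exp (- t) - X * exp t)) by ring.
        replace (- t / 2 - X * exp (- - t) - X * exp (- t)) with (- t / 2 + (- X * exp (- t) - X * exp t))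
          by (rewrite Ropp_involutive; ring).
        replace (2 * X * 1 - X * exp (- t) - X * exp t) with (2 * X + (- X * exp (- t) - X * exp t)) by ring.
        rewrite !(exp_plus _ (- X * exp (- t) - X * exp t)).
        assert (E4 : exp (- 2 * X) * exp (2 * X) = 1) by (rewrite <- exp_plus, <- exp_0; f_equal; ring).
        replace (2 * (exp (- 2 * X) / sqrt X) *
          (sqrt X * (exp (t / 2) + exp (- t / 2)) / 2 * (exp (2 * X) * exp (- X * exp (- t) - X * exp t))))
          with ((exp (- 2 * X) * exp (2 * X)) * ((exp (t / 2) + exp (- t / 2)) * exp (- X * exp (- t) - X * exp t)))
          by (field; lra).
        rewrite E4. ring.
    - intros eps He. destruct (Hlim eps He) as [T HT]. exists T. intros t Ht. specialize (HT t Ht).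
      assert (Es : s (- t) = - s t).
      { unfold s. rewrite Ropp_involutive. replace (- t / 2) with (- (t / 2)) by field. ring. }
      rewrite Es, gauss_prim_opp.
      replace (RtoC (2 * k) * - gauss_prim (s t) - RtoC (2 * k) * - (/ 2 * line gauss))%C with
        (- (RtoC (2 * k) * gauss_prim (s t) - RtoC (2 * k) * (/ 2 * line gauss)))%C by ring.
      rewrite Cmod_opp. exact HT. }
  rewrite line_plus, (line_opp_arg f) in H by assumption.
  replace (line f) with (/ 2 * (line f + line f))%C by field.
  rewrite H, RtoC_mult. field.
Qed.

(** Reversing the first factor makes [y] the logarithm of the product of the two Euler variables;
    the inner integral is then a [K_{1/2}]. The constant [line gauss] is evaluated only afterwards,
    from this formula. *)
Lemma egamma_duplication_gauss (w : C) : 0 < Re w ->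
  (egamma w * egamma (w + RtoC (/ 2)))%C = (2 * Cexp (- (2 * w * RtoC (ln 2))) * line gauss * egamma (2 * w))%C.
Proof.
  intros Hw.
  assert (D1 : dexp (gker w)) by (apply gker_dexp, Hw).
  assert (D1' := dexp_opp_arg _ D1).
  assert (D2 : dexp (gker (w + RtoC (/ 2)))) by (apply gker_dexp; reim; lra).
  assert (D3 : dexp (gker (2 * w))) by (apply gker_dexp; reim; lra).
  unfold egamma at 1 2. rewrite <- (line_opp_arg _ D1), (line_conv _ _ D1' D2).
  rewrite (line_ext _ (fun y => (line gauss * Cexp (- (2 * w * RtoC (ln 2))) * gker (2 * w)%C (/ 2 * y + ln 2)%R)%C)).
  - rewrite line_scal by (apply dexp_lin; [lra|exact D3]).
    rewrite line_lin by (lra || exact D3). unfold egamma.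
    replace (/ / 2) with 2 by field. ring.
  (* Centring [u] at [- y / 2] gives both exponentials the same coefficient [X]. *)
  - intros y. set (X := exp (y / 2)). assert (HX : 0 < X) by apply exp_pos.
    set (g := fun t => RtoC (exp (t / 2 - X * exp (- t) - X * exp t))).
    assert (D4 := conv_inner_dexp _ _ y D1' D2).
    set (k := Cexp ((w + RtoC (/ 2)) * RtoC y - RtoC (y / 4))).
    assert (Eg : forall u, (gker w (- u)%R * gker (w + RtoC (/ 2)) (u + y)%R)%C =
      (k * g (u + y / 2)%R)%C).
    { intros u. unfold gker, g, k.
      replace (X * exp (- (u + y / 2))) with (exp (- u)).
      2: { unfold X. rewrite <- exp_plus. f_equal. field. }
      replace (X * exp (u + y / 2)) with (exp (u + y)).
      2: { unfold X. rewrite <- exp_plus. f_equal. field. }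
      generalize (exp (- u)) (exp (u + y)). intros r1 r2.
      rewrite <- Cexp_R, <- !Cexp_plus. f_equal. destruct w as [a b].
      apply injective_projections; simpl; field. }
    assert (Hk : k <> 0%C) by apply Cexp_neq_0.
    assert (D5 : dexp (fun u => g (u + y / 2))).
    { apply dexp_ext with (fun u => (/ k * (gker w (- u)%R * gker (w + RtoC (/ 2)) (u + y)%R))%C).
      - intros u. rewrite Eg. field. exact Hk.
      - apply dexp_scal, D4. }
    assert (D6 : dexp g).
    { apply dexp_ext with (fun u => (fun v => g (v + y / 2)) (1 * u + - (y / 2))).
      - intros u. cbv beta. f_equal. ring.
      - apply (dexp_lin (fun v => g (v + y / 2))); [lra|exact D5]. }
    rewrite (line_ext _ _ Eg), line_scal, (line_shift g) by assumption.
    unfold g. rewrite line_cosh_gauss by assumption.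
    assert (Hsq : sqrt X = exp (y / 4)).
    { replace X with (exp (y / 4) * exp (y / 4)) by (unfold X; rewrite <- exp_plus; f_equal; field).
      apply sqrt_square. left; apply exp_pos. }
    rewrite Hsq.
    replace (exp (- 2 * X) / exp (y / 4)) with (exp (- 2 * X + - (y / 4))).
    2: { rewrite exp_plus, exp_Ropp. reflexivity. }
    rewrite <- Cexp_R. unfold k, gker.
    replace (Cexp ((w + RtoC (/ 2)) * RtoC y - RtoC (y / 4)) * (Cexp (RtoC (- 2 * X + - (y / 4))) * line gauss))%C
      with (line gauss * (Cexp ((w + RtoC (/ 2)) * RtoC y - RtoC (y / 4)) * Cexp (RtoC (- 2 * X + - (y / 4)))))%C by ring.
    rewrite <- Cmult_assoc, <- !Cexp_plus. do 2 f_equal.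
    replace (exp (/ 2 * y + ln 2)) with (2 * X).
    2: { unfold X. rewrite exp_plus, exp_ln by lra. replace (/ 2 * y) with (y / 2) by field. ring. }
    generalize X (ln 2). intros r1 r2. destruct w as [a b].
    apply injective_projections; simpl; field.
Qed.

Lemma Cexp_half_PI : Cexp (RtoC (/ 2) * (Ci * RtoC PI)) = Ci.
Proof.
  unfold Cexp. apply injective_projections; simpl.
  - replace (/ 2 * (0 * 0 + 1 * PI) + 0 * (0 * PI - 1 * 0)) with (PI / 2) by field.
    rewrite cos_PI2. ring.
  - replace (/ 2 * (0 * 0 + 1 * PI) + 0 * (0 * PI - 1 * 0)) with (PI / 2) by field.
    rewrite sin_PI2.
    replace (/ 2 * (0 * PI - 1 * 0) - 0 * (0 * 0 + 1 * PI)) with 0 by field. rewrite exp_0. ring.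
Qed.

Lemma Ci_sqr : (Ci * Ci)%C = (- (1))%C.
Proof. apply injective_projections; simpl; ring. Qed.

Lemma egamma_half_gauss : egamma (RtoC (/ 2)) = line gauss.
Proof.
  assert (H := egamma_duplication_gauss (RtoC (/ 2)) ltac:(reim; lra)).
  replace (RtoC (/ 2) + RtoC (/ 2))%C with (RtoC 1) in H by (rewrite <- RtoC_plus; f_equal; field).
  replace (2 * RtoC (/ 2))%C with (RtoC 1) in H by (rewrite <- RtoC_mult; f_equal; field).
  rewrite egamma_1 in H.
  replace (- (1 * RtoC (ln 2)))%C with (RtoC (- ln 2)) in H by (rewrite RtoC_opp; ring).
  rewrite Cexp_R, exp_Ropp, exp_ln, <- RtoC_mult in H by lra.
  replace (2 * / 2) with 1 in H by field.
  replace (egamma (RtoC (/ 2))) with (egamma (RtoC (/ 2)) * 1)%C by ring. rewrite H. ring.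
Qed.

(** Duplication at [/ 2] identifies the integral with [egamma (/ 2)], and reflection at [/ 2] gives
    its square. Polar coordinates are avoided. *)
Lemma gauss_integral : line gauss = RtoC (sqrt PI).
Proof.
  assert (HP := PI_RGT_0). assert (Hs : 0 < sqrt PI) by (apply sqrt_lt_R0, HP).
  set (g := line gauss).
  assert (H := egamma_reflection (RtoC (/ 2)) ltac:(reim; lra)).
  replace (1 - RtoC (/ 2))%C with (RtoC (/ 2)) in H
    by (rewrite <- RtoC_minus; f_equal; field).
  rewrite egamma_half_gauss, Cexp_opp, Cexp_half_PI in H. fold g in H.
  assert (Ei : (/ Ci)%C = (- Ci)%C).
  { replace (- Ci)%C with (- (Ci * Ci) / Ci)%C by (field; apply Ci_neq_0). rewrite Ci_sqr.
    field. apply Ci_neq_0. }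
  rewrite Ei in H.
  assert (Hg : ((g - RtoC (sqrt PI)) * (g + RtoC (sqrt PI)))%C = 0%C).
  { replace ((g - RtoC (sqrt PI)) * (g + RtoC (sqrt PI)))%C with
      (g * g * (Ci - - Ci) / (2 * Ci) - RtoC (sqrt PI) * RtoC (sqrt PI))%C.
    - rewrite H. replace (RtoC (sqrt PI) * RtoC (sqrt PI))%C with (RtoC PI)
        by (rewrite <- RtoC_mult, sqrt_sqrt by lra; reflexivity). field. apply Ci_neq_0.
    - field. apply Ci_neq_0. }
  destruct (Ceq_dec (g - RtoC (sqrt PI)) 0) as [E0|Hn].
  - replace g with (g - RtoC (sqrt PI) + RtoC (sqrt PI))%C by ring. rewrite E0. ring.
  (* The root [- sqrt PI] is impossible because the truncated integrals have non-negative real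
     part. *)
  - exfalso. apply (Cmult_neq_0 _ (g + RtoC (sqrt PI))%C Hn); [|exact Hg]. intros E0.
    destruct (line_lim gauss gauss_dexp (sqrt PI) Hs) as [T [HT HL]].
    specialize (HL (- T) T (Rle_refl _) (Rle_refl _)). fold g in HL.
    assert (Hr := is_Cint_Re _ _ _ _ (Cint_correct gauss (- T) T gauss_cont)).
    assert (Hpos : 0 <= Re (Cint gauss (- T) T)).
    { apply (is_RInt_le (fun _ => 0) (fun t => Re (gauss t)) (- T) T 0); [lra| |exact Hr|].
      - assert (Z := is_RInt_const (V := R_NormedModule) (- T) T 0).
        assert (E1 : scal (T - - T) (0 : R_NormedModule) = 0) by (apply (scal_zero_r (V := R_ModuleSpace))).
        rewrite E1 in Z. exact Z.
      - intros t _. simpl. left; apply exp_pos. }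
    assert (Hre := Re_le_Cmod (g - Cint gauss (- T)%R T)).
    replace g with (- RtoC (sqrt PI))%C in Hre, HL
      by (replace g with (g + RtoC (sqrt PI) - RtoC (sqrt PI))%C by ring; rewrite E0; ring).
    rewrite Re_Cminus, Re_Copp, Re_RtoC in Hre.
    rewrite Rabs_left in Hre by lra. lra.
Qed.

Lemma egamma_duplication (w : C) : 0 < Re w ->
  (egamma w * egamma (w + RtoC (/ 2)))%C =
  (2 * Cexp (- (2 * w * RtoC (ln 2))) * RtoC (sqrt PI) * egamma (2 * w))%C.
Proof. intros H. rewrite egamma_duplication_gauss, gauss_integral by exact H. reflexivity. Qed.

(** * Ramanujan's master theorem as a Mellin-Barnes integral *)

(* The growth class of Hardy's form of the theorem. *)
Definition hardy_class (delta K P B : R) (psi : C -> C) : Prop :=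
  (forall s, - delta <= Re s -> cdiff psi s) /\
  (forall s, - delta <= Re s -> Cmod (psi s) <= K * exp (P * Re s + B * Rabs (Im s))).

(** [L] is the logarithm of the argument. The factor [1 / (2 * PI)] is left out of [mellin_barnes]
    and reappears in [mellin_barnes_series]. *)
Definition mbker (psi : C -> C) (L : R) (s : C) : C := (psi s * egamma (- s) * Cexp (s * RtoC L))%C.
Definition mellin_barnes (delta : R) (psi : C -> C) (L : R) : C := line (fun w => mbker psi L ((- delta)%R, w)).

(** An angle at which the decay of Gamma beats the growth [B], the margin being [mid_angle B - B].
    The maximum with 0 makes it positive, as [egamma_decay] requires. *)
Definition mid_angle (B : R) : R := (Rmax B 0 + PI / 2) / 2.

Lemma mid_angle_spec (B : R) : B < PI / 2 -> 0 < mid_angle B < PI / 2 /\ B < mid_angle B.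
Proof.
  intros HB. assert (HP := PI_RGT_0). unfold mid_angle, Rmax. destruct (Rle_dec B 0); lra.
Qed.

Lemma hardy_class_pos (delta K P B : R) (psi : C -> C) : 0 <= delta -> hardy_class delta K P B psi -> 0 <= K.
Proof.
  intros Hd [_ H]. specialize (H 0%C). rewrite Re_RtoC, Im_RtoC, Rabs_R0 in H.
  specialize (H ltac:(lra)). rewrite !Rmult_0_r, Rplus_0_r, exp_0 in H.
  generalize (Cmod_ge_0 (psi 0)); lra.
Qed.

Lemma ccont_ver (F : C -> C) (x : R) : (forall y, Ccont F (x, y)) -> ccont (fun y => F (x, y)).
Proof. intros H y. apply Ccont_ver, H. Qed.

(** [CI] depends neither on [psi] nor on [K]. This linearity in [K] makes the remainders in
    [mellin_barnes_series] vanish. *)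
Lemma mbker_edom (delta P B L : R) : 0 < delta -> B < PI / 2 -> exists CI, 0 <= CI /\
  forall K psi, hardy_class delta K P B psi ->
    edom (fun w => mbker psi L ((- delta)%R, w)) (CI * K) (mid_angle B - B).
Proof.
  intros Hd HB. destruct (mid_angle_spec B HB) as [Ht1 Ht2].
  destruct (egamma_decay delta delta (mid_angle B) Hd (Rle_refl _) Ht1) as [M [HM H]].
  exists (exp (P * - delta) * M * exp (- delta * L)). split.
  { apply Rmult_le_pos; [apply Rmult_le_pos; [left; apply exp_pos|lra]|left; apply exp_pos]. }
  intros K psi Hg. assert (HK := hardy_class_pos _ _ _ _ _ (Rlt_le _ _ Hd) Hg). destruct Hg as [Hg1 Hg2].
  split; [|split; [lra|]].
  - apply (ccont_ver (mbker psi L)). intros y. apply cdiff_continuous.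
    apply (cdiff_mult (fun s => (psi s * egamma (- s))%C)).
    + apply cdiff_mult; [apply Hg1; simpl; lra|].
      apply (cdiff_comp egamma (fun s => (- s)%C)); [apply egamma_cdiff; simpl; lra|apply cdiff_opp, cdiff_id].
    + apply cdiff_exp, cdiff_mult; [apply cdiff_id|apply cdiff_const].
  - intros w. unfold mbker. rewrite !Cmod_mult, Cmod_Cexp.
    assert (H1 := Hg2 (- delta, w) ltac:(simpl; lra)). simpl Re in H1. simpl Im in H1.
    assert (H2 := H (- (- delta, w)%R)%C ltac:(simpl; lra)).
    simpl Im in H2. rewrite Rabs_Ropp in H2.
    replace (Re ((- delta, w)%R * RtoC L)) with (- delta * L) by (simpl; ring).
    replace (exp (P * - delta) * M * exp (- delta * L) * K * exp (- (mid_angle B - B) * Rabs w)) with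
      (K * exp (P * - delta + B * Rabs w) * (M * exp (- mid_angle B * Rabs w)) * exp (- delta * L)).
    2: { replace (- (mid_angle B - B) * Rabs w) with (B * Rabs w + - mid_angle B * Rabs w) by ring.
         rewrite !exp_plus. ring. }
    apply Rmult_le_compat_r; [left; apply exp_pos|].
    apply Rmult_le_compat; try apply Cmod_ge_0; assumption.
Qed.

(** With [Gamma (- s) = - Gamma (1 - s) / s] the pole at 0 is explicit and Gamma stays on the right
    half-plane. On the new line [Re s = 1 - delta] the substitution of [s + 1] for [s] restores
    [Gamma (- s)] on the old one, so the poles are taken one at a time on the same strip. *)
Lemma mellin_barnes_step (delta K P B L : R) (psi : C -> C) : 0 < delta < 1 -> B < PI / 2 ->
  hardy_class delta K P B psi ->
  mellin_barnes delta psi L = (2 * RtoC PI * psi 0 - RtoC (exp L) * mellin_barnes delta (fun s => (psi (s + 1) / (s + 1))%C) L)%C.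
Proof.
  intros Hd HB Hg. destruct (mid_angle_spec B HB) as [Ht1 Ht2].
  assert (HK := hardy_class_pos _ _ _ _ _ (Rlt_le _ _ (proj1 Hd)) Hg). destruct Hg as [Hg1 Hg2].
  destruct (egamma_decay delta (1 + delta) (mid_angle B) ltac:(lra) ltac:(lra) Ht1) as [M [HM H]].
  set (G := fun s : C => (psi s * egamma (1 - s) * Cexp (s * RtoC L))%C).
  set (F := fun s : C => (G s * (- / s))%C).
  assert (HGd : forall s, - delta <= Re s <= 1 - delta -> cdiff G s).
  { intros s Hs. apply (cdiff_mult (fun s => (psi s * egamma (1 - s))%C)).
    - apply cdiff_mult; [apply Hg1; lra|].
      apply (cdiff_comp egamma (fun s => (1 - s)%C)); [apply egamma_cdiff; reim; lra|].
      apply cdiff_minus; [apply cdiff_const|apply cdiff_id].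
    - apply cdiff_exp, cdiff_mult; [apply cdiff_id|apply cdiff_const]. }
  assert (Hdf : forall s, - delta <= Re s <= 1 - delta -> s <> RtoC 0 -> cdiff F s).
  { intros s Hs Hn. apply cdiff_mult; [apply HGd, Hs|]. apply cdiff_opp, cdiff_inv; [apply cdiff_id|exact Hn]. }
  assert (Htail : strip_tail F (- delta) (1 - delta) (K * exp (Rabs P) * M * exp (Rabs L)) (mid_angle B - B)).
  { intros s Hs Hi. unfold F, G. rewrite !Cmod_mult, Cmod_opp, Cmod_Cexp.
    assert (H1 := Hg2 s ltac:(lra)).
    assert (H2 := H (1 - s)%C ltac:(reim; lra)). rewrite Im_Cminus, Im_RtoC in H2.
    replace (0 - Im s) with (- Im s) in H2 by ring. rewrite Rabs_Ropp in H2.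
    assert (Hsn : s <> 0%C) by (intros E0; rewrite E0, Im_RtoC, Rabs_R0 in Hi; lra).
    assert (H3 : Cmod (/ s) <= 1).
    { rewrite Cmod_inv by exact Hsn. rewrite <- Rinv_1. apply Rinv_le_contravar; [lra|].
      eapply Rle_trans; [exact Hi|apply Im_le_Cmod]. }
    assert (H4 : exp (Re (s * RtoC L)) <= exp (Rabs L)).
    { apply exp_le. replace (Re (s * RtoC L)) with (Re s * L) by (destruct s; simpl; ring).
      assert (A : Rabs (Re s * L) <= 1 * Rabs L).
      { rewrite Rabs_mult. apply Rmult_le_compat_r; [apply Rabs_pos|]. apply Rabs_le. lra. }
      generalize (Rle_abs (Re s * L)); lra. }
    assert (H5 : exp (P * Re s + B * Rabs (Im s)) <= exp (Rabs P) * exp (B * Rabs (Im s))).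
    { rewrite <- exp_plus. apply exp_le.
      assert (A : Rabs (P * Re s) <= Rabs P * 1).
      { rewrite Rabs_mult. apply Rmult_le_compat_l; [apply Rabs_pos|]. apply Rabs_le. lra. }
      generalize (Rle_abs (P * Re s)); lra. }
    assert (P1 := exp_pos (Rabs P)). assert (P2 := exp_pos (B * Rabs (Im s))).
    assert (P3 := exp_pos (- mid_angle B * Rabs (Im s))). assert (P4 := exp_pos (Rabs L)).
    replace (K * exp (Rabs P) * M * exp (Rabs L) * exp (- (mid_angle B - B) * Rabs (Im s))) with
      (K * (exp (Rabs P) * exp (B * Rabs (Im s))) * (M * exp (- mid_angle B * Rabs (Im s))) * exp (Rabs L) * 1).
    2: { replace (- (mid_angle B - B) * Rabs (Im s)) with (B * Rabs (Im s) + - mid_angle B * Rabs (Im s)) by ring.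
         rewrite exp_plus. ring. }
    apply Rmult_le_compat; [|apply Cmod_ge_0| |exact H3].
    { apply Rmult_le_pos; [apply Rmult_le_pos; apply Cmod_ge_0|left; apply exp_pos]. }
    apply Rmult_le_compat; [apply Rmult_le_pos; apply Cmod_ge_0|left; apply exp_pos| |exact H4].
    apply Rmult_le_compat; [apply Cmod_ge_0|apply Cmod_ge_0| |exact H2].
    eapply Rle_trans; [exact H1|]. apply Rmult_le_compat_l; assumption. }
  assert (Hlim : forall eps, 0 < eps -> exists del, 0 < del /\ forall s, s <> RtoC 0 ->
     Cmod (s - RtoC 0) < del -> Cmod ((s - RtoC 0) * F s - (- psi 0)) <= eps).
  { apply (residue_limit F (fun s => (- G s)%C)).
    - apply continuous_Copp, cdiff_continuous, HGd. rewrite Re_RtoC. lra.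
    - unfold G. replace (1 - 0)%C with (RtoC 1) by ring. rewrite egamma_1.
      replace (0 * RtoC L)%C with (RtoC 0) by ring. rewrite Cexp_0. ring.
    - intros s Hs. unfold F. field. exact Hs. }
  destruct (strip_residue F (- delta) (1 - delta) _ (mid_angle B - B) 0 (- psi 0)%C ltac:(lra) ltac:(lra) Hdf Htail Hlim)
    as [_ [D1 EL]].
  assert (E1 : forall w, F ((- delta)%R, w) = mbker psi L ((- delta)%R, w)).
  { intros w. unfold F, G, mbker. set (s := ((- delta)%R, w) : C).
    assert (Hs : Re s = - delta) by reflexivity.
    assert (Hsn : s <> 0%C) by (intros E0; rewrite E0, Re_RtoC in Hs; lra).
    replace (1 - s)%C with (- s + 1)%C by ring. rewrite egamma_succ by (reim; lra). field. exact Hsn. }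
  assert (E2 : forall w, F ((1 - delta)%R, w) =
    (RtoC (- exp L) * mbker (fun s => (psi (s + 1) / (s + 1))%C) L ((- delta)%R, w))%C).
  { intros w. unfold F, G, mbker. set (s := ((- delta)%R, w) : C).
    replace (((1 - delta)%R, w) : C) with (s + 1)%C by (apply injective_projections; simpl; ring).
    replace (1 - (s + 1))%C with (- s)%C by ring.
    replace ((s + 1) * RtoC L)%C with (s * RtoC L + RtoC L)%C by ring.
    rewrite Cexp_plus, Cexp_R, RtoC_opp. unfold Cdiv. ring. }
  assert (Hx : RtoC (- exp L) <> 0%C).
  { intros E0. apply RtoC_inj in E0. generalize (exp_pos L); lra. }
  assert (D2 : dexp (fun w => mbker (fun s => (psi (s + 1) / (s + 1))%C) L ((- delta)%R, w))).
  { apply dexp_ext with (fun w => (/ RtoC (- exp L) * F ((1 - delta)%R, w))%C).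
    - intros w. rewrite E2. field. exact Hx.
    - apply dexp_scal, D1. }
  rewrite (line_ext _ _ E1), (line_ext _ _ E2), line_scal in EL by exact D2.
  unfold mellin_barnes. rewrite RtoC_opp in EL.
  set (u := line (fun w => mbker psi L ((- delta)%R, w))) in *.
  set (v := line (fun w => mbker (fun s => (psi (s + 1) / (s + 1))%C) L ((- delta)%R, w))) in *.
  replace (2 * RtoC PI * psi 0 - RtoC (exp L) * v)%C with (2 * RtoC PI * psi 0 + - RtoC (exp L) * v)%C by ring.
  rewrite EL. ring.
Qed.

Fixpoint Csum (a : nat -> C) (n : nat) : C :=
  match n with
  | O => RtoC 0
  | S k => (Csum a k + a k)%C
  end.

Definition Cconv (a : nat -> C) (l : C) : Prop :=
  forall eps, 0 < eps -> exists N, forall n, (N <= n)%nat -> Cmod (Csum a n - l) < eps.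

(* The effect on [psi] of moving the line of integration [n] units to the right. *)
Definition shiftN (psi : C -> C) (n : nat) (s : C) : C :=
  (psi (s + RtoC (INR n)) / rising (s + 1) n)%C.

Lemma rising_S_l (z : C) (n : nat) : rising z (S n) = (z * rising (z + 1) n)%C.
Proof.
  induction n as [|n IH].
  - simpl. ring.
  - change (rising z (S (S n))) with (rising z (S n) * (z + RtoC (INR (S n))))%C.
    rewrite IH, S_INR, RtoC_plus. simpl. ring.
Qed.

Lemma rising_1 (n : nat) : rising 1 n = RtoC (INR (fact n)).
Proof.
  induction n as [|n IH]; [reflexivity|].
  change (rising 1 (S n)) with (rising 1 n * (1 + RtoC (INR n)))%C.
  rewrite IH. change (fact (S n)) with (S n * fact n)%nat.
  rewrite mult_INR, S_INR, RtoC_mult, RtoC_plus. ring.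
Qed.

(** The first factor has real part at least [1 - delta], and the factor [s + 1 + k] has real part at
    least [k] for [k >= 1]. *)
Lemma rising_lower (delta : R) (s : C) (n : nat) : delta < 1 -> - delta <= Re s ->
  (1 - delta) * INR (fact n) <= Cmod (rising (s + 1) (S n)).
Proof.
  intros Hd Hs. induction n as [|n IH].
  - simpl rising. rewrite Cmod_mult, Cmod_1.
    assert (H := Re_le_Cmod (s + 1 + 0)). rewrite !Re_Cplus, !Re_RtoC in H.
    rewrite Rabs_pos_eq in H by lra. simpl. lra.
  - change (rising (s + 1) (S (S n))) with (rising (s + 1) (S n) * (s + 1 + RtoC (INR (S n))))%C.
    change (fact (S n)) with (S n * fact n)%nat. rewrite mult_INR, Cmod_mult.
    replace ((1 - delta) * (INR (S n) * INR (fact n))) with ((1 - delta) * INR (fact n) * INR (S n)) by ring.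
    assert (Hf := INR_fact_lt_0 n). assert (HS := pos_INR (S n)).
    apply Rmult_le_compat; [nra|exact HS|exact IH|].
    assert (H := Re_le_Cmod (s + 1 + RtoC (INR (S n)))). rewrite !Re_Cplus, !Re_RtoC in H.
    generalize (Rle_abs (Re s + 1 + INR (S n))). lra.
Qed.

Lemma rising_neq_0 (delta : R) (s : C) (n : nat) : delta < 1 -> - delta <= Re s ->
  rising (s + 1) n <> 0%C.
Proof.
  intros Hd Hs. destruct n as [|n]; [simpl; intros E0; apply RtoC_inj in E0; lra|].
  intros H. assert (H1 := rising_lower delta s n Hd Hs). rewrite H, Cmod_0 in H1.
  assert (Hf := INR_fact_lt_0 n). nra.
Qed.

Lemma rising_cdiff (n : nat) (s : C) : cdiff (fun s => rising (s + 1) n) s.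
Proof.
  induction n as [|n IH]; simpl; [apply (cdiff_const 1%C)|].
  apply cdiff_mult; [exact IH|].
  apply cdiff_plus; [|apply cdiff_const]. apply cdiff_plus; [apply cdiff_id|apply cdiff_const].
Qed.

Lemma shiftN_diff (delta K P B : R) (psi : C -> C) (n : nat) : delta < 1 ->
  hardy_class delta K P B psi -> forall s, - delta <= Re s -> cdiff (shiftN psi n) s.
Proof.
  intros Hd [Hg _] s Hs. apply cdiff_mult.
  - apply (cdiff_comp psi (fun s => (s + RtoC (INR n))%C)).
    + apply Hg. reim. generalize (pos_INR n). lra.
    + apply cdiff_plus; [apply cdiff_id|apply cdiff_const].
  - apply cdiff_inv; [apply rising_cdiff|apply (rising_neq_0 delta); assumption].
Qed.

(** [P] and [B] do not change, so the decay rate is the same for all [n]; the constant gains the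
    reciprocal factorial that makes the series converge for every argument. *)
Lemma shiftN_good (delta K P B : R) (psi : C -> C) (n : nat) : 0 <= delta < 1 ->
  hardy_class delta K P B psi ->
  hardy_class delta (K * exp (P * INR (S n)) / ((1 - delta) * INR (fact n))) P B (shiftN psi (S n)).
Proof.
  intros Hd Hg. assert (HK := hardy_class_pos _ _ _ _ _ (proj1 Hd) Hg).
  split; [apply (shiftN_diff delta K P B); [lra|exact Hg]|].
  intros s Hs. unfold shiftN.
  assert (Hn := rising_neq_0 delta s (S n) ltac:(lra) Hs).
  rewrite Cmod_div by exact Hn.
  assert (H1 := proj2 Hg (s + RtoC (INR (S n)))%C
    ltac:(reim; generalize (pos_INR (S n)); lra)).
  rewrite Re_Cplus, Im_Cplus, Re_RtoC, Im_RtoC, Rplus_0_r in H1.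
  assert (H2 := rising_lower delta s n ltac:(lra) Hs).
  assert (Hf := INR_fact_lt_0 n).
  assert (Hp : 0 < (1 - delta) * INR (fact n)) by nra.
  replace (K * exp (P * INR (S n)) / ((1 - delta) * INR (fact n)) * exp (P * Re s + B * Rabs (Im s))) with
    ((K * exp (P * (Re s + INR (S n)) + B * Rabs (Im s))) * / ((1 - delta) * INR (fact n))).
  2: { replace (P * (Re s + INR (S n)) + B * Rabs (Im s)) with (P * INR (S n) + (P * Re s + B * Rabs (Im s))) by ring.
       rewrite exp_plus. field. lra. }
  apply Rmult_le_compat; [apply Cmod_ge_0|left; apply Rinv_0_lt_compat; lra|exact H1|].
  apply Rinv_le_contravar; assumption.
Qed.

Lemma mellin_barnes_ext (delta L : R) (f g : C -> C) : (forall w, f ((- delta)%R, w) = g ((- delta)%R, w)) ->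
  mellin_barnes delta f L = mellin_barnes delta g L.
Proof. intros H. apply line_ext. intros w. unfold mbker. rewrite H. reflexivity. Qed.

Lemma mellin_barnes_sum (delta K P B L : R) (psi : C -> C) (n : nat) : 0 < delta < 1 -> B < PI / 2 ->
  hardy_class delta K P B psi ->
  mellin_barnes delta psi L =
    (2 * RtoC PI * Csum (fun m => psi (RtoC (INR m)) / RtoC (INR (fact m)) * (- RtoC (exp L)) ^ m) n
     + (- RtoC (exp L)) ^ n * mellin_barnes delta (shiftN psi n) L)%C.
Proof.
  intros Hd HB Hg. induction n as [|n IH].
  - simpl. rewrite (mellin_barnes_ext delta L (shiftN psi 0) psi).
    + ring.
    + intros w. unfold shiftN. set (s := ((- delta)%R, w) : C). simpl.
      replace (s + 0)%C with s by ring. field.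
  - assert (Hgn : exists K', hardy_class delta K' P B (shiftN psi n)).
    { destruct n as [|n].
      - exists K. split; [apply (shiftN_diff delta K P B); [lra|exact Hg]|].
        intros s Hs. unfold shiftN. simpl.
        replace (psi (s + 0) / 1)%C with (psi s) by (replace (s + 0)%C with s by ring; field).
        apply Hg, Hs.
      - eexists. apply (shiftN_good delta K P B psi n ltac:(lra) Hg). }
    destruct Hgn as [K' Hgn].
    rewrite IH, (mellin_barnes_step delta K' P B L (shiftN psi n) Hd HB Hgn).
    rewrite (mellin_barnes_ext delta L (fun s => (shiftN psi n (s + 1) / (s + 1))%C) (shiftN psi (S n))).
    + simpl Csum. simpl Cpow.
      replace (shiftN psi n 0) with (psi (RtoC (INR n)) / RtoC (INR (fact n)))%C.
      2: { unfold shiftN. replace (0 + 1)%C with (RtoC 1) by ring. rewrite rising_1.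
           replace (0 + RtoC (INR n))%C with (RtoC (INR n)) by ring. reflexivity. }
      ring.
    + intros w. unfold shiftN. set (s := ((- delta)%R, w) : C).
      assert (Hs : Re s = - delta) by reflexivity.
      assert (Hn := rising_neq_0 delta s (S n) ltac:(lra) ltac:(lra)).
      rewrite rising_S_l in Hn |- *.
      replace (s + 1 + RtoC (INR n))%C with (s + RtoC (INR (S n)))%C by (rewrite S_INR, RtoC_plus; ring).
      field. split; intros E0; apply Hn; rewrite E0; ring.
Qed.

Lemma Cmod_pow (z : C) (n : nat) : Cmod (z ^ n) = Cmod z ^ n.
Proof.
  induction n as [|n IH]; simpl; [apply Cmod_1|]. rewrite Cmod_mult, IH. reflexivity.
Qed.

Lemma pow_fact_small (x eps : R) : 0 < eps ->
  exists N, forall n, (N <= n)%nat -> Rabs (x ^ n / INR (fact n)) < eps.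
Proof.
  intros He. destruct (cv_speed_pow_fact x eps He) as [N HN]. exists N. intros n Hn.
  specialize (HN n Hn). unfold Rdist in HN. rewrite Rminus_0_r in HN. exact HN.
Qed.

(** The remainder after [S n] poles is [exp L ^ S n] times an integral of size [exp P ^ S n / n!],
    which tends to 0 whatever [L] is. *)
Lemma mellin_barnes_series (delta K P B L : R) (psi : C -> C) : 0 < delta < 1 -> B < PI / 2 ->
  hardy_class delta K P B psi ->
  Cconv (fun m => psi (RtoC (INR m)) / RtoC (INR (fact m)) * (- RtoC (exp L)) ^ m)%C
    (mellin_barnes delta psi L / (2 * RtoC PI))%C.
Proof.
  intros Hd HB Hg eps Heps. assert (HP := PI_RGT_0).
  destruct (mbker_edom delta P B L (proj1 Hd) HB) as [CI [HCI HE]].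
  destruct (mid_angle_spec B HB) as [Ht1 Ht2].
  set (e := mid_angle B - B) in *. assert (He : 0 < e) by (unfold e; lra).
  assert (HK := hardy_class_pos _ _ _ _ _ (Rlt_le _ _ (proj1 Hd)) Hg).
  set (x := exp L). set (y := x * exp P).
  assert (Hx : 0 < x) by apply exp_pos. assert (Hy : 0 < y) by (apply Rmult_lt_0_compat; [exact Hx|apply exp_pos]).
  (* [S n] powers of [y] meet only [n!], so one power is moved into the constant. *)
  set (A := 2 * (CI * K / (1 - delta)) / e * y).
  assert (HA : 0 <= A).
  { unfold A. apply Rmult_le_pos; [|lra]. apply Rdiv_le_0_compat; [|exact He].
    apply Rmult_le_pos; [lra|]. apply Rdiv_le_0_compat; [|lra]. apply Rmult_le_pos; assumption. }
  destruct (pow_fact_small y (eps / (A + 1))) as [N HN]; [apply Rdiv_lt_0_compat; lra|].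
  exists (S N). intros n Hn. destruct n as [|n]; [lia|]. specialize (HN n ltac:(lia)).
  rewrite (mellin_barnes_sum delta K P B L psi (S n) Hd HB Hg). fold x.
  set (Sn := Csum _ (S n)).
  assert (HPn : (2 * RtoC PI)%C <> 0%C).
  { rewrite <- RtoC_mult. intros E0. apply RtoC_inj in E0. lra. }
  replace (Sn - (2 * RtoC PI * Sn + (- RtoC x) ^ S n * mellin_barnes delta (shiftN psi (S n)) L) / (2 * RtoC PI))%C with
    (- ((- RtoC x) ^ S n * mellin_barnes delta (shiftN psi (S n)) L) / (2 * RtoC PI))%C
    by (field; intros E0; apply HPn; rewrite E0; ring).
  rewrite Cmod_div by exact HPn. rewrite Cmod_opp, Cmod_mult, Cmod_pow, Cmod_opp, <- RtoC_mult, !Cmod_R.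
  rewrite (Rabs_pos_eq x), (Rabs_pos_eq (2 * PI)) by lra.
  assert (HB2 := line_bound _ _ _ (HE _ _ (shiftN_good delta K P B psi n ltac:(lra) Hg))).
  fold (mellin_barnes delta (shiftN psi (S n)) L) in HB2.
  assert (Hfl : 0 < INR (fact n)) by apply INR_fact_lt_0.
  assert (Hyn : 0 < y ^ n) by (apply pow_lt, Hy).
  assert (HN2 : y ^ n / INR (fact n) < eps / (A + 1)).
  { rewrite Rabs_pos_eq in HN; [exact HN|]. apply Rdiv_le_0_compat; lra. }
  assert (Hexp : exp (P * INR (S n)) = exp P ^ S n).
  { rewrite <- Rpower_pow by apply exp_pos. unfold Rpower. rewrite ln_exp. f_equal. ring. }
  assert (Hb : x ^ S n * Cmod (mellin_barnes delta (shiftN psi (S n)) L) <= A * (y ^ n / INR (fact n))).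
  { eapply Rle_trans; [apply Rmult_le_compat_l; [apply pow_le; lra|exact HB2]|].
    right. rewrite Hexp. unfold A. replace (y ^ n) with (x ^ n * exp P ^ n) by (unfold y; rewrite Rpow_mult_distr; reflexivity).
    unfold y. simpl pow. field. repeat split; lra. }
  apply Rle_lt_trans with (A * (y ^ n / INR (fact n))).
  - apply Rmult_le_reg_r with (2 * PI); [lra|]. unfold Rdiv at 1. rewrite Rmult_assoc, Rinv_l, Rmult_1_r by lra.
    eapply Rle_trans; [exact Hb|]. assert (1 <= 2 * PI) by (generalize PI2_1; lra).
    assert (0 <= A * (y ^ n / INR (fact n))) by (apply Rmult_le_pos; [exact HA|apply Rdiv_le_0_compat; lra]).
    nra.
  - apply Rle_lt_trans with (A * (eps / (A + 1))); [apply Rmult_le_compat_l; lra|].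
    apply Rmult_lt_reg_r with (A + 1); [lra|].
    replace (A * (eps / (A + 1)) * (A + 1)) with (A * eps) by (field; lra). nra.
Qed.

(** Multiplication by [s] represents [x * h' x]. The real part costs one unit of [P], because [Re s]
    is bounded below; the imaginary part costs [eta], half of the gap between [B] and [PI / 2]. *)
Lemma hardy_class_mult_id (delta K P B : R) (psi : C -> C) : 0 <= delta < 1 -> B < PI / 2 ->
  hardy_class delta K P B psi ->
  exists K' B', B' < PI / 2 /\ hardy_class delta K' (P + 1) B' (fun s => (s * psi s)%C).
Proof.
  intros Hd HB Hg. assert (HK := hardy_class_pos _ _ _ _ _ (proj1 Hd) Hg). destruct Hg as [Hg1 Hg2].
  set (eta := (PI / 2 - B) / 2). assert (He : 0 < eta) by (unfold eta; lra).
  exists (exp 1 * (1 + / eta) * K), (B + eta). split; [unfold eta; lra|]. split.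
  - intros s Hs. apply cdiff_mult; [apply cdiff_id|apply Hg1, Hs].
  - intros s Hs. rewrite Cmod_mult.
    assert (H1 : Rabs (Re s) <= exp 1 * exp (Re s)).
    { rewrite <- exp_plus. assert (H0 := exp_ineq1_le (1 + Re s)). apply Rabs_le. lra. }
    assert (H2 : 1 <= exp 1 * exp (Re s)).
    { rewrite <- exp_plus. apply Rle_trans with (exp 0); [rewrite exp_0; lra|apply exp_le; lra]. }
    assert (Hi := Rabs_pos (Im s)).
    assert (H3 : 1 + Rabs (Im s) <= (1 + / eta) * exp (eta * Rabs (Im s))).
    { assert (H4 := exp_ineq1_le (eta * Rabs (Im s))).
      assert (Hie : 0 < / eta) by (apply Rinv_0_lt_compat, He).
      assert (H5 : Rabs (Im s) = / eta * (eta * Rabs (Im s))) by (field; lra).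
      assert (0 <= eta * Rabs (Im s)) by (apply Rmult_le_pos; lra). nra. }
    assert (H6 : Cmod s <= (exp 1 * exp (Re s)) * ((1 + / eta) * exp (eta * Rabs (Im s)))).
    { eapply Rle_trans; [apply Cmod_le_ReIm|].
      apply Rle_trans with ((exp 1 * exp (Re s)) * (1 + Rabs (Im s))); [nra|].
      apply Rmult_le_compat_l; [lra|exact H3]. }
    replace (exp 1 * (1 + / eta) * K * exp ((P + 1) * Re s + (B + eta) * Rabs (Im s))) with
      ((exp 1 * exp (Re s)) * ((1 + / eta) * exp (eta * Rabs (Im s))) * (K * exp (P * Re s + B * Rabs (Im s)))).
    + apply Rmult_le_compat; try apply Cmod_ge_0; [exact H6|apply Hg2, Hs].
    + replace ((P + 1) * Re s + (B + eta) * Rabs (Im s)) with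
        (Re s + (eta * Rabs (Im s) + (P * Re s + B * Rabs (Im s)))) by ring.
      rewrite (exp_plus (Re s)), (exp_plus (eta * Rabs (Im s))). ring.
Qed.

(** * The identity theorem along the half-line *)

Lemma bdry_bounded (g : C -> C) (a b c d : R) : a <= b -> c <= d ->
  (forall z, bdry a b c d z -> Ccont g z) ->
  exists M, 0 <= M /\ forall z, bdry a b c d z -> Cmod (g z) <= M.
Proof.
  intros Hab Hcd H.
  assert (A : forall y, y = c \/ y = d -> exists M, forall x, a <= x <= b -> Cmod (g (x, y)) <= M).
  { intros y Hy.
    destruct (bounded_continuity (V := C_R_NormedModule) (fun x => g (x, y)) a b) as [M HM].
    - intros x Hx. apply (Ccont_hor g). apply H. unfold bdry, rect; simpl. destruct Hy; subst; lra.
    - exists M. intros x Hx. left. rewrite <- C_norm. apply HM, Hx. }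
  assert (B : forall x, x = a \/ x = b -> exists M, forall y, c <= y <= d -> Cmod (g (x, y)) <= M).
  { intros x Hx.
    destruct (bounded_continuity (V := C_R_NormedModule) (fun y => g (x, y)) c d) as [M HM].
    - intros y Hy. apply (Ccont_ver g). apply H. unfold bdry, rect; simpl. destruct Hx; subst; lra.
    - exists M. intros y Hy. left. rewrite <- C_norm. apply HM, Hy. }
  destruct (A c (or_introl eq_refl)) as [M1 H1]. destruct (A d (or_intror eq_refl)) as [M2 H2].
  destruct (B a (or_introl eq_refl)) as [M3 H3]. destruct (B b (or_intror eq_refl)) as [M4 H4].
  exists (Rabs M1 + Rabs M2 + Rabs M3 + Rabs M4).
  generalize (Rabs_pos M1) (Rabs_pos M2) (Rabs_pos M3) (Rabs_pos M4)
    (Rle_abs M1) (Rle_abs M2) (Rle_abs M3) (Rle_abs M4). intros.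
  split; [lra|]. intros [x y] [[Hx Hy] Hd]. simpl in *.
  destruct Hd as [E0|[E0|[E0|E0]]]; subst.
  - specialize (H3 y Hy). lra.
  - specialize (H4 y Hy). lra.
  - specialize (H1 x Hx). lra.
  - specialize (H2 x Hx). lra.
Qed.

Lemma cdiff_pow (f : C -> C) (n : nat) (z : C) : cdiff f z -> cdiff (fun s => (f s ^ n)%C) z.
Proof.
  intros H. induction n as [|n IH]; simpl; [apply (cdiff_const 1%C)|].
  apply (cdiff_mult f (fun s => (f s ^ n)%C)); assumption.
Qed.

Lemma Csub_neq (z w : C) : z <> w -> (z - w)%C <> 0%C.
Proof. intros H E. apply H. replace z with (z - w + w)%C by ring. rewrite E. ring. Qed.

(* Cauchy's integral formula for [g z / (z - a) ^ n] bounds [g z] by a constant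
   times [(|z - a| / r) ^ n]. *)
Lemma identity_square (g : C -> C) (a : C) (r eta : R) : 0 < r -> 0 < eta ->
  (forall z, rect (Re a - r) (Re a + r) (Im a - r) (Im a + r) z -> cdiff g z) ->
  (forall z, Cmod (z - a) < eta -> g z = 0%C) ->
  forall z, Rabs (Re z - Re a) < r / 2 -> Rabs (Im z - Im a) < r / 2 -> g z = 0%C.
Proof.
  intros Hr Heta Hg H0 z Hz1 Hz2.
  destruct (Ceq_dec z a) as [Ea|Hza].
  { apply H0. rewrite Ea. replace (a - a)%C with (RtoC 0) by ring. rewrite Cmod_0. exact Heta. }
  assert (Hzn := Csub_neq z a Hza).
  set (a1 := Re a) in *. set (a2 := Im a) in *.
  assert (Hz3 := Rabs_def2 _ _ Hz1). assert (Hz4 := Rabs_def2 _ _ Hz2).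
  destruct (bdry_bounded g (a1 - r) (a1 + r) (a2 - r) (a2 + r)) as [M [HM HMb]]; try lra.
  { intros u [Hu _]. apply cdiff_continuous, Hg, Hu. }
  (* In the half-size square [|z - a| <= |Re (z - a)| + |Im (z - a)| < r], hence [q < 1]. *)
  set (q := Cmod (z - a) / r).
  assert (Hq0 : 0 <= q) by (apply Rdiv_le_0_compat; [apply Cmod_ge_0|exact Hr]).
  assert (Hq1 : q < 1).
  { assert (H := Cmod_le_ReIm (z - a)). rewrite Re_Cminus, Im_Cminus in H. fold a1 a2 in H.
    unfold q. apply Rmult_lt_reg_r with r; [exact Hr|]. unfold Rdiv. rewrite Rmult_assoc, Rinv_l; lra. }
  (* The constant is the perimeter [8 * r] divided by the distance [r / 2] from [z] to the sides. *)
  assert (HB : forall n, 2 * PI * Cmod (g z) <= 16 * M * q ^ n).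
  { intros n. set (F := fun s : C => (g s * / ((s - a) ^ n * (s - z)))%C).
    assert (HJ : rect_int F (a1 - r) (a1 + r) (a2 - r) (a2 + r) = (2 * RtoC PI * Ci * (g z / (z - a) ^ n))%C).
    { apply rect_residue with z; try lra.
      - intros s Hs Hsz. destruct (Ceq_dec s a) as [Es|Hsa].
        (* [g] vanishes near [a], so the quotient is identically 0 there, at [a] itself too, and [z]
           is the only pole. *)
        + subst s. exists 0%C. apply (cder_ext_loc (fun _ => 0%C) F a 0%C eta Heta); [|apply cder_const].
          intros w Hw. unfold F. rewrite (H0 w Hw). ring.
        + apply cdiff_mult; [apply Hg, Hs|]. apply cdiff_inv.
          * apply (cdiff_mult (fun s => ((s - a) ^ n)%C) (fun s => (s - z)%C)).
            { apply (cdiff_pow (fun s => (s - a)%C)).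
              apply cdiff_minus; [apply cdiff_id|apply cdiff_const]. }
            apply cdiff_minus; [apply cdiff_id|apply cdiff_const].
          * apply Cmult_neq_0; [apply Cpow_nz, Csub_neq, Hsa|apply Csub_neq, Hsz].
      - apply (residue_limit F (fun s => (g s / (s - a) ^ n)%C)); [|reflexivity|].
        + apply continuous_Cmult; [apply cdiff_continuous, Hg; split; lra|].
          apply continuous_Cinv; [|apply Cpow_nz, Hzn].
          apply (cdiff_continuous (fun s => ((s - a) ^ n)%C)).
          apply (cdiff_pow (fun s => (s - a)%C)). apply cdiff_minus; [apply cdiff_id|apply cdiff_const].
        + intros s Hs. unfold F. assert (Hsz := Csub_neq s z Hs).
          destruct (Ceq_dec ((s - a) ^ n) 0) as [E0|Hn].
          * rewrite E0. replace (0 * (s - z))%C with (RtoC 0) by ring. unfold Cdiv. rewrite Cinv_zero. ring.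
          * field. split; assumption. }
    assert (HPz := pow_lt r n Hr).
    assert (Hbd : Cmod (rect_int F (a1 - r) (a1 + r) (a2 - r) (a2 + r)) <=
      2 * ((a1 + r - (a1 - r)) + (a2 + r - (a2 - r))) * (M * / (r ^ n * (r / 2)))).
    { apply rect_int_bound; try lra. intros s Hs.
      assert (Hsr := proj1 Hs).
      assert (Hd1 : r <= Cmod (s - a)).
      { generalize (Re_le_Cmod (s - a)) (Im_le_Cmod (s - a)). rewrite Re_Cminus, Im_Cminus. fold a1 a2.
        intros A B. destruct Hs as [_ [Hs|[Hs|[Hs|Hs]]]]; rewrite Hs in *.
        - rewrite Rabs_left in A by lra. lra.
        - rewrite Rabs_pos_eq in A by lra. lra.
        - rewrite Rabs_left in B by lra. lra.
        - rewrite Rabs_pos_eq in B by lra. lra. }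
      assert (Hd2 : r / 2 <= Cmod (s - z)).
      { generalize (Re_le_Cmod (s - z)) (Im_le_Cmod (s - z)). rewrite Re_Cminus, Im_Cminus.
        intros A B. destruct Hs as [_ [Hs|[Hs|[Hs|Hs]]]]; rewrite Hs in *.
        - rewrite Rabs_left in A by lra. lra.
        - rewrite Rabs_pos_eq in A by lra. lra.
        - rewrite Rabs_left in B by lra. lra.
        - rewrite Rabs_pos_eq in B by lra. lra. }
      assert (Hn1 : ((s - a) ^ n * (s - z))%C <> 0%C).
      { apply Cmult_neq_0; [apply Cpow_nz|]; intros E0; rewrite E0, Cmod_0 in *; lra. }
      split.
      - apply continuous_Cmult; [apply cdiff_continuous, Hg, Hsr|].
        apply continuous_Cinv; [|exact Hn1].
        apply (cdiff_continuous (fun s => ((s - a) ^ n * (s - z))%C)).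
        apply (cdiff_mult (fun s => ((s - a) ^ n)%C) (fun s => (s - z)%C)).
        { apply (cdiff_pow (fun s => (s - a)%C)).
          apply cdiff_minus; [apply cdiff_id|apply cdiff_const]. }
        apply cdiff_minus; [apply cdiff_id|apply cdiff_const].
      - unfold F. rewrite Cmod_mult, Cmod_inv by exact Hn1.
        apply Rmult_le_compat; [apply Cmod_ge_0|left; apply Rinv_0_lt_compat, Cmod_gt_0, Hn1|apply HMb, Hs|].
        apply Rinv_le_contravar; [apply Rmult_lt_0_compat; lra|].
        rewrite Cmod_mult, Cmod_pow. apply Rmult_le_compat; try lra.
        apply pow_incr. lra. }
    rewrite HJ in Hbd. rewrite !Cmod_mult, Cmod_Ci, Cmod_div, Cmod_pow, !Cmod_R in Hbd by apply Cpow_nz, Hzn.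
    assert (HP := PI_RGT_0). rewrite (Rabs_pos_eq 2), (Rabs_pos_eq PI) in Hbd by lra.
    assert (Hzp : 0 < Cmod (z - a) ^ n) by (apply pow_lt, Cmod_gt_0, Hzn).
    assert (Eq : q ^ n = Cmod (z - a) ^ n / r ^ n).
    { unfold q, Rdiv. rewrite Rpow_mult_distr, pow_inv. reflexivity. }
    rewrite Eq.
    replace (2 * PI * Cmod (g z)) with (2 * PI * 1 * (Cmod (g z) / Cmod (z - a) ^ n) * Cmod (z - a) ^ n) by (field; lra).
    eapply Rle_trans; [apply Rmult_le_compat_r; [lra|exact Hbd]|].
    right. field. split; lra. }
  apply Cmod_eq_0. apply Rle_antisym; [|apply Cmod_ge_0]. apply le_epsilon. intros eps Heps.
  rewrite Rplus_0_l.
  assert (Hlim : is_lim_seq (fun n => (16 * M) * q ^ n) ((16 * M) * 0)).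
  { apply (is_lim_seq_scal_l (fun n => q ^ n) (16 * M) 0). apply is_lim_seq_geom. rewrite Rabs_pos_eq; lra. }
  rewrite Rmult_0_r in Hlim.
  destruct (proj2 (is_lim_seq_spec _ _) Hlim (mkposreal _ Heps)) as [N HN].
  specialize (HN N (Nat.le_refl N)). simpl in HN. rewrite Rminus_0_r in HN.
  generalize (Rle_abs (16 * M * q ^ N)) (HB N) (Cmod_ge_0 (g z)) PI2_1. intros. nra.
Qed.

(** Connectedness of the half-line: if the points near which [g] vanishes stopped at a supremum [m],
    a square centred slightly to the left of [m] would carry the vanishing past it. *)
Lemma identity_halfline (g : C -> C) :
  (forall x, 0 <= x -> exists r, 0 < r /\ forall z, Cmod (z - RtoC x) < r -> cdiff g z) ->
  (exists eta, 0 < eta /\ forall z, Cmod z < eta -> g z = 0%C) ->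
  forall x, 0 <= x -> exists eta, 0 < eta /\ forall z, Cmod (z - RtoC x) < eta -> g z = 0%C.
Proof.
  intros Hd H0.
  set (Good := fun x => exists eta, 0 < eta /\ forall z, Cmod (z - RtoC x) < eta -> g z = 0%C).
  set (S := fun x => 0 <= x /\ forall t, 0 <= t <= x -> Good t).
  assert (S0 : S 0).
  { split; [lra|]. intros t Ht. replace t with 0 by lra. destruct H0 as [eta [He H]].
    exists eta. split; [exact He|]. intros z Hz. apply H. replace (z - RtoC 0)%C with z in Hz by ring. exact Hz. }
  intros x0 Hx0. apply Classical_Prop.NNPP. intros Hbad.
  assert (Hub : is_upper_bound S x0).
  { intros s [Hs1 Hs2]. apply Rnot_lt_le. intros Hlt. apply Hbad, Hs2. lra. }
  destruct (completeness S (ex_intro _ x0 Hub) (ex_intro _ 0 S0)) as [m [Hm1 Hm2]].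
  assert (Hm0 : 0 <= m) by (apply Hm1, S0).
  destruct (Hd m Hm0) as [r [Hr Hrd]].
  assert (Ha : exists a, S a /\ m - r / 16 < a).
  { apply Classical_Prop.NNPP. intros Hno.
    assert (Hb : is_upper_bound S (m - r / 16)).
    { intros s Hs. apply Rnot_lt_le. intros Hlt. apply Hno. exists s. split; assumption. }
    specialize (Hm2 _ Hb). lra. }
  destruct Ha as [a [[Ha0 HaS] Ham]].
  assert (Ham2 : a <= m) by (apply Hm1; split; assumption).
  destruct (HaS a ltac:(lra)) as [eta [Heta Hga]].
  assert (HS : S (m + r / 32)).
  { split; [lra|]. intros t Ht. destruct (Rle_dec t a) as [Hta|Hta]; [apply HaS; lra|].
    apply Rnot_le_lt in Hta. exists (r / 64). split; [lra|]. intros z Hz.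
    (* As [a] is within [r / 16] of [m], the square lies in the disc around [m]. Its half-size part
       reaches [r / 8] beyond [a], more than [r / 16 + r / 32 + r / 64]. *)
    apply (identity_square g (RtoC a) (r / 4) eta); try lra.
    - intros u [Hu1 Hu2]. rewrite Re_RtoC in Hu1. rewrite Im_RtoC in Hu2. apply Hrd.
      eapply Rle_lt_trans; [apply Cmod_le_ReIm|]. reim.
      assert (Rabs (Re u - m) <= r / 4 + r / 16) by (apply Rabs_le; lra).
      assert (Rabs (Im u - 0) <= r / 4) by (apply Rabs_le; lra). lra.
    - exact Hga.
    - assert (H1 := Re_le_Cmod (z - RtoC t)). rewrite Re_Cminus, Re_RtoC in H1. rewrite Re_RtoC.
      assert (H2 := Rabs_def2 (Re z - t) (r / 64) ltac:(lra)). apply Rabs_def1; lra.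
    - assert (H1 := Im_le_Cmod (z - RtoC t)). rewrite Im_Cminus, Im_RtoC in H1. rewrite Im_RtoC. lra. }
  specialize (Hm1 _ HS). lra.
Qed.

(** * Entire functions with factorially small coefficients *)

Lemma pow_fact_le_exp (t : R) (n : nat) : 0 <= t -> t ^ n / INR (fact n) <= exp t.
Proof.
  intros Ht. eapply Rle_trans; [|apply (exp_ge_taylor t n Ht)].
  assert (Hp : forall k, 0 <= t ^ k / INR (fact k)).
  { intros k. apply Rdiv_le_0_compat; [apply pow_le, Ht|apply INR_fact_lt_0]. }
  destruct n as [|n]; [apply Rle_refl|]. rewrite tech5.
  assert (H : 0 <= sum_f_R0 (fun k => t ^ k / INR (fact k)) n) by (apply cond_pos_sum, Hp).
  lra.
Qed.

(** Read off from [(2 * t) ^ n / n! <= exp (2 * t)]. It turns factorial bounds into geometric ones,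
    the only form in which convergence is tested below. *)
Lemma pow_fact_geom (t : R) (n : nat) : 0 <= t -> t ^ n / INR (fact n) <= exp (2 * t) / 2 ^ n.
Proof.
  intros Ht. assert (H := pow_fact_le_exp (2 * t) n ltac:(lra)).
  assert (Hp : 0 < 2 ^ n) by (apply pow_lt; lra). assert (Hf := INR_fact_lt_0 n).
  rewrite Rpow_mult_distr in H.
  apply Rmult_le_reg_r with (2 ^ n); [exact Hp|].
  replace (exp (2 * t) / 2 ^ n * 2 ^ n) with (exp (2 * t)) by (field; lra).
  replace (t ^ n / INR (fact n) * 2 ^ n) with (2 ^ n * t ^ n / INR (fact n)) by (field; lra).
  exact H.
Qed.

Lemma Cconv_unique (a : nat -> C) (l m : C) : Cconv a l -> Cconv a m -> l = m.
Proof.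
  intros Hl Hm. apply C_eq_eps. intros eps He. assert (He2 : 0 < eps / 2) by lra.
  destruct (Hl _ He2) as [N1 H1]. destruct (Hm _ He2) as [N2 H2].
  specialize (H1 (max N1 N2) ltac:(lia)). specialize (H2 (max N1 N2) ltac:(lia)).
  set (s := Csum a (max N1 N2)) in *.
  replace (l - m)%C with (- (s - l) + (s - m))%C by ring.
  eapply Rle_trans; [apply Cmod_triangle|]. rewrite Cmod_opp. lra.
Qed.

Lemma Csum_plus (a b : nat -> C) (n : nat) : Csum (fun k => (a k + b k)%C) n = (Csum a n + Csum b n)%C.
Proof. induction n as [|n IH]; simpl; [ring|]. rewrite IH. ring. Qed.

Lemma Csum_scal (c : C) (a : nat -> C) (n : nat) : Csum (fun k => (c * a k)%C) n = (c * Csum a n)%C.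
Proof. induction n as [|n IH]; simpl; [ring|]. rewrite IH. ring. Qed.

Lemma Csum_ext (a b : nat -> C) (n : nat) : (forall k, a k = b k) -> Csum a n = Csum b n.
Proof. intros H. induction n as [|n IH]; simpl; [reflexivity|]. rewrite IH, H. reflexivity. Qed.

Lemma Csum_geom_diff (a : nat -> C) (A : R) (n p : nat) : (forall k, Cmod (a k) <= A / 2 ^ k) ->
  Cmod (Csum a (n + p) - Csum a n) <= 2 * A / 2 ^ n - 2 * A / 2 ^ (n + p).
Proof.
  intros H. induction p as [|p IH].
  - rewrite Nat.add_0_r. replace (Csum a n - Csum a n)%C with (RtoC 0) by ring. rewrite Cmod_0. lra.
  - rewrite Nat.add_succ_r. simpl Csum.
    replace (Csum a (n + p) + a (n + p)%nat - Csum a n)%C with ((Csum a (n + p) - Csum a n) + a (n + p)%nat)%C by ring.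
    eapply Rle_trans; [apply Cmod_triangle|].
    assert (E1 : 2 * A / 2 ^ S (n + p) = A / 2 ^ (n + p)) by (simpl; field; apply pow_nonzero; lra).
    rewrite E1. specialize (H (n + p)%nat).
    assert (E2 : 2 * A / 2 ^ (n + p) = A / 2 ^ (n + p) + A / 2 ^ (n + p)) by (field; apply pow_nonzero; lra).
    lra.
Qed.

(* Total, but meaningful only for convergent series. *)
Definition Clim (a : nat -> C) : C :=
  (real (Lim_seq (fun n => Re (Csum a n))), real (Lim_seq (fun n => Im (Csum a n)))).

(** Each coordinate contributes an error [2 * A / 2 ^ n], the geometric tail. *)
Lemma Clim_geom (a : nat -> C) (A : R) : (forall k, Cmod (a k) <= A / 2 ^ k) ->
  forall n, Cmod (Clim a - Csum a n) <= 4 * A / 2 ^ n.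
Proof.
  intros H. assert (HA : 0 <= A).
  { specialize (H 0%nat). simpl in H. generalize (Cmod_ge_0 (a 0%nat)). lra. }
  assert (Hp : forall n, 0 < 2 ^ n) by (intros; apply pow_lt; lra).
  (* Real and imaginary parts are treated at once as subtractive functions bounded by the
     modulus. *)
  assert (HR : forall f : C -> R, (forall z w, f (z - w)%C = f z - f w) -> (forall z, Rabs (f z) <= Cmod z) ->
    forall n, Rabs (real (Lim_seq (fun n => f (Csum a n))) - f (Csum a n)) <= 2 * A / 2 ^ n).
  { intros f Hf1 Hf2 n.
    assert (Hb : forall p, Rabs (f (Csum a (n + p)) - f (Csum a n)) <= 2 * A / 2 ^ n).
    { intros p. rewrite <- Hf1. eapply Rle_trans; [apply Hf2|].
      eapply Rle_trans; [apply (Csum_geom_diff a A n p H)|].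
      assert (0 <= 2 * A / 2 ^ (n + p)) by (apply Rdiv_le_0_compat; [lra|apply Hp]). lra. }
    assert (Hex : ex_finite_lim_seq (fun n => f (Csum a n))).
    { apply ex_lim_seq_cauchy_corr. intros eps.
      destruct (pow2_small (4 * A) eps (cond_pos eps)) as [N HN]. exists N.
      assert (HbN : forall m, (N <= m)%nat -> Rabs (f (Csum a m) - f (Csum a N)) <= 2 * A / 2 ^ N).
      { intros m Hm. replace m with (N + (m - N))%nat by lia. rewrite <- Hf1.
        eapply Rle_trans; [apply Hf2|]. eapply Rle_trans; [apply (Csum_geom_diff a A N (m - N) H)|].
        assert (0 <= 2 * A / 2 ^ (N + (m - N))) by (apply Rdiv_le_0_compat; [lra|apply Hp]). lra. }
      intros p q Hp1 Hq1. assert (A1 := HbN p Hp1). assert (A2 := HbN q Hq1).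
      replace (f (Csum a p) - f (Csum a q)) with
        ((f (Csum a p) - f (Csum a N)) + - (f (Csum a q) - f (Csum a N))) by ring.
      eapply Rle_lt_trans; [apply Rabs_triang|]. rewrite Rabs_Ropp.
      unfold Rdiv in *. lra. }
    apply Lim_seq_correct' in Hex.
    assert (Hs : is_lim_seq (fun p => f (Csum a (n + p)) - f (Csum a n))
      (real (Lim_seq (fun n => f (Csum a n))) - f (Csum a n))).
    { apply is_lim_seq_minus'; [|apply is_lim_seq_const].
      apply (is_lim_seq_ext (fun p => f (Csum a (p + n)))); [intros; do 2 f_equal; lia|].
      apply (is_lim_seq_incr_n (fun n => f (Csum a n)) n). exact Hex. }
    apply Rabs_le. split.
    - apply (is_lim_seq_le (fun _ => - (2 * A / 2 ^ n)) (fun p => f (Csum a (n + p)) - f (Csum a n))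
        (- (2 * A / 2 ^ n)) (real (Lim_seq (fun n => f (Csum a n))) - f (Csum a n)));
        [|apply is_lim_seq_const|exact Hs].
      intros p. assert (B := Hb p). apply Rabs_le_between in B. lra.
    - apply (is_lim_seq_le (fun p => f (Csum a (n + p)) - f (Csum a n)) (fun _ => 2 * A / 2 ^ n)
        (real (Lim_seq (fun n => f (Csum a n))) - f (Csum a n)) (2 * A / 2 ^ n));
        [|exact Hs|apply is_lim_seq_const].
      intros p. assert (B := Hb p). apply Rabs_le_between in B. lra. }
  intros n. eapply Rle_trans; [apply Cmod_le_ReIm|]. rewrite Re_Cminus, Im_Cminus.
  assert (A1 := HR Re (fun z w => eq_refl) Re_le_Cmod n).
  assert (A2 := HR Im (fun z w => eq_refl) Im_le_Cmod n).
  unfold Clim. simpl Re at 1. simpl Im at 1. unfold Rdiv in *. lra.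
Qed.

Lemma Clim_conv (a : nat -> C) (A : R) : (forall k, Cmod (a k) <= A / 2 ^ k) -> Cconv a (Clim a).
Proof.
  intros H eps He. destruct (pow2_small (4 * A) eps He) as [N HN]. exists N. intros n Hn.
  rewrite Cmod_minus_sym. eapply Rle_lt_trans; [apply (Clim_geom a A H n)|].
  eapply Rle_lt_trans; [|exact HN].
  assert (HA : 0 <= A).
  { specialize (H 0%nat). simpl in H. generalize (Cmod_ge_0 (a 0%nat)). lra. }
  apply Rmult_le_compat_l; [lra|]. apply Rinv_le_contravar; [apply pow_lt; lra|].
  apply Rle_pow; [lra|exact Hn].
Qed.

Definition entire_coef (c : nat -> C) (K y : R) : Prop :=
  0 <= K /\ 0 <= y /\ forall m, Cmod (c m) <= K * (y ^ m / INR (fact m)).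

Definition entire (c : nat -> C) (z : C) : C := Clim (fun m => (c m * z ^ m)%C).
(** The index is not shifted: the term [m = 0] vanishes through its factor [INR 0], whatever
    [pred 0] is. *)
Definition entire_der (c : nat -> C) (z : C) : C :=
  Clim (fun m => (c m * (RtoC (INR m) * z ^ pred m))%C).

Lemma INR_le_pow2 (m : nat) : INR m <= 2 ^ m.
Proof.
  induction m as [|m IH]; [simpl; lra|]. rewrite S_INR. simpl.
  assert (1 <= 2 ^ m) by (apply pow_R1_Rle; lra). lra.
Qed.

Lemma entire_term_geom (c : nat -> C) (K y rho : R) (v : C) (m : nat) : entire_coef c K y ->
  0 <= rho -> Cmod v <= rho ^ m -> Cmod (c m * v) <= K * exp (2 * (y * rho)) / 2 ^ m.
Proof.
  intros [HK [Hy Hc]] Hrho Hv. rewrite Cmod_mult.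
  apply Rle_trans with (K * (y ^ m / INR (fact m)) * rho ^ m).
  - apply Rmult_le_compat; try apply Cmod_ge_0; [apply Hc|exact Hv].
  - assert (H := pow_fact_geom (y * rho) m ltac:(apply Rmult_le_pos; assumption)).
    rewrite Rpow_mult_distr in H.
    replace (K * (y ^ m / INR (fact m)) * rho ^ m) with (K * (y ^ m * rho ^ m / INR (fact m)))
      by (field; apply INR_fact_neq_0).
    unfold Rdiv in *. rewrite (Rmult_assoc K). apply Rmult_le_compat_l; assumption.
Qed.

Lemma entire_conv (c : nat -> C) (K y : R) (z : C) : entire_coef c K y ->
  Cconv (fun m => (c m * z ^ m)%C) (entire c z).
Proof.
  intros Hc. apply Clim_conv with (K * exp (2 * (y * Cmod z))). intros m.
  apply entire_term_geom; [exact Hc|apply Cmod_ge_0|]. rewrite Cmod_pow. lra.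
Qed.

Lemma entire_der_bound (z : C) (rho : R) (m : nat) : 1 <= rho -> Cmod z <= rho ->
  Cmod (RtoC (INR m) * z ^ pred m) <= (2 * rho) ^ m.
Proof.
  intros H1 Hz. rewrite Cmod_mult, Cmod_R, Rabs_pos_eq, Cmod_pow, Rpow_mult_distr by apply pos_INR.
  apply Rmult_le_compat; [apply pos_INR|apply pow_le, Cmod_ge_0|apply INR_le_pow2|].
  apply Rle_trans with (rho ^ pred m).
  - apply pow_incr. split; [apply Cmod_ge_0|exact Hz].
  - apply Rle_pow; [exact H1|lia].
Qed.

Lemma entire_der_conv (c : nat -> C) (K y : R) (z : C) : entire_coef c K y ->
  Cconv (fun m => (c m * (RtoC (INR m) * z ^ pred m))%C) (entire_der c z).
Proof.
  intros Hc. assert (Hz := Cmod_ge_0 z). apply Clim_conv with (K * exp (2 * (y * (2 * (Cmod z + 1))))). intros m.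
  apply entire_term_geom; [exact Hc|lra|]. apply entire_der_bound; lra.
Qed.

(** A crude polynomial factor in [m] is affordable because the coefficients decay factorially. *)
Lemma Cpow_taylor (z k : C) (rho : R) (m : nat) : 1 <= rho -> Cmod z <= rho -> Cmod (z + k) <= rho ->
  Cmod ((z + k) ^ m - z ^ m - RtoC (INR m) * z ^ pred m * k) <=
  INR m * INR m * (Cmod k * Cmod k) * rho ^ m.
Proof.
  intros H1 Hz Hk. induction m as [|m IH].
  - simpl. replace (1 - 1 - 0 * 1 * k)%C with (RtoC 0) by ring. rewrite Cmod_0. lra.
  - assert (E0 : ((z + k) ^ S m - z ^ S m - RtoC (INR (S m)) * z ^ pred (S m) * k)%C =
      ((z + k) * ((z + k) ^ m - z ^ m - RtoC (INR m) * z ^ pred m * k) +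
       RtoC (INR m) * z ^ pred m * (k * k))%C).
    { rewrite S_INR, RtoC_plus. destruct m as [|m]; simpl; ring. }
    rewrite E0. eapply Rle_trans; [apply Cmod_triangle|].
    rewrite Cmod_mult.
    assert (HA : Cmod (RtoC (INR m) * z ^ pred m * (k * k)) <= INR m * rho ^ S m * (Cmod k * Cmod k)).
    { rewrite !Cmod_mult, Cmod_R, Rabs_pos_eq, Cmod_pow by apply pos_INR.
      apply Rmult_le_compat_r; [apply Rmult_le_pos; apply Cmod_ge_0|].
      apply Rmult_le_compat_l; [apply pos_INR|].
      apply Rle_trans with (rho ^ pred m).
      - apply pow_incr. split; [apply Cmod_ge_0|exact Hz].
      - apply Rle_pow; [exact H1|lia]. }
    assert (HB : Cmod (z + k) * Cmod ((z + k) ^ m - z ^ m - RtoC (INR m) * z ^ pred m * k) <=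
      rho * (INR m * INR m * (Cmod k * Cmod k) * rho ^ m)).
    { apply Rmult_le_compat; try apply Cmod_ge_0; assumption. }
    rewrite S_INR. simpl pow in *.
    assert (Hm := pos_INR m). assert (Hkk : 0 <= Cmod k * Cmod k) by (apply Rmult_le_pos; apply Cmod_ge_0).
    assert (Hrm : 0 <= rho * rho ^ m) by (apply Rmult_le_pos; [lra|apply pow_le; lra]).
    assert (Hp : 0 <= (Cmod k * Cmod k) * (rho * rho ^ m)) by (apply Rmult_le_pos; assumption).
    apply Rle_trans with ((INR m * INR m + INR m) * ((Cmod k * Cmod k) * (rho * rho ^ m))); [nra|].
    replace ((INR m + 1) * (INR m + 1) * (Cmod k * Cmod k) * (rho * rho ^ m)) with
      ((INR m + 1) * (INR m + 1) * ((Cmod k * Cmod k) * (rho * rho ^ m))) by ring.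
    apply Rmult_le_compat_r; [exact Hp|]. nra.
Qed.

Lemma Cconv_plus (a b : nat -> C) (l m : C) : Cconv a l -> Cconv b m ->
  Cconv (fun k => (a k + b k)%C) (l + m)%C.
Proof.
  intros Hl Hm eps He. assert (He2 : 0 < eps / 2) by lra.
  destruct (Hl _ He2) as [N1 H1]. destruct (Hm _ He2) as [N2 H2].
  exists (max N1 N2). intros n Hn. rewrite Csum_plus.
  replace (Csum a n + Csum b n - (l + m))%C with ((Csum a n - l) + (Csum b n - m))%C by ring.
  eapply Rle_lt_trans; [apply Cmod_triangle|].
  specialize (H1 n ltac:(lia)). specialize (H2 n ltac:(lia)). lra.
Qed.

Lemma Cconv_scal (c : C) (a : nat -> C) (l : C) : Cconv a l -> Cconv (fun k => (c * a k)%C) (c * l)%C.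
Proof.
  intros Hl eps He. assert (Hp : 0 < Cmod c + 1) by (generalize (Cmod_ge_0 c); lra).
  destruct (Hl (eps / (Cmod c + 1))) as [N H]; [apply Rdiv_lt_0_compat; lra|].
  exists N. intros n Hn. rewrite Csum_scal. specialize (H n Hn).
  replace (c * Csum a n - c * l)%C with (c * (Csum a n - l))%C by ring. rewrite Cmod_mult.
  apply Rle_lt_trans with (Cmod c * (eps / (Cmod c + 1))); [apply Rmult_le_compat_l; [apply Cmod_ge_0|lra]|].
  apply Rmult_lt_reg_r with (Cmod c + 1); [exact Hp|].
  replace (Cmod c * (eps / (Cmod c + 1)) * (Cmod c + 1)) with (Cmod c * eps) by (field; lra).
  generalize (Cmod_ge_0 c). nra.
Qed.

Lemma Cconv_ext (a b : nat -> C) (l : C) : (forall k, a k = b k) -> Cconv a l -> Cconv b l.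
Proof.
  intros H Hl eps He. destruct (Hl eps He) as [N HN]. exists N. intros n Hn.
  rewrite <- (Csum_ext a b n H). apply HN, Hn.
Qed.

Lemma Cconv_bound (a : nat -> C) (l : C) (A : R) : (forall k, Cmod (a k) <= A / 2 ^ k) ->
  Cconv a l -> Cmod l <= 4 * A.
Proof.
  intros Ha Hl. rewrite <- (Cconv_unique _ _ _ (Clim_conv a A Ha) Hl).
  assert (H := Clim_geom a A Ha 0). simpl in H. rewrite Rdiv_1_r in H.
  replace (Clim a - 0)%C with (Clim a) in H by ring. exact H.
Qed.

(** Termwise differentiation: the remainders sum to a multiple of [|k| ^ 2]. The radius [4 * rho] in
    the constant comes from [m ^ 2 * rho ^ m <= (4 * rho) ^ m], since [m <= 2 ^ m]. *)
Lemma entire_cder (c : nat -> C) (K y : R) (z : C) : entire_coef c K y ->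
  cder (entire c) z (entire_der c z).
Proof.
  intros Hc. set (rho := Cmod z + 1). assert (Hz := Cmod_ge_0 z). assert (Hr : 1 <= rho) by (unfold rho; lra).
  set (A := K * exp (2 * (y * (4 * rho)))).
  assert (HA : 0 <= A) by (apply Rmult_le_pos; [apply Hc|left; apply exp_pos]).
  apply cder_of_eps. intros eps He. exists (Rmin 1 (eps / (4 * A + 1))).
  split; [apply Rmin_pos; [lra|apply Rdiv_lt_0_compat; lra]|]. intros w Hw.
  assert (Hw1 : Cmod (w - z) < 1) by (eapply Rlt_le_trans; [exact Hw|apply Rmin_l]).
  assert (Hw2 : Cmod (w - z) < eps / (4 * A + 1)) by (eapply Rlt_le_trans; [exact Hw|apply Rmin_r]).
  set (k := (w - z)%C) in *.
  assert (Ew : w = (z + k)%C) by (unfold k; ring).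
  assert (Hzk : Cmod (z + k) <= rho).
  { eapply Rle_trans; [apply Cmod_triangle|]. unfold rho. lra. }
  assert (Hconv : Cconv (fun m => (c m * ((z + k) ^ m - z ^ m - RtoC (INR m) * z ^ pred m * k))%C)
    (entire c w - entire c z - entire_der c z * k)%C).
  { assert (C1 := entire_conv c K y w Hc). assert (C2 := Cconv_scal (-1)%C _ _ (entire_conv c K y z Hc)).
    assert (C3 := Cconv_scal (- k)%C _ _ (entire_der_conv c K y z Hc)).
    assert (C4 := Cconv_plus _ _ _ _ (Cconv_plus _ _ _ _ C1 C2) C3).
    replace (entire c w - entire c z - entire_der c z * k)%C with
      (entire c w + -1 * entire c z + - k * entire_der c z)%C by ring.
    apply (Cconv_ext _ _ _) with (2 := C4). intros m. rewrite Ew. ring. }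
  assert (Hkk : 0 <= Cmod k * Cmod k) by (apply Rmult_le_pos; apply Cmod_ge_0).
  eapply Rle_trans; [apply (Cconv_bound _ _ (A * (Cmod k * Cmod k))) with (2 := Hconv)|].
  - intros m. destruct Hc as [HK [Hy Hcm]]. rewrite Cmod_mult.
    assert (HT := Cpow_taylor z k rho m Hr ltac:(unfold rho; lra) Hzk).
    assert (H4 : INR m * INR m * rho ^ m <= (4 * rho) ^ m).
    { rewrite Rpow_mult_distr. apply Rmult_le_compat_r; [apply pow_le; lra|].
      replace (4 ^ m) with (2 ^ m * 2 ^ m) by (rewrite <- Rpow_mult_distr; f_equal; ring).
      apply Rmult_le_compat; try apply pos_INR; apply INR_le_pow2. }
    assert (H5 := pow_fact_geom (y * (4 * rho)) m ltac:(apply Rmult_le_pos; lra)).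
    rewrite (Rpow_mult_distr y) in H5.
    apply Rle_trans with (K * (y ^ m / INR (fact m)) * ((4 * rho) ^ m * (Cmod k * Cmod k))).
    + apply Rmult_le_compat; try apply Cmod_ge_0; [apply Hcm|].
      eapply Rle_trans; [exact HT|].
      replace (INR m * INR m * (Cmod k * Cmod k) * rho ^ m) with (INR m * INR m * rho ^ m * (Cmod k * Cmod k)) by ring.
      apply Rmult_le_compat_r; assumption.
    + replace (K * (y ^ m / INR (fact m)) * ((4 * rho) ^ m * (Cmod k * Cmod k))) with
        (K * (y ^ m * (4 * rho) ^ m / INR (fact m)) * (Cmod k * Cmod k)) by (field; apply INR_fact_neq_0).
      replace (A * (Cmod k * Cmod k) / 2 ^ m) with
        (K * (exp (2 * (y * (4 * rho))) / 2 ^ m) * (Cmod k * Cmod k)) by (unfold A; field; apply pow_nonzero; lra).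
      apply Rmult_le_compat_r; [exact Hkk|]. apply Rmult_le_compat_l; assumption.
  - replace (4 * (A * (Cmod k * Cmod k))) with (4 * A * Cmod k * Cmod k) by ring.
    apply Rmult_le_compat_r; [apply Cmod_ge_0|].
    apply Rle_trans with ((4 * A + 1) * Cmod k).
    + apply Rmult_le_compat_r; [apply Cmod_ge_0|lra].
    + apply Rmult_le_reg_r with (/ (4 * A + 1)); [apply Rinv_0_lt_compat; lra|].
      replace ((4 * A + 1) * Cmod k * / (4 * A + 1)) with (Cmod k) by (field; lra). left; exact Hw2.
Qed.

(** The operator [z d/dz] multiplies the coefficients by [m] and keeps the powers, which matches the
    passage from [phi s] to [s * phi s]. *)
Lemma entire_der_scal (c : nat -> C) (K y : R) (z : C) : entire_coef c K y ->
  Cconv (fun m => (RtoC (INR m) * c m * z ^ m)%C) (z * entire_der c z)%C.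
Proof.
  intros Hc. apply (Cconv_ext (fun m => (z * (c m * (RtoC (INR m) * z ^ pred m)))%C)).
  - intros m. destruct m as [|m]; simpl; ring.
  - apply Cconv_scal, (entire_der_conv c K y z Hc).
Qed.

(** The product, which is what [hweight] contains, is again an [entire] function; [m <= 2 ^ m]
    allows the factor [m] at the price of doubling [y]. *)
Lemma entire_der_ccont (c : nat -> C) (K y : R) : entire_coef c K y ->
  forall z, Ccont (fun z => (z * entire_der c z)%C) z.
Proof.
  intros Hc z.
  set (c' := fun m => (RtoC (INR m) * c m)%C).
  assert (Hc' : entire_coef c' K (2 * y)).
  { destruct Hc as [HK [Hy H]]. split; [exact HK|split; [lra|]]. intros m. unfold c'.
    rewrite Cmod_mult, Cmod_R, Rabs_pos_eq, Rpow_mult_distr by apply pos_INR.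
    replace (K * (2 ^ m * y ^ m / INR (fact m))) with (2 ^ m * (K * (y ^ m / INR (fact m))))
      by (field; apply INR_fact_neq_0).
    apply Rmult_le_compat; [apply pos_INR|apply Cmod_ge_0|apply INR_le_pow2|apply H]. }
  apply continuous_ext with (entire c').
  - intros w. apply (Cconv_unique (fun m => (c' m * w ^ m)%C)).
    + apply (entire_conv c' K (2 * y) w Hc').
    + apply (entire_der_scal c K y w Hc).
  - eapply cder_continuous. apply (entire_cder c' K (2 * y) z Hc').
Qed.

(** * Bessel functions and Weber's integral *)

Definition bj_coef (k : nat) : R := (-1) ^ k / (INR (fact k)) ^ 2.
Definition bk_coef (k : nat) : R := (-1) ^ k / (INR (fact k) * INR (fact (S k))).

(* In terms of Bessel functions, [bj (x ^ 2 / 4) = J_0 x] and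
   [bk (x ^ 2 / 4) = 2 * J_1 x / x]. *)
Definition bj : R -> R := PSeries bj_coef.
Definition bk : R -> R := PSeries bk_coef.

Lemma INR_fact_S (n : nat) : INR (fact (S n)) = INR (S n) * INR (fact n).
Proof. change (fact (S n)) with (S n * fact n)%nat. apply mult_INR. Qed.

Lemma bk_coef_radius : CV_radius bk_coef = p_infty.
Proof.
  apply CV_radius_infinite_DAlembert.
  - intros n. unfold bk_coef. apply Rmult_integral_contrapositive_currified.
    + apply pow_nonzero; lra.
    + apply Rinv_neq_0_compat, Rmult_integral_contrapositive_currified; apply INR_fact_neq_0.
  - apply (is_lim_seq_le_le (fun _ => 0) _ (fun n => / INR (S n))).
    + intros n. split; [apply Rabs_pos|].
      assert (Hf := INR_fact_lt_0 n). assert (HS := lt_0_INR (S n) ltac:(lia)). assert (HS2 := lt_0_INR (S (S n)) ltac:(lia)).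
      assert (H1 : 1 <= INR (S (S n))) by (rewrite S_INR; generalize (pos_INR (S n)); lra).
      replace (bk_coef (S n) / bk_coef n) with (- (/ INR (S n) * / INR (S (S n)))).
      * rewrite Rabs_Ropp, Rabs_pos_eq.
        -- rewrite <- (Rmult_1_r (/ INR (S n))) at 2. apply Rmult_le_compat_l.
           ++ left; apply Rinv_0_lt_compat, HS.
           ++ apply Rle_trans with (/ 1); [apply Rinv_le_contravar; lra|rewrite Rinv_1; lra].
        -- apply Rmult_le_pos; left; apply Rinv_0_lt_compat; assumption.
      * unfold bk_coef. rewrite (INR_fact_S (S n)), (INR_fact_S n).
        rewrite <- (tech_pow_Rmult (-1) n).
        field. repeat split; try lra. apply pow_nonzero; lra.
    + apply is_lim_seq_const.
    + replace (Finite 0) with (Rbar_inv p_infty) by reflexivity.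
      apply is_lim_seq_inv; [|discriminate].
      apply (is_lim_seq_incr_1 INR), is_lim_seq_INR.
Qed.

(** [bj] is the termwise derivative of [y * bk y], so the radius is inherited. *)
Lemma bj_coef_radius : CV_radius bj_coef = p_infty.
Proof.
  assert (H : CV_radius (PS_incr_1 bk_coef) = p_infty) by (rewrite CV_radius_incr_1; apply bk_coef_radius).
  rewrite <- CV_radius_derive in H. rewrite <- H. apply CV_radius_ext. intros n.
  unfold PS_derive, PS_incr_1, bj_coef, bk_coef. rewrite INR_fact_S.
  field. split; [apply INR_fact_neq_0|]. generalize (lt_0_INR (S n) ltac:(lia)); lra.
Qed.

Lemma bj_derive (y : R) : is_derive bj y (- bk y).
Proof.
  replace (- bk y) with (PSeries (PS_derive bj_coef) y).
  - apply is_derive_PSeries. rewrite bj_coef_radius. exact I.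
  - unfold bk. rewrite <- PSeries_opp. apply PSeries_ext. intros n.
    unfold PS_opp, PS_derive, bj_coef, bk_coef. rewrite INR_fact_S.
    change (opp ((-1) ^ n / (INR (fact n) * (INR (S n) * INR (fact n))))) with
      (- ((-1) ^ n / (INR (fact n) * (INR (S n) * INR (fact n))))).
    rewrite <- (tech_pow_Rmult (-1) n).
    field. split; [apply INR_fact_neq_0|]. generalize (lt_0_INR (S n) ltac:(lia)); lra.
Qed.

Lemma bk_ex_derive (y : R) : ex_derive bk y.
Proof. apply ex_derive_PSeries. rewrite bk_coef_radius. exact I. Qed.

(** With [y = x ^ 2 / 4] this is [(x * J_1 x)' = x * J_0 x], and [bj_derive] is [J_0' = - J_1]. *)
Lemma mult_bk_derive (y : R) : is_derive (fun y => y * bk y) y (bj y).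
Proof.
  apply (is_derive_ext (PSeries (PS_incr_1 bk_coef))).
  - intros t. apply PSeries_incr_1.
  - replace (bj y) with (PSeries (PS_derive (PS_incr_1 bk_coef)) y).
    + apply is_derive_PSeries. rewrite CV_radius_incr_1, bk_coef_radius. exact I.
    + apply PSeries_ext. intros n. unfold PS_derive, PS_incr_1, bj_coef, bk_coef. rewrite INR_fact_S.
      field. split; [apply INR_fact_neq_0|]. generalize (lt_0_INR (S n) ltac:(lia)); lra.
Qed.

Lemma bk_derive (y : R) : y <> 0 -> Derive bk y = (bj y - bk y) / y.
Proof.
  intros Hy. assert (H1 := mult_bk_derive y).
  assert (H2 : is_derive (fun y => y * bk y) y (1 * bk y + y * Derive bk y)).
  { apply (is_derive_mult (K := R_AbsRing) (fun y => y) bk).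
    - apply (is_derive_id (K := R_AbsRing)).
    - apply Derive_correct, bk_ex_derive.
    - intros; apply Rmult_comm. }
  assert (E0 : bj y = 1 * bk y + y * Derive bk y).
  { rewrite <- (is_derive_unique _ _ _ H1). apply is_derive_unique, H2. }
  rewrite E0. field. exact Hy.
Qed.

(* Up to a constant, this is the energy [u' ^ 2 + (1 + 1 / (4 x ^ 2)) u ^ 2] of
   [u = sqrt x * J_0 x], which satisfies [u'' + (1 + 1 / (4 x ^ 2)) u = 0]. *)
Definition benergy (y : R) : R :=
  sqrt y * (bj y * bj y * (1 + / (8 * y)) - bj y * bk y / 2 + y * (bk y * bk y)).

(** In the energy, the terms with [u'] cancel by the differential equation, and only the derivative
    of the decreasing coefficient [1 / (4 * x ^ 2)] survives. *)
Lemma benergy_derive (y : R) : 0 < y -> is_derive benergy y (- (bj y * bj y / (16 * y * sqrt y))).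
Proof.
  intros Hy. unfold benergy.
  assert (Hj := is_derive_unique _ _ _ (bj_derive y)). assert (Hk := bk_derive y ltac:(lra)).
  assert (Hs : 0 < sqrt y) by (apply sqrt_lt_R0, Hy).
  assert (Hss : sqrt y * sqrt y = y) by (apply sqrt_sqrt; lra).
  auto_derive.
  - repeat split; try lra; solve [exists (- bk y); apply bj_derive|apply bk_ex_derive].
  - change (Derive (fun x => bj x) y) with (Derive bj y). change (Derive (fun x => bk x) y) with (Derive bk y).
    rewrite Hj, Hk. generalize (bj y) (bk y). intros j k.
    set (s := sqrt y) in *. rewrite <- Hss. field. lra.
Qed.

Lemma benergy_decr (y : R) : 1 <= y -> benergy y <= benergy 1.
Proof.
  intros Hy.
  destruct (MVT_gen benergy 1 y (fun y => - (bj y * bj y / (16 * y * sqrt y)))) as [c [Hc Ec]].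
  - intros x Hx. rewrite Rmin_left in Hx by lra. apply benergy_derive. lra.
  - intros x Hx. rewrite Rmin_left in Hx by lra. apply continuity_pt_filterlim.
    apply (ex_derive_continuous (V := R_NormedModule)). eexists. apply benergy_derive. lra.
  - rewrite Rmin_left in Hc by lra.
    assert (Hs : 0 < sqrt c) by (apply sqrt_lt_R0; lra).
    assert (0 <= bj c * bj c / (16 * c * sqrt c)).
    { apply Rdiv_le_0_compat; [nra|]. apply Rmult_lt_0_compat; lra. }
    nra.
Qed.

Lemma bk_cont (y : R) : continuous bk y.
Proof. apply (ex_derive_continuous (V := R_NormedModule)), bk_ex_derive. Qed.

(** The monotone energy gives [J_1 x] = O(x ^ (- 1 / 2)) without asymptotic expansions, that is
    [bk y] = O(y ^ (- 3 / 4)); near 0 continuity is enough. *)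
Lemma bk_bound : exists D, 0 < D /\ forall v,
  Rabs (bk (exp v)) <= D /\ Rabs (bk (exp v)) <= D * exp (- (3 / 4) * v).
Proof.
  destruct (bounded_continuity (V := R_NormedModule) bk 0 1 (fun x _ => bk_cont x)) as [M HM].
  set (W := Rabs (benergy 1) + 1). assert (HW : 0 < W) by (generalize (Rabs_pos (benergy 1)); unfold W; lra).
  set (D := Rabs M + 4 / 3 * W + 1).
  assert (HMp := Rabs_pos M).
  exists D. split; [unfold D; lra|]. intros v.
  assert (Hv : 0 < exp v) by apply exp_pos.
  destruct (Rle_dec 0 v) as [Hp|Hn].
  - assert (Hy : 1 <= exp v) by (rewrite <- exp_0; apply exp_le, Hp).
    set (y := exp v) in *.
    assert (Hb := benergy_decr y Hy). unfold benergy at 1 in Hb.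
    (* The cross term is absorbed by [(j - k) ^ 2 >= 0] and a quarter of [y * k ^ 2], using
       [y >= 1]. *)
    assert (Hq : 3 / 4 * (y * (bk y * bk y)) <=
      bj y * bj y * (1 + / (8 * y)) - bj y * bk y / 2 + y * (bk y * bk y)).
    { assert (0 < / (8 * y)) by (apply Rinv_0_lt_compat; lra).
      generalize (bj y) (bk y). intros j k.
      assert (H1 := Rle_0_sqr (j - k)). assert (H2 := Rle_0_sqr j). assert (H3 := Rle_0_sqr k).
      unfold Rsqr in *.
      assert (H4 : 0 <= j * j * / (8 * y)) by (apply Rmult_le_pos; lra).
      assert (H5 : 0 <= (y - 1) * (k * k)) by (apply Rmult_le_pos; lra). lra. }
    assert (Hs : sqrt y = exp (v / 2)).
    { unfold y. replace (exp v) with (exp (v / 2) * exp (v / 2)) by (rewrite <- exp_plus; f_equal; field).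
      apply sqrt_square. left; apply exp_pos. }
    assert (Hk2 : bk y * bk y * exp (3 / 4 * v) * exp (3 / 4 * v) <= 4 / 3 * W).
    { replace (bk y * bk y * exp (3 / 4 * v) * exp (3 / 4 * v)) with (4 / 3 * (sqrt y * (3 / 4 * (y * (bk y * bk y))))).
      - assert (H1 : sqrt y * (3 / 4 * (y * (bk y * bk y))) <= W).
        { apply Rle_trans with (benergy 1); [|unfold W; generalize (Rle_abs (benergy 1)); lra].
          eapply Rle_trans; [|exact Hb]. apply Rmult_le_compat_l; [apply sqrt_pos|exact Hq]. }
        lra.
      - rewrite Hs. unfold y at 1. replace (exp v) with (exp (v / 2) * exp (v / 2)) by (rewrite <- exp_plus; f_equal; field).
        replace (3 / 4 * v) with (v / 2 + v / 4) by field. rewrite exp_plus.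
        assert (E4 : exp (v / 4) * exp (v / 4) = exp (v / 2)) by (rewrite <- exp_plus; f_equal; field).
        rewrite <- E4. field. }
    assert (Hk3 : Rabs (bk y) * exp (3 / 4 * v) <= D).
    { set (t := exp (3 / 4 * v)) in *. assert (Ht : 0 < t) by apply exp_pos.
      assert (Hr : Rabs (bk y) * t = Rabs (bk y * t)) by (rewrite Rabs_mult, (Rabs_pos_eq t) by lra; reflexivity).
      assert (Hsq : Rabs (bk y * t) * Rabs (bk y * t) <= 4 / 3 * W).
      { rewrite <- Rabs_mult, Rabs_pos_eq by nra. lra. }
      assert (Hab := Rabs_pos (bk y * t)). rewrite Hr.
      assert (Rabs (bk y * t) <= 4 / 3 * W + 1).
      { apply Rnot_lt_le. intros Hlt.
        assert (Rabs (bk y * t) * 1 <= Rabs (bk y * t) * Rabs (bk y * t)) by (apply Rmult_le_compat_l; lra).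
        lra. }
      unfold D. lra. }
    assert (Hk4 : Rabs (bk y) <= D * exp (- (3 / 4) * v)).
    { replace (- (3 / 4) * v) with (- (3 / 4 * v)) by ring. rewrite exp_Ropp.
      apply Rmult_le_reg_r with (exp (3 / 4 * v)); [apply exp_pos|].
      rewrite Rmult_assoc, Rinv_l, Rmult_1_r; [exact Hk3|]. generalize (exp_pos (3 / 4 * v)); lra. }
    split; [|exact Hk4]. eapply Rle_trans; [exact Hk4|].
    rewrite <- (Rmult_1_r D) at 2. apply Rmult_le_compat_l; [unfold D; lra|].
    rewrite <- exp_0. apply exp_le. lra.
  - apply Rnot_le_lt in Hn.
    assert (Hy : exp v <= 1) by (rewrite <- exp_0; apply exp_le; lra).
    assert (HM1 : Rabs (bk (exp v)) <= D).
    { assert (H1 := HM (exp v) ltac:(lra)). change (norm (bk (exp v))) with (Rabs (bk (exp v))) in H1.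
      generalize (Rle_abs M). unfold D. lra. }
    split; [exact HM1|]. eapply Rle_trans; [exact HM1|].
    rewrite <- (Rmult_1_r D) at 1. apply Rmult_le_compat_l; [unfold D; lra|].
    rewrite <- exp_0. apply exp_le. lra.
Qed.

(** * Weber's integral *)

Lemma Csum_RtoC (a : nat -> R) (n : nat) : Csum (fun k => RtoC (a k)) (S n) = RtoC (sum_n a n).
Proof.
  induction n as [|n IH].
  - simpl. rewrite sum_O. ring.
  - change (Csum (fun k => RtoC (a k)) (S (S n))) with (Csum (fun k => RtoC (a k)) (S n) + RtoC (a (S n)))%C.
    rewrite IH, sum_Sn, <- RtoC_plus. reflexivity.
Qed.

Lemma Cconv_RtoC (a : nat -> R) (l : R) : is_series a l -> Cconv (fun k => RtoC (a k)) (RtoC l).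
Proof.
  intros H eps He. destruct (proj1 (filterlim_locally _ _) H (mkposreal _ He)) as [N HN].
  exists (S N). intros n Hn. destruct n as [|n]; [lia|].
  rewrite Csum_RtoC, <- RtoC_minus, Cmod_R. apply (HN n). lia.
Qed.

Lemma Cconv_exp (x : R) : Cconv (fun k => RtoC (x ^ k / INR (fact k))) (RtoC (exp x)).
Proof.
  apply Cconv_RtoC. apply (is_series_ext (fun k => scal (pow_n x k) (/ INR (fact k)))).
  - intros n. rewrite pow_n_pow. reflexivity.
  - apply is_exp_Reals.
Qed.

Lemma Cconv_bk (y : R) : Cconv (fun k => RtoC (bk_coef k * y ^ k)) (RtoC (bk y)).
Proof.
  apply Cconv_RtoC. apply (is_series_ext (fun k => scal (pow_n y k) (bk_coef k))).
  - intros n. rewrite pow_n_pow. apply Rmult_comm.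
  - apply (PSeries_correct bk_coef y). apply CV_radius_inside. rewrite bk_coef_radius. exact I.
Qed.

(** Writing [y = (y / (2 * r)) * (2 * r)], each factor takes one of the two factorials. At
    [y = r * exp u] the growth is [exp (exp u / 2)], half of what [gker] can absorb. *)
Lemma bk_term_bound (r y : R) (m : nat) : 0 < r -> 0 <= y ->
  Rabs (bk_coef m * y ^ m) <= exp (4 * r) * exp (y / (2 * r)) / 2 ^ m.
Proof.
  intros Hr Hy. assert (Hf := INR_fact_lt_0 m). assert (Hf2 := INR_fact_lt_0 (S m)).
  assert (Hfm : INR (fact m) <= INR (fact (S m))) by (apply le_INR, fact_le; lia).
  assert (Hp : 0 < 2 ^ m) by (apply pow_lt; lra).
  assert (Hyr : 0 <= y / (2 * r)) by (apply Rdiv_le_0_compat; lra).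
  assert (H1 := pow_fact_le_exp (y / (2 * r)) m Hyr).
  assert (H2 := pow_fact_geom (2 * r) m ltac:(lra)). replace (2 * (2 * r)) with (4 * r) in H2 by ring.
  assert (E0 : Rabs (bk_coef m * y ^ m) =
    (y / (2 * r)) ^ m / INR (fact m) * ((2 * r) ^ m / INR (fact (S m)))).
  { unfold bk_coef, Rdiv. rewrite !Rabs_mult, pow_1_abs.
    rewrite (Rabs_pos_eq (/ _)) by (left; apply Rinv_0_lt_compat, Rmult_lt_0_compat; assumption).
    rewrite (Rabs_pos_eq (y ^ m)) by (apply pow_le, Hy).
    rewrite (Rpow_mult_distr y), pow_inv. field.
    repeat split; try lra. apply pow_nonzero; lra. }
  rewrite E0.
  replace (exp (4 * r) * exp (y / (2 * r)) / 2 ^ m) with (exp (y / (2 * r)) * (exp (4 * r) / 2 ^ m)) by (field; lra).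
  apply Rmult_le_compat; [| |exact H1|].
  - apply Rdiv_le_0_compat; [apply pow_le, Hyr|exact Hf].
  - apply Rdiv_le_0_compat; [apply pow_le; lra|exact Hf2].
  - eapply Rle_trans; [|exact H2]. apply Rmult_le_compat_l; [apply pow_le; lra|].
    apply Rinv_le_contravar; assumption.
Qed.

Lemma exp_pow (u : R) (m : nat) : exp u ^ m = exp (INR m * u).
Proof.
  induction m as [|m IH]; [simpl; rewrite Rmult_0_l, exp_0; reflexivity|].
  rewrite S_INR, Rmult_plus_distr_r, Rmult_1_l, exp_plus, <- IH. simpl. ring.
Qed.

(** The integral of [t ^ (m + 1) * exp (- t)] is [(m + 1)!], which cancels the second factorial in
    [bk_coef]. *)
Lemma line_gker_Csum (c : nat -> C) (N : nat) :
  dexp (fun u => Csum (fun m => (c m * gker (RtoC (INR m) + 1 + 1) u)%C) N) /\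
  line (fun u => Csum (fun m => (c m * gker (RtoC (INR m) + 1 + 1) u)%C) N) =
  Csum (fun m => (c m * RtoC (INR (fact (S m))))%C) N.
Proof.
  assert (D : forall m, dexp (gker (RtoC (INR m) + 1 + 1))).
  { intros m. apply gker_dexp. reim. generalize (pos_INR m); lra. }
  assert (Ef : forall m, egamma (RtoC (INR m) + 1 + 1) = RtoC (INR (fact (S m)))).
  { intros m. rewrite <- egamma_fact, S_INR, RtoC_plus. reflexivity. }
  induction N as [|N [IH1 IH2]].
  - assert (D0 : dexp (fun _ : R => RtoC 0)).
    { apply dexp_ext with (fun u => (0 * gker 1 u)%C); [intros; ring|].
      apply dexp_scal, gker_dexp. reim. lra. }
    split; [exact D0|]. simpl.
    rewrite (line_ext _ (fun u => (0 * gker 1 u)%C)) by (intros; ring).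
    rewrite line_scal by (apply gker_dexp; reim; lra). ring.
  - assert (D1 := dexp_scal (c N) _ (D N)). split; [apply (dexp_plus _ _ IH1 D1)|].
    change (line (fun u => (Csum (fun m => c m * gker (RtoC (INR m) + 1 + 1) u) N
       + c N * gker (RtoC (INR N) + 1 + 1) u)%C) = Csum (fun m => (c m * RtoC (INR (fact (S m))))%C) (S N)).
    rewrite line_plus, line_scal, IH2 by (assumption || apply D).
    fold (egamma (RtoC (INR N) + 1 + 1)). rewrite Ef. reflexivity.
Qed.

(** The Laplace-type integral of [t * bk (r * t) * exp (- t)]. Integrated term by term, the series
    of [bk] becomes the exponential series. *)
Lemma line_bk_gker (r : R) : 0 < r ->
  dexp (fun u => (RtoC (bk (r * exp u)) * gker 2 u)%C) ->
  line (fun u => (RtoC (bk (r * exp u)) * gker 2 u)%C) = RtoC (exp (- r)).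
Proof.
  intros Hr D.
  apply (Cconv_unique (fun k => RtoC ((- r) ^ k / INR (fact k)))); [|apply Cconv_exp].
  (* The other half of [exp (- exp u)] pays for the growth in [bk_term_bound]. *)
  destruct (gker_bound 2 2 (/ 2) ltac:(lra) (Rle_refl _) ltac:(lra)) as [M [HM HB]].
  intros eps He.
  destruct (pow2_small (2 * (4 * exp (4 * r) * M) / 2) eps He) as [N0 HN0].
  exists N0. intros N HN.
  set (c := fun m => RtoC (bk_coef m * r ^ m)).
  destruct (line_gker_Csum c N) as [D2 E2].
  assert (Ec : Csum (fun k => RtoC ((- r) ^ k / INR (fact k))) N = Csum (fun m => (c m * RtoC (INR (fact (S m))))%C) N).
  { apply Csum_ext. intros m. unfold c. rewrite <- RtoC_mult. f_equal. unfold bk_coef.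
    replace (- r) with (-1 * r) by ring. rewrite Rpow_mult_distr. field.
    split; apply INR_fact_neq_0. }
  rewrite Ec, <- E2, Cmod_minus_sym, <- line_minus by assumption.
  assert (Hdiff : edom (fun u => (RtoC (bk (r * exp u)) * gker 2 u -
     Csum (fun m => (c m * gker (RtoC (INR m) + 1 + 1) u)%C) N)%C) (4 * exp (4 * r) * M / 2 ^ N) 2).
  { split; [|split; [lra|]].
    - intros u. apply continuous_Cminus; [destruct D as [? [? D]]; apply D|destruct D2 as [? [? D2]]; apply D2].
    - intros u. assert (P := exp_pos u).
      assert (Es : Csum (fun m => (c m * gker (RtoC (INR m) + 1 + 1) u)%C) N =
        (gker 2 u * Csum (fun m => RtoC (bk_coef m * (r * exp u) ^ m)) N)%C).
      { rewrite <- Csum_scal. apply Csum_ext. intros m. unfold c, gker.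
        rewrite Rpow_mult_distr, exp_pow, <- Rmult_assoc, (RtoC_mult (bk_coef m * r ^ m)), <- (Cexp_R (INR m * u)).
        replace ((RtoC (INR m) + 1 + 1) * RtoC u - RtoC (exp u))%C with
          ((2 * RtoC u - RtoC (exp u)) + RtoC (INR m * u))%C.
        - rewrite Cexp_plus. ring.
        - rewrite RtoC_mult. replace (RtoC 2) with (1 + 1)%C by (rewrite <- RtoC_plus; f_equal; ring). ring. }
      rewrite Es.
      replace (RtoC (bk (r * exp u)) * gker 2 u - gker 2 u * Csum (fun m => RtoC (bk_coef m * (r * exp u) ^ m)) N)%C
        with (gker 2 u * (RtoC (bk (r * exp u)) - Csum (fun m => RtoC (bk_coef m * (r * exp u) ^ m)) N))%C by ring.
      assert (Hy : 0 <= r * exp u) by (apply Rmult_le_pos; lra).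
      assert (Hb : forall k, Cmod (RtoC (bk_coef k * (r * exp u) ^ k)) <=
        exp (4 * r) * exp (r * exp u / (2 * r)) / 2 ^ k).
      { intros k. rewrite Cmod_R. apply bk_term_bound; assumption. }
      rewrite <- (Cconv_unique _ _ _ (Clim_conv _ _ Hb) (Cconv_bk (r * exp u))).
      rewrite Cmod_mult.
      eapply Rle_trans; [apply Rmult_le_compat_l; [apply Cmod_ge_0|apply (Clim_geom _ _ Hb N)]|].
      rewrite Cmod_gker, Re_RtoC.
      replace (r * exp u / (2 * r)) with (/ 2 * exp u) by (field; lra).
      replace (exp (2 * u - 1 * exp u)) with (exp (2 * u - / 2 * exp u) * exp (- (/ 2 * exp u))).
      2: { rewrite <- exp_plus. f_equal. field. }
      assert (Hp2 : 0 < 2 ^ N) by (apply pow_lt; lra).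
      replace (exp (2 * u - / 2 * exp u) * exp (- (/ 2 * exp u)) * (4 * (exp (4 * r) * exp (/ 2 * exp u)) / 2 ^ N))
        with (4 * exp (4 * r) / 2 ^ N * exp (2 * u - / 2 * exp u)).
      2: { rewrite exp_Ropp. field. split; [lra|]. generalize (exp_pos (/ 2 * exp u)); lra. }
      replace (4 * exp (4 * r) * M / 2 ^ N * exp (- (2) * Rabs u)) with
        (4 * exp (4 * r) / 2 ^ N * (M * exp (- (2) * Rabs u))) by (field; lra).
      apply Rmult_le_compat_l; [|apply HB; lra].
      apply Rdiv_le_0_compat; [generalize (exp_pos (4 * r)); lra|exact Hp2]. }
  eapply Rle_lt_trans; [apply (line_bound _ _ _ Hdiff)|].
  eapply Rle_lt_trans; [|exact HN0].
  replace (2 * (4 * exp (4 * r) * M / 2 ^ N) / 2) with (2 * (4 * exp (4 * r) * M) / 2 * / 2 ^ N)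
    by (field; apply pow_nonzero; lra).
  apply Rmult_le_compat_l.
  - assert (0 < exp (4 * r) * M) by (apply Rmult_lt_0_compat; [apply exp_pos|exact HM]). lra.
  - apply Rinv_le_contravar; [apply pow_lt; lra|]. apply Rle_pow; [lra|exact HN].
Qed.

Definition bkker (z : C) (v : R) : C := (RtoC (bk (exp v)) * Cexp (z * RtoC v))%C.

(** The range is dictated by [bk]: bounded at 0, and O(y ^ (- 3 / 4)) at infinity. *)
Lemma bkker_edom (a : R) : 0 < a < 3 / 4 -> exists M e, 0 <= M /\
  forall z, Re z = a -> edom (bkker z) M e.
Proof.
  intros Ha. destruct bk_bound as [D [HD Hb]].
  set (e := Rmin a (3 / 4 - a)). assert (He : 0 < e) by (apply Rmin_pos; lra).
  assert (Hel : e <= a /\ e <= 3 / 4 - a) by (split; [apply Rmin_l|apply Rmin_r]).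
  exists D, e. split; [lra|]. intros z Hz. split; [|split; [exact He|]].
  - intros v. apply continuous_Cmult.
    + apply continuous_RtoC. apply (continuous_Rcomp bk exp); [apply continuous_exp|apply bk_cont].
    + apply continuous_Cexp, continuous_Cmult; [apply continuous_const|apply continuous_RtoC, continuous_id].
  - intros v. unfold bkker. rewrite Cmod_mult, Cmod_R, Cmod_Cexp.
    replace (Re (z * RtoC v)) with (a * v) by (rewrite <- Hz; destruct z; simpl; ring).
    destruct (Hb v) as [H1 H2]. assert (P := exp_pos (a * v)).
    destruct (Rle_dec 0 v) as [Hv|Hv].
    + rewrite (Rabs_pos_eq v) by exact Hv.
      apply Rle_trans with (D * exp (- (3 / 4) * v) * exp (a * v)); [apply Rmult_le_compat_r; lra|].
      rewrite Rmult_assoc, <- exp_plus. apply Rmult_le_compat_l; [lra|]. apply exp_le. nra.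
    + apply Rnot_le_lt in Hv. rewrite (Rabs_left v) by exact Hv.
      apply Rle_trans with (D * exp (a * v)); [apply Rmult_le_compat_r; lra|].
      apply Rmult_le_compat_l; [lra|]. apply exp_le. nra.
Qed.

(* The product is the double integral of [t ^ (1 - z) exp (- t) bk y y ^ (z - 1)];
   putting [y = r t], the integral over [t] is [exp (- r)] by [line_bk_gker]. *)
Lemma weber (z : C) : 0 < Re z < 3 / 4 -> (egamma (2 - z) * line (bkker z))%C = egamma z.
Proof.
  intros Hz.
  assert (D1 : dexp (gker (2 - z))) by (apply gker_dexp; reim; lra).
  assert (D2 : dexp (bkker z)).
  { destruct (bkker_edom (Re z) Hz) as [M [e [_ H]]]. exists M, e. apply H. reflexivity. }
  unfold egamma at 1. rewrite (line_conv _ _ D1 D2). apply line_ext. intros y.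
  assert (D3 := conv_inner_dexp _ _ y D1 D2).
  assert (Eq : forall u, (gker (2 - z) u * bkker z (u + y)%R)%C =
    (Cexp (z * RtoC y) * (RtoC (bk (exp y * exp u)) * gker 2 u))%C).
  { intros u. unfold gker, bkker. rewrite exp_plus, (Rmult_comm (exp u)).
    replace (Cexp ((2 - z) * RtoC u - RtoC (exp u)) * (RtoC (bk (exp y * exp u)) * Cexp (z * RtoC (u + y))))%C with
      (RtoC (bk (exp y * exp u)) * (Cexp ((2 - z) * RtoC u - RtoC (exp u)) * Cexp (z * RtoC (u + y))))%C by ring.
    replace (Cexp (z * RtoC y) * (RtoC (bk (exp y * exp u)) * Cexp (2 * RtoC u - RtoC (exp u))))%C with
      (RtoC (bk (exp y * exp u)) * (Cexp (z * RtoC y) * Cexp (2 * RtoC u - RtoC (exp u))))%C by ring.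
    rewrite <- !Cexp_plus. do 2 f_equal. rewrite RtoC_plus. ring. }
  assert (D4 : dexp (fun u => (RtoC (bk (exp y * exp u)) * gker 2 u)%C)).
  { apply dexp_ext with (fun u => (/ Cexp (z * RtoC y) * (gker (2 - z) u * bkker z (u + y)%R))%C).
    - intros u. rewrite Eq. field. apply Cexp_neq_0.
    - apply dexp_scal, D3. }
  rewrite (line_ext _ _ Eq), line_scal, line_bk_gker by (exact D4 || apply exp_pos).
  unfold gker. rewrite <- Cexp_R, <- Cexp_plus. f_equal. rewrite RtoC_opp. ring.
Qed.

(** * The contour integral *)

Lemma egamma_neq_0 (z : C) : 0 < Re z < 1 -> egamma z <> 0%C.
Proof.
  intros Hz H0. assert (H := egamma_reflection z Hz). rewrite H0 in H.
  assert (HP := PI_RGT_0). assert (H1 := f_equal Im H). simpl in H1. lra.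
Qed.

Definition hint (phi : C -> C) (q : R) (s : C) : C :=
  (phi s * (egamma (2 * s + 1) / egamma (1 / 2 - s)) * Rcpow 2 (6 * s + 1) * Rcpow q (- (4) * s))%C.

(* [hint] with the reciprocal of [egamma (1 / 2 - s)] removed by the reflection formula. *)
Definition hint_refl (phi : C -> C) (q : R) (s : C) : C :=
  (phi s * egamma (2 * s + 1) * egamma (1 / 2 + s) *
   ((Cexp ((1 / 2 - s) * (Ci * RtoC PI)) - Cexp (- ((1 / 2 - s) * (Ci * RtoC PI)))) / (2 * RtoC PI * Ci))
   * Rcpow 2 (6 * s + 1) * Rcpow q (- (4) * s))%C.

Lemma C_half : (1 / 2)%C = RtoC (/ 2).
Proof. rewrite RtoC_inv by lra. unfold Cdiv. ring. Qed.

Lemma two_pi_i_neq_0 : (2 * RtoC PI * Ci)%C <> 0%C.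
Proof. intros H. assert (HP := PI_RGT_0). assert (H1 := f_equal Im H). simpl in H1. lra. Qed.

Lemma hint_refl_eq (phi : C -> C) (q : R) (s : C) : - (1 / 2) < Re s < 1 / 2 ->
  hint_refl phi q s = hint phi q s.
Proof.
  intros Hs. unfold hint, hint_refl. rewrite C_half.
  assert (Hz : 0 < Re (RtoC (/ 2) - s) < 1) by (reim; lra).
  assert (H := egamma_reflection _ Hz). assert (Hn := egamma_neq_0 _ Hz).
  replace (1 - (RtoC (/ 2) - s))%C with (RtoC (/ 2) + s)%C in H.
  2: { replace (RtoC 1) with (RtoC (/ 2) + RtoC (/ 2))%C by (rewrite <- RtoC_plus; f_equal; field). ring. }
  set (d := (Cexp ((RtoC (/ 2) - s) * (Ci * RtoC PI)) - Cexp (- ((RtoC (/ 2) - s) * (Ci * RtoC PI))))%C) in *.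
  assert (H2 := two_pi_i_neq_0).
  assert (H3 : (egamma (RtoC (/ 2) + s) * (d / (2 * RtoC PI * Ci)))%C = (/ egamma (RtoC (/ 2) - s))%C).
  { rewrite <- H. rewrite <- H in H2. field. split; [exact Hn|].
    split; intros H0; apply H2; rewrite H0; ring. }
  unfold Cdiv at 2. rewrite <- H3. ring.
Qed.

Lemma Rcpow_cdiff (a : R) (f : C -> C) (z : C) : cdiff f z -> cdiff (fun s => Rcpow a (f s)) z.
Proof. intros H. apply cdiff_exp. apply cdiff_mult; [exact H|apply cdiff_const]. Qed.

Lemma Cmod_Rcpow (a : R) (s : C) : Cmod (Rcpow a s) = exp (Re s * ln a).
Proof. unfold Rcpow. rewrite Cmod_Cexp. f_equal. destruct s; simpl; ring. Qed.

Lemma hint_shift (delta K P B q alpha : R) (phi : C -> C) : 0 < delta < 1 / 2 -> B < PI / 2 ->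
  hardy_class delta K P B phi -> - delta < alpha < 0 ->
  dexp (fun w => hint phi q (alpha, w)) /\
  line (fun w => hint phi q (alpha, w)) = line (fun w => hint phi q ((- delta)%R, w)).
Proof.
  intros Hd HB Hg Hal. assert (HP := PI_RGT_0).
  assert (HK := hardy_class_pos _ _ _ _ _ (Rlt_le _ _ (proj1 Hd)) Hg). destruct Hg as [Hg1 Hg2].
  set (B0 := Rmax B 0). assert (HB0 : B <= B0 /\ 0 <= B0 < PI / 2).
  { unfold B0. split; [apply Rmax_l|]. split; [apply Rmax_r|]. apply Rmax_lub_lt; lra. }
  (* The decay is [2 * t] from [egamma (2 * s + 1)] and [t] from [egamma (1 / 2 + s)], against [PI]
     from the sine and [B] from [phi]. An angle below [PI / 2] with [3 * t > PI + B] exists because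
     [B < PI / 2]. *)
  set (t := ((PI + B0) / 3 + PI / 2) / 2).
  assert (Ht : 0 < t < PI / 2 /\ PI + B < 3 * t) by (unfold t; lra).
  set (e := 3 * t - PI - B).
  (* The lower ends are the real parts of [2 * s + 1] and [1 / 2 + s] at [Re s = - delta]; both are
     positive since [delta < 1 / 2]. *)
  destruct (egamma_decay (1 - 2 * delta) 1 t ltac:(lra) ltac:(lra) (proj1 Ht)) as [M1 [HM1 H1]].
  destruct (egamma_decay (/ 2 - delta) 1 t ltac:(lra) ltac:(lra) (proj1 Ht)) as [M2 [HM2 H2]].
  set (F := hint_refl phi q).
  assert (Hln2 : 0 < ln 2) by (rewrite <- ln_1; apply ln_increasing; lra).
  assert (Hd1 : forall s, - delta <= Re s <= alpha -> cdiff F s).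
  { intros s Hs.
    assert (L1 : cdiff (fun s => (2 * s + 1)%C) s).
    { apply cdiff_plus; [|apply cdiff_const]. apply cdiff_mult; [apply cdiff_const|apply cdiff_id]. }
    assert (L2 : cdiff (fun s => (1 / 2 + s)%C) s) by (apply cdiff_plus; [apply cdiff_const|apply cdiff_id]).
    assert (L3 : cdiff (fun s => ((1 / 2 - s) * (Ci * RtoC PI))%C) s).
    { apply cdiff_mult; [|apply cdiff_const]. apply cdiff_minus; [apply cdiff_const|apply cdiff_id]. }
    assert (L4 : cdiff (fun s => (6 * s + 1)%C) s).
    { apply cdiff_plus; [|apply cdiff_const]. apply cdiff_mult; [apply cdiff_const|apply cdiff_id]. }
    assert (L5 : cdiff (fun s => (- (4) * s)%C) s) by (apply cdiff_mult; [apply cdiff_const|apply cdiff_id]).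
    unfold F, hint_refl.
    refine (cdiff_mult _ _ _ _ (Rcpow_cdiff q _ _ L5)).
    refine (cdiff_mult _ _ _ _ (Rcpow_cdiff 2 _ _ L4)).
    refine (cdiff_mult _ _ _ _ _).
    - refine (cdiff_mult _ _ _ _ _).
      + refine (cdiff_mult _ _ _ _ _); [apply Hg1; lra|].
        refine (cdiff_comp egamma _ _ _ L1). apply egamma_cdiff. reim. lra.
      + refine (cdiff_comp egamma _ _ _ L2). apply egamma_cdiff. rewrite C_half. reim. lra.
    - refine (cdiff_mult _ _ _ _ (cdiff_const _ _)).
      refine (cdiff_minus _ _ _ (cdiff_exp _ _ L3) (cdiff_exp _ _ (cdiff_opp _ _ L3))). }
  set (C2 := exp (7 * ln 2)). set (Cq := exp (4 * Rabs (ln q))).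
  set (Cp := / Cmod (2 * RtoC PI * Ci)).
  assert (HCp : 0 < Cp) by (apply Rinv_0_lt_compat, Cmod_gt_0, two_pi_i_neq_0).
  assert (Htail : strip_tail F (- delta) alpha (K * exp (Rabs P) * M1 * M2 * (2 * Cp) * C2 * Cq) e).
  { intros s Hs _. unfold F, hint_refl.
    assert (A0 := Rabs_pos (Im s)).
    assert (B1 : Cmod (phi s) <= K * exp (Rabs P) * exp (B * Rabs (Im s))).
    { eapply Rle_trans; [apply Hg2; lra|]. rewrite Rmult_assoc, <- exp_plus.
      apply Rmult_le_compat_l; [exact HK|]. apply exp_le.
      assert (A : Rabs (P * Re s) <= Rabs P * 1).
      { rewrite Rabs_mult. apply Rmult_le_compat_l; [apply Rabs_pos|]. apply Rabs_le. lra. }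
      generalize (Rle_abs (P * Re s)); lra. }
    assert (B2 : Cmod (egamma (2 * s + 1)) <= M1 * exp (- (2 * t) * Rabs (Im s))).
    { eapply Rle_trans; [apply H1; reim; lra|]. reim.
      rewrite Rplus_0_r, Rabs_mult, (Rabs_pos_eq 2) by lra. right. do 2 f_equal. ring. }
    assert (B3 : Cmod (egamma (1 / 2 + s)) <= M2 * exp (- t * Rabs (Im s))).
    { rewrite C_half. eapply Rle_trans; [apply H2; reim; lra|]. reim. rewrite Rplus_0_l. lra. }
    assert (B4 : Cmod ((Cexp ((1 / 2 - s) * (Ci * RtoC PI)) - Cexp (- ((1 / 2 - s) * (Ci * RtoC PI)))) /
      (2 * RtoC PI * Ci)) <= 2 * Cp * exp (PI * Rabs (Im s))).
    { rewrite Cmod_div by apply two_pi_i_neq_0. unfold Rdiv. fold Cp.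
      replace (2 * Cp * exp (PI * Rabs (Im s))) with (2 * exp (PI * Rabs (Im s)) * Cp) by ring.
      apply Rmult_le_compat_r; [lra|].
      unfold Cminus at 1. eapply Rle_trans; [apply Cmod_triangle|]. rewrite Cmod_opp, !Cmod_Cexp.
      rewrite Re_Copp.
      assert (Er : Re ((1 / 2 - s) * (Ci * RtoC PI)) = PI * Im s).
      { rewrite C_half. destruct s; simpl. ring. }
      rewrite Er. generalize (Rle_abs (Im s)) (Rle_abs (- Im s)). rewrite Rabs_Ropp. intros A1 A2.
      assert (exp (PI * Im s) <= exp (PI * Rabs (Im s))) by (apply exp_le; nra).
      assert (exp (- (PI * Im s)) <= exp (PI * Rabs (Im s))) by (apply exp_le; nra). lra. }
    assert (B5 : Cmod (Rcpow 2 (6 * s + 1)) <= C2).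
    { rewrite Cmod_Rcpow. apply exp_le. reim. nra. }
    assert (B6 : Cmod (Rcpow q (- (4) * s)) <= Cq).
    { rewrite Cmod_Rcpow. apply exp_le.
      replace (Re (- (4) * s)) with (- 4 * Re s) by (destruct s; simpl; ring).
      assert (A : Rabs (- 4 * Re s * ln q) <= 4 * Rabs (ln q)).
      { rewrite Rabs_mult. apply Rmult_le_compat_r; [apply Rabs_pos|]. apply Rabs_le. lra. }
      generalize (Rle_abs (- 4 * Re s * ln q)); lra. }
    replace (K * exp (Rabs P) * M1 * M2 * (2 * Cp) * C2 * Cq * exp (- e * Rabs (Im s))) with
      (K * exp (Rabs P) * exp (B * Rabs (Im s)) * (M1 * exp (- (2 * t) * Rabs (Im s))) *
       (M2 * exp (- t * Rabs (Im s))) * (2 * Cp * exp (PI * Rabs (Im s))) * C2 * Cq).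
    2: { replace (- e * Rabs (Im s)) with (B * Rabs (Im s) + - (2 * t) * Rabs (Im s) + - t * Rabs (Im s) + PI * Rabs (Im s))
           by (unfold e; ring). rewrite !exp_plus. ring. }
    rewrite !Cmod_mult.
    repeat (apply Rmult_le_compat; [repeat apply Rmult_le_pos; apply Cmod_ge_0|apply Cmod_ge_0| |assumption]).
    exact B1. }
  destruct (strip_shift F (- delta) alpha _ e ltac:(lra) ltac:(unfold e; lra) Hd1 Htail) as [Da [Db EL]].
  assert (Ea : forall w, F (alpha, w) = hint phi q (alpha, w)) by (intros w; apply hint_refl_eq; simpl; lra).
  assert (Eb : forall w, F ((- delta)%R, w) = hint phi q ((- delta)%R, w)) by (intros w; apply hint_refl_eq; simpl; lra).
  split; [apply dexp_ext with (2 := Db); exact Ea|].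
  rewrite <- (line_ext _ _ Ea), <- (line_ext _ _ Eb). symmetry. exact EL.
Qed.

(** Weber's integral at [2 * s + 1], with [Gamma (1 - 2 s) = - 2 s Gamma (- 2 s)] and the
    duplication formula at [- s]. The condition [Re s < - (1 / 8)] is [Re (2 * s + 1) < 3 / 4]. *)
Lemma weber_gamma (s : C) : - (1 / 2) < Re s < - (1 / 8) ->
  (- (2) * s * egamma (- s) * line (bkker (2 * s + 1)))%C =
  (2 * Cexp (2 * s * RtoC (ln 2)) * RtoC (sqrt PI) * (egamma (2 * s + 1) / egamma (1 / 2 - s)))%C.
Proof.
  intros Hs. rewrite C_half.
  assert (HW := weber (2 * s + 1)%C ltac:(reim; lra)).
  replace (2 - (2 * s + 1))%C with (2 * - s + 1)%C in HW.
  2: { replace (RtoC 2) with (1 + 1)%C by (rewrite <- RtoC_plus; f_equal; ring). ring. }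
  rewrite (egamma_succ (2 * - s)) in HW by (reim; rewrite Re_Copp; lra).
  assert (HD := egamma_duplication (- s)%C ltac:(reim; lra)).
  replace (- s + RtoC (/ 2))%C with (RtoC (/ 2) - s)%C in HD by ring.
  replace (- (2 * - s * RtoC (ln 2)))%C with (2 * s * RtoC (ln 2))%C in HD by ring.
  assert (Hn := egamma_neq_0 (RtoC (/ 2) - s)%C ltac:(reim; lra)).
  set (m := line (bkker (2 * s + 1))) in *.
  replace (- (2) * s * egamma (- s) * m)%C with
    (- (2) * s * (egamma (- s) * egamma (RtoC (/ 2) - s)) * m / egamma (RtoC (/ 2) - s))%C by (field; exact Hn).
  rewrite HD, <- HW. field. exact Hn.
Qed.

(** In the variable [v] with [(q * x / 2) ^ 2 = exp v], the logarithm of [x ^ 4] is [L + 2 * v]. *)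
Lemma mbker_shift (psi : C -> C) (L v : R) (s : C) :
  mbker psi (L + 2 * v) s = (mbker psi L s * Cexp (2 * s * RtoC v))%C.
Proof.
  unfold mbker. replace (s * RtoC (L + 2 * v))%C with (s * RtoC L + 2 * s * RtoC v)%C.
  - rewrite Cexp_plus. ring.
  - rewrite RtoC_plus, RtoC_mult. ring.
Qed.

(** On the contour [|Cexp (2 * s * v)|] is the constant [exp (- (2 * delta) * v)], which comes out
    of the bound. *)
Lemma mellin_barnes_decay (delta K P B L : R) (psi : C -> C) : 0 < delta -> B < PI / 2 ->
  hardy_class delta K P B psi ->
  exists N, 0 <= N /\ forall v, Cmod (mellin_barnes delta psi (L + 2 * v)) <= N * exp (- (2 * delta) * v).
Proof.
  intros Hd HB Hg. destruct (mbker_edom delta P B L Hd HB) as [CI [HCI HE]].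
  destruct (mid_angle_spec B HB) as [_ Ht].
  assert (HK := hardy_class_pos _ _ _ _ _ (Rlt_le _ _ Hd) Hg). specialize (HE K psi Hg).
  set (e := mid_angle B - B) in *. assert (He : 0 < e) by (unfold e; lra).
  exists (2 * (CI * K) / e). split; [apply Rdiv_le_0_compat; [|exact He]; assert (0 <= CI * K) by (apply Rmult_le_pos; assumption); lra|].
  intros v. unfold mellin_barnes.
  replace (2 * (CI * K) / e * exp (- (2 * delta) * v)) with (2 * (CI * K * exp (- (2 * delta) * v)) / e) by (field; lra).
  apply line_bound. split; [|split; [exact He|]].
  - intros w. apply continuous_ext with (fun w : R => (mbker psi L ((- delta)%R, w) * Cexp (2 * (((- delta)%R, w) : C) * RtoC v))%C).
    + intros w'. symmetry. apply mbker_shift.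
    + apply continuous_Cmult; [apply HE|]. apply continuous_Cexp, continuous_Cmult; [|apply continuous_const].
      apply continuous_Cmult; [apply continuous_const|].
      apply continuous_pairC; simpl; [apply continuous_const|apply continuous_id].
  - intros w. rewrite mbker_shift, Cmod_mult, Cmod_Cexp.
    replace (Re (2 * ((- delta)%R, w) * RtoC v)) with (- (2 * delta) * v) by (simpl; ring).
    replace (CI * K * exp (- (2 * delta) * v) * exp (- e * Rabs w)) with
      (CI * K * exp (- e * Rabs w) * exp (- (2 * delta) * v)) by ring.
    apply Rmult_le_compat_r; [left; apply exp_pos|apply HE].
Qed.

(** [k] is the transform side, an integral over [v] of contour integrals; [m] is the contour side,
    with the Bessel integral evaluated inside. Both are iterated integrals of one dominated
    kernel. *)
Lemma mellin_swap (delta K P B L : R) (psi : C -> C) : 1 / 8 < delta < 1 / 2 -> B < PI / 2 ->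
  hardy_class delta K P B psi ->
  let k := fun v => (RtoC (exp v * bk (exp v)) * mellin_barnes delta psi (L + 2 * v))%C in
  let m := fun w => (mbker psi L ((- delta)%R, w) * line (bkker (2 * ((- delta)%R, w) + 1)))%C in
  dexp k /\ dexp m /\ line k = line m.
Proof.
  intros Hd HB Hg k m.
  destruct (mbker_edom delta P B L ltac:(lra) HB) as [CI [HCI HE]].
  assert (HK := hardy_class_pos delta _ _ _ _ ltac:(lra) Hg). specialize (HE K psi Hg).
  (* On the contour [Re (2 * s + 1) = 1 - 2 * delta], which lies in [(0, 3 / 4)] exactly when
     [1 / 8 < delta < 1 / 2]. *)
  destruct (bkker_edom (1 - 2 * delta) ltac:(lra)) as [M [e2 [HM Hbk]]].
  assert (Hb : forall w, edom (bkker (2 * ((- delta)%R, w) + 1)) M e2).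
  { intros w. apply Hbk. simpl. ring. }
  set (e1 := mid_angle B - B) in *.
  assert (He1 : 0 < e1) by apply HE. assert (He2 : 0 < e2) by apply (Hb 0).
  set (e := Rmin e1 e2). assert (He : 0 < e) by (apply Rmin_pos; assumption).
  assert (HE' := edom_weaken _ _ _ (CI * K) e HE (Rle_refl _) (conj He (Rmin_l _ _))).
  assert (Hb' : forall w, edom (bkker (2 * ((- delta)%R, w) + 1)) M e).
  { intros w. apply edom_weaken with M e2; [apply Hb|lra|]. split; [exact He|apply Rmin_r]. }
  set (F := fun v w => (mbker psi L ((- delta)%R, w) * bkker (2 * ((- delta)%R, w) + 1) v)%C).
  assert (HF : edom2 F (M * (CI * K)) e).
  { split; [|split; [exact He|]].
    - apply ccont2_mult.
      + apply (ccont2_snd (fun w => mbker psi L ((- delta)%R, w))), HE.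
      + unfold bkker. apply ccont2_mult.
        * apply (ccont2_fst (fun v => RtoC (bk (exp v)))). intros v. apply continuous_RtoC.
          apply (continuous_Rcomp bk exp); [apply continuous_exp|apply bk_cont].
        * intros p. apply continuous_Cexp, continuous_Cmult.
          -- apply (ccont2_snd (fun w => (2 * ((- delta)%R, w) + 1)%C)). intros w.
             apply continuous_Cplus; [|apply continuous_const].
             apply continuous_Cmult; [apply continuous_const|].
             apply continuous_pairC; simpl; [apply continuous_const|apply continuous_id].
          -- apply (ccont2_fst RtoC). intros v. apply continuous_RtoC, continuous_id.
    - intros v w. unfold F. rewrite Cmod_mult.
      replace (M * (CI * K) * exp (- e * Rabs v) * exp (- e * Rabs w)) with
        ((CI * K * exp (- e * Rabs w)) * (M * exp (- e * Rabs v))) by ring.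
      apply Rmult_le_compat; try apply Cmod_ge_0; [apply HE'|apply Hb']. }
  assert (Ek : forall v, line (fun w => F v w) = k v).
  { intros v. unfold k, mellin_barnes. rewrite <- line_scal.
    - apply line_ext. intros w. unfold F, bkker. rewrite mbker_shift.
      replace ((2 * ((- delta)%R, w) + 1) * RtoC v)%C with (RtoC v + 2 * (((- delta)%R, w) : C) * RtoC v)%C by ring.
      rewrite Cexp_plus, Cexp_R, RtoC_mult. ring.
    - apply dexp_ext with (fun w => (/ (RtoC (exp v) * 1) * (RtoC (exp v) * mbker psi (L + 2 * v) ((- delta)%R, w)))%C).
      + intros w. field. intros E0. apply RtoC_inj in E0. generalize (exp_pos v); lra.
      + apply dexp_scal. apply dexp_scal.
        destruct (mbker_edom delta P B (L + 2 * v) ltac:(lra) HB) as [CI2 [_ HE2]].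
        eexists; eexists. apply (HE2 K psi Hg). }
  assert (Em : forall w, line (fun v => F v w) = m w).
  { intros w. unfold m, F. apply line_scal. eexists; eexists; apply (Hb w). }
  split; [|split].
  - apply dexp_ext with (1 := Ek). eexists; eexists. apply (edom2_line F _ _ HF).
  - apply dexp_ext with (1 := Em). eexists; eexists. apply (edom2_line _ _ _ (edom2_swap F _ _ HF)).
  - rewrite <- (line_ext _ _ Ek), <- (line_ext _ _ Em). apply (line_fubini F _ _ HF).
Qed.

(** * The entire extension of [h] *)

Lemma sum_n_Csum (a : nat -> C) (n : nat) : sum_n (G := C_AbelianGroup) a n = Csum a (S n).
Proof.
  induction n as [|n IH].
  - rewrite sum_O. simpl. ring.
  - rewrite sum_Sn, IH. reflexivity.
Qed.

Lemma Cconv_of_is_series (a : nat -> C) (l : C) :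
  is_series (K := C_AbsRing) (V := C_NormedModule) a l -> Cconv a l.
Proof.
  intros H eps He. assert (He2 : 0 < eps / 2) by lra.
  destruct (proj1 (filterlim_locally (U := C_UniformSpace) _ _) H (mkposreal _ He2)) as [N HN].
  exists (S N). intros n Hn. destruct n as [|n]; [lia|].
  specialize (HN n ltac:(lia)). apply ball_Cmod in HN. simpl in HN.
  rewrite <- sum_n_Csum.
  assert (E0 : eps = 2 * (eps / 2)) by field. rewrite E0. exact HN.
Qed.

Lemma locally_Cmod (z : C) (Q : C -> Prop) : locally (T := C_UniformSpace) z Q ->
  exists r, 0 < r /\ forall w, Cmod (w - z) < r -> Q w.
Proof.
  intros [r Hr]. exists r. split; [apply cond_pos|]. intros w Hw. apply Hr, Cmod_ball, Hw.
Qed.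

Lemma regular_cdiff (S : C -> Prop) (f : C -> C) : regular_on S f ->
  forall z, S z -> exists r, 0 < r /\ forall w, Cmod (w - z) < r -> cdiff f w.
Proof.
  intros H z Hz. destruct (locally_Cmod z _ (H z Hz)) as [r [Hr Hd]].
  exists r. split; [exact Hr|]. intros w Hw. apply cder_of_derive, Hd, Hw.
Qed.

Lemma Cpow_opp (z : C) (m : nat) : ((- z) ^ m)%C = (RtoC ((-1) ^ m) * z ^ m)%C.
Proof.
  induction m as [|m IH]; [simpl; ring|].
  change ((- z) ^ S m)%C with (- z * (- z) ^ m)%C. rewrite IH.
  change ((-1) ^ S m) with (-1 * (-1) ^ m). change (z ^ S m)%C with (z * z ^ m)%C.
  rewrite RtoC_mult. ring.
Qed.

(** * Hankel transforms by parts *)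

Definition bsq (q x : R) : R := (q * x / 2) ^ 2.
(** With [g = entire c] this is [(4 / q) * J_1 (q x) * x ^ 4 * g' (x ^ 4)], and [hbdry] below is
    [(x / q) * J_1 (q x) * g (x ^ 4)]. *)
Definition hweight (q : R) (c : nat -> C) (x : R) : C :=
  (RtoC (2 * x * bk (bsq q x)) * (RtoC (x ^ 4) * entire_der c (RtoC (x ^ 4))))%C.
Definition hbdry (q : R) (c : nat -> C) (x : R) : C :=
  (RtoC (2 / q ^ 2 * (bsq q x * bk (bsq q x))) * entire c (RtoC (x ^ 4)))%C.

Lemma bsq_derive (q x : R) : is_derive (bsq q) x (q ^ 2 * x / 2).
Proof. unfold bsq. auto_derive; [trivial|]. field. Qed.

Lemma bsq_cont (q x : R) : continuous (bsq q) x.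
Proof. apply (ex_derive_continuous (V := R_NormedModule)). eexists. apply bsq_derive. Qed.

Lemma pow4_cont (x : R) : continuous (fun x => x ^ 4) x.
Proof. apply (ex_derive_continuous (V := R_NormedModule)). auto_derive. trivial. Qed.

Lemma hweight_cont (q : R) (c : nat -> C) (K y : R) : entire_coef c K y -> ccont (hweight q c).
Proof.
  intros Hc x. apply continuous_Cmult.
  - apply continuous_RtoC. apply (continuous_Rmult (fun x => 2 * x) (fun x => bk (bsq q x))).
    + apply continuous_Rmult; [apply continuous_const|apply continuous_id].
    + apply (continuous_Rcomp bk (bsq q)); [apply bsq_cont|apply bk_cont].
  - apply (continuous_comp (U := R_UniformSpace) (V := C_UniformSpace) (W := C_UniformSpace)
      (fun x => RtoC (x ^ 4)) (fun z => (z * entire_der c z)%C)).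
    + apply continuous_RtoC, pow4_cont.
    + apply (entire_der_ccont c K y Hc).
Qed.

Lemma entire_pow4_derive (c : nat -> C) (K y x : R) : entire_coef c K y ->
  is_derive (V := C_R_NormedModule) (fun x : R => entire c (RtoC (x ^ 4))) x
    (RtoC (4 * x ^ 3) * entire_der c (RtoC (x ^ 4)))%C.
Proof.
  intros Hc. rewrite <- scal_C.
  apply (is_derive_comp (V := C_R_NormedModule) (fun t : R => entire c (RtoC t)) (fun x => x ^ 4)).
  - apply (cder_is_derive_hor (entire c) (x ^ 4) 0). apply (entire_cder c K y _ Hc).
  - auto_derive; [trivial|]. ring.
Qed.

(** [(x / q) * J_1 (q x)] is a primitive of [x * J_0 (q x)], so [hbdry] differentiates to the Hankel
    integrand plus [hweight]; it vanishes at 0. *)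
Lemma hankel_by_parts (q b : R) (c : nat -> C) (K y : R) : 0 < q -> entire_coef c K y ->
  is_Cint (fun x => (RtoC (bessel_J0 (q * x)) * entire c (RtoC (x ^ 4)) * RtoC x)%C) 0 b
    (hbdry q c b - Cint (hweight q c) 0 b)%C.
Proof.
  intros Hq Hc.
  assert (HJ : forall x, bessel_J0 (q * x) = bj (bsq q x)) by reflexivity.
  set (dT := fun x => (RtoC (x * bj (bsq q x)) * entire c (RtoC (x ^ 4)) + hweight q c x)%C).
  assert (HdT : forall x, is_derive (V := C_R_NormedModule) (hbdry q c) x (dT x)).
  { intros x. unfold hbdry, dT.
    assert (Du : is_derive (fun x => 2 / q ^ 2 * (bsq q x * bk (bsq q x))) x (x * bj (bsq q x))).
    { replace (x * bj (bsq q x)) with (2 / q ^ 2 * (q ^ 2 * x / 2 * bj (bsq q x))) by (field; lra).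
      apply (is_derive_scal (fun x => bsq q x * bk (bsq q x))).
      apply (is_derive_comp (V := R_NormedModule) (fun y => y * bk y) (bsq q)).
      - apply mult_bk_derive.
      - apply bsq_derive. }
    assert (E0 : hweight q c x = (RtoC (2 / q ^ 2 * (bsq q x * bk (bsq q x))) *
       (RtoC (4 * x ^ 3) * entire_der c (RtoC (x ^ 4))))%C).
    { unfold hweight. rewrite !Cmult_assoc, <- !RtoC_mult. do 2 f_equal.
      unfold bsq. field. lra. }
    rewrite E0.
    exact (is_derive_Cmult _ _ x _ _ (is_derive_RtoC _ x _ Du) (entire_pow4_derive c K y x Hc)). }
  assert (Hw := hweight_cont q c K y Hc).
  assert (HdTc : ccont dT).
  { intros x. apply continuous_Cplus; [|apply Hw]. apply continuous_Cmult.
    - apply continuous_RtoC. apply (continuous_Rmult (fun x => x) (fun x => bj (bsq q x))); [apply continuous_id|].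
      apply (continuous_Rcomp bj (bsq q)); [apply bsq_cont|].
      apply (ex_derive_continuous (V := R_NormedModule)). eexists. apply bj_derive.
    - apply (ex_derive_continuous (V := C_R_NormedModule)). eexists. apply (entire_pow4_derive c K y x Hc). }
  assert (I1 := is_Cint_derive _ _ 0 b (fun x _ => HdT x) (fun x _ => HdTc x)).
  assert (I2 := is_Cint_minus _ _ _ _ _ _ I1 (Cint_correct _ 0 b Hw)).
  replace (hbdry q c b - hbdry q c 0)%C with (hbdry q c b) in I2.
  - revert I2. apply is_Cint_ext. intros x _. unfold dT. rewrite HJ, RtoC_mult. ring.
  - unfold hbdry. replace (bsq q 0) with 0 by (unfold bsq; field).
    rewrite Rmult_0_l, Rmult_0_r. ring.
Qed.

Lemma bsq_exp (q v : R) : 0 < q -> bsq q (2 / q * exp (v / 2)) = exp v.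
Proof.
  intros Hq. unfold bsq. replace (q * (2 / q * exp (v / 2)) / 2) with (exp (v / 2)) by (field; lra).
  simpl. rewrite Rmult_1_r, <- exp_plus. f_equal. field.
Qed.

Lemma pow4_exp (q v : R) : 0 < q ->
  (2 / q * exp (v / 2)) ^ 4 = exp (4 * (ln 2 - ln q) + 2 * v).
Proof.
  intros Hq. replace (4 * (ln 2 - ln q) + 2 * v) with (4 * (ln 2 + - ln q + v / 2)) by field.
  assert (E0 : 2 / q * exp (v / 2) = exp (ln 2 + - ln q + v / 2)).
  { rewrite !exp_plus, exp_Ropp, !exp_ln by lra. reflexivity. }
  rewrite E0, exp_pow. f_equal. simpl. ring.
Qed.

(** The substitution [x = (2 / q) * exp (v / 2)] is made by differentiating the integral up to [x]
    with respect to [v], which leaves only the contribution near [x = 0] to be estimated. *)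
Lemma hweight_int_limit (delta K P B q : R) (psi : C -> C) (c : nat -> C) (Kc y : R) :
  0 < q -> 1 / 8 < delta < 1 / 2 -> B < PI / 2 -> hardy_class delta K P B psi -> entire_coef c Kc y ->
  (forall L, (RtoC (exp L) * entire_der c (RtoC (exp L)))%C = (mellin_barnes delta psi L / (2 * RtoC PI))%C) ->
  let L := 4 * (ln 2 - ln q) in
  let I := (RtoC (2 / (q ^ 2 * PI)) *
    line (fun v => (RtoC (exp v * bk (exp v)) * mellin_barnes delta psi (L + 2 * v))%C))%C in
  forall eps, 0 < eps -> exists T, forall v, T <= v ->
    Cmod (Cint (hweight q c) 0 (2 / q * exp (v / 2)) - I) < eps.
Proof.
  intros Hq Hd HB Hg Hc Hrep L I eps Heps. assert (HP := PI_RGT_0).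
  destruct (mellin_swap delta K P B L psi Hd HB Hg) as [Dk [_ _]].
  set (k := fun v => (RtoC (exp v * bk (exp v)) * mellin_barnes delta psi (L + 2 * v))%C) in *.
  assert (Hw := hweight_cont q c Kc y Hc).
  set (X := fun v => 2 / q * exp (v / 2)).
  set (D := fun v => Cint (hweight q c) 0 (X v)).
  assert (HX : forall v : R, is_derive X v (/ q * exp (v / 2))).
  { intros v. unfold X. auto_derive; [trivial|]. unfold Rdiv. field. lra. }
  assert (HD : forall v : R, is_derive (V := C_R_NormedModule) D v (RtoC (2 / (q ^ 2 * PI)) * k v)%C).
  { intros v. replace (RtoC (2 / (q ^ 2 * PI)) * k v)%C with (RtoC (/ q * exp (v / 2)) * hweight q c (X v))%C.
    - rewrite <- scal_C. apply (is_derive_comp (V := C_R_NormedModule) (fun x => Cint (hweight q c) 0 x) X); [|apply HX].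
      apply (is_derive_RInt (V := C_R_NormedModule) (hweight q c) _ 0).
      + apply filter_forall. intros t. apply Cint_correct, Hw.
      + apply Hw.
    - unfold hweight, k, X. rewrite (bsq_exp q v Hq), (pow4_exp q v Hq), Hrep. fold L.
      assert (E1 : exp v = exp (v / 2) * exp (v / 2)) by (rewrite <- exp_plus; f_equal; field).
      replace (RtoC (/ q * exp (v / 2)) * (RtoC (2 * (2 / q * exp (v / 2)) * bk (exp v)) * (mellin_barnes delta psi (L + 2 * v) / (2 * RtoC PI))))%C
        with (RtoC (/ q * exp (v / 2) * (2 * (2 / q * exp (v / 2)) * bk (exp v)) * / (2 * PI)) * mellin_barnes delta psi (L + 2 * v))%C.
      + rewrite Cmult_assoc, <- RtoC_mult. do 2 f_equal.
        rewrite E1 at 2. field. lra.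
      + unfold Cdiv. replace (/ (2 * RtoC PI))%C with (RtoC (/ (2 * PI))) by (rewrite RtoC_inv, RtoC_mult by lra; reflexivity).
        rewrite (RtoC_mult _ (/ (2 * PI))), (RtoC_mult (/ q * exp (v / 2))). ring. }
  destruct (ccont_bounded (hweight q c) 0 1 Hw) as [M HM].
  (* [a] near minus infinity means [x] near 0: the second threshold puts [X a] below 1, where the
     weight is bounded by [M], and the first makes the integral small. *)
  assert (Hsmall : exists T, forall a, a <= - T -> Cmod (D a) < eps / 2).
  { destruct (exp_small (2 / q * (Rabs M + 1)) (/ 2) (eps / 2) ltac:(lra) ltac:(lra)) as [T1 [_ HT1]].
    destruct (exp_small (2 / q) (/ 2) 1 ltac:(lra) ltac:(lra)) as [T2 [_ HT2]].
    exists (Rmax T1 T2). intros a Ha.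
    assert (Ha1 : T1 <= - a) by (generalize (Rmax_l T1 T2); lra).
    assert (Ha2 : T2 <= - a) by (generalize (Rmax_r T1 T2); lra).
    specialize (HT1 _ Ha1). specialize (HT2 _ Ha2).
    replace (- / 2 * - a) with (a / 2) in HT1, HT2 by field.
    assert (HXp : 0 < X a) by (apply Rmult_lt_0_compat; [apply Rdiv_lt_0_compat; lra|apply exp_pos]).
    assert (HX1 : X a < 1) by exact HT2.
    unfold D. apply Rle_lt_trans with ((X a - 0) * (Rabs M + 1)).
    - apply (is_Cint_bound_const (hweight q c)); [lra| |apply Cint_correct, Hw].
      intros x Hx. generalize (HM x ltac:(lra)) (Rle_abs M). lra.
    - unfold X. replace ((2 / q * exp (a / 2) - 0) * (Rabs M + 1)) with (2 / q * (Rabs M + 1) * exp (a / 2)) by ring.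
      exact HT1. }
  destruct Hsmall as [T0 HT0].
  assert (Dk' := dexp_scal (RtoC (2 / (q ^ 2 * PI))) _ Dk).
  destruct (line_lim _ Dk' (eps / 2) ltac:(lra)) as [T1 [HT1 HL]].
  rewrite (line_scal _ _ Dk) in HL. fold I in HL.
  exists T1. intros v Hv.
  set (a := - Rmax T0 T1).
  assert (Ha : a <= - T0 /\ a <= - T1).
  { unfold a. generalize (Rmax_l T0 T1) (Rmax_r T0 T1). lra. }
  assert (Hkc : ccont (fun v => (RtoC (2 / (q ^ 2 * PI)) * k v)%C)) by (destruct Dk' as [? [? Dk']]; apply Dk').
  assert (HI := is_Cint_unique _ _ _ _ (is_Cint_derive D _ a v (fun x _ => HD x) (fun x _ => Hkc x))).
  specialize (HL a v (proj2 Ha) Hv). rewrite HI in HL.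
  specialize (HT0 a (proj1 Ha)).
  change (Cmod (D v - I) < eps).
  replace (D v - I)%C with (D a + - (I - (D v - D a)))%C by ring.
  eapply Rle_lt_trans; [apply Cmod_triangle|]. rewrite Cmod_opp. lra.
Qed.

Lemma hbdry_limit (delta K P B q : R) (psi : C -> C) (c : nat -> C) :
  0 < q -> 1 / 8 < delta < 1 / 2 -> B < PI / 2 -> hardy_class delta K P B psi ->
  (forall L, entire c (RtoC (exp L)) = (mellin_barnes delta psi L / (2 * RtoC PI))%C) ->
  forall eps, 0 < eps -> exists T, forall v, T <= v ->
    Cmod (hbdry q c (2 / q * exp (v / 2))) < eps.
Proof.
  intros Hq Hd HB Hg Hrep eps Heps. assert (HP := PI_RGT_0).
  set (L := 4 * (ln 2 - ln q)).
  destruct (mellin_barnes_decay delta K P B L psi ltac:(lra) HB Hg) as [N [HN HMB]].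
  destruct bk_bound as [D [HD Hb]].
  (* [exp v * bk (exp v)] grows at most at rate [1 / 4] and the contour integral decays at rate
     [2 * delta]; the difference is positive because [delta > 1 / 8]. *)
  destruct (exp_small (2 / q ^ 2 * D * (N / (2 * PI))) (2 * delta - 1 / 4) eps ltac:(lra) Heps) as [T [HT H]].
  exists T. intros v Hv. eapply Rle_lt_trans; [|apply (H v Hv)].
  unfold hbdry. rewrite (bsq_exp q v Hq), (pow4_exp q v Hq), Hrep. fold L.
  rewrite Cmod_mult, Cmod_R, Cmod_div.
  2: { rewrite <- RtoC_mult. intros E0. apply RtoC_inj in E0. lra. }
  rewrite <- RtoC_mult, Cmod_R, (Rabs_pos_eq (2 * PI)) by lra.
  assert (Hq2 : 0 < q ^ 2) by (apply pow_lt, Hq).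
  assert (H1 : Rabs (2 / q ^ 2 * (exp v * bk (exp v))) <= 2 / q ^ 2 * D * exp (1 / 4 * v)).
  { assert (P1 : 0 < 2 / q ^ 2) by (apply Rdiv_lt_0_compat; lra). assert (P2 := exp_pos v).
    rewrite !Rabs_mult, (Rabs_pos_eq (2 / q ^ 2)), (Rabs_pos_eq (exp v)) by lra.
    rewrite Rmult_assoc. apply Rmult_le_compat_l; [lra|].
    eapply Rle_trans; [apply Rmult_le_compat_l; [lra|apply (proj2 (Hb v))]|].
    right. replace (1 / 4 * v) with (v + - (3 / 4) * v) by field. rewrite exp_plus. ring. }
  assert (H2 : Cmod (mellin_barnes delta psi (L + 2 * v)) / (2 * PI) <= N * exp (- (2 * delta) * v) / (2 * PI)).
  { apply Rmult_le_compat_r; [left; apply Rinv_0_lt_compat; lra|apply HMB]. }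
  eapply Rle_trans; [apply Rmult_le_compat; [apply Rabs_pos| |exact H1|exact H2]|].
  - apply Rdiv_le_0_compat; [apply Cmod_ge_0|lra].
  - right. replace (- (2 * delta - 1 / 4) * v) with (1 / 4 * v + - (2 * delta) * v) by field.
    rewrite exp_plus. field. split; lra.
Qed.

(** On the contour the swapped integrand is, up to the constant [- sqrt PI / 2], the integrand of
    the theorem. *)
Lemma Rcpow_hint (phi : C -> C) (q delta w : R) : 0 < q -> - (1 / 2) < - delta < - (1 / 8) ->
  let s := ((- delta)%R, w) : C in
  (mbker (fun s => s * phi s) (4 * (ln 2 - ln q)) s * line (bkker (2 * s + 1)))%C =
  (RtoC (- sqrt PI / 2) * hint phi q s)%C.
Proof.
  intros Hq Hd s. assert (HW := weber_gamma s Hd). unfold mbker, hint.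
  set (m := line (bkker (2 * s + 1))) in *. set (G := (egamma (2 * s + 1) / egamma (1 / 2 - s))%C) in *.
  replace (s * phi s * egamma (- s) * Cexp (s * RtoC (4 * (ln 2 - ln q))) * m)%C with
    (- / 2 * phi s * Cexp (s * RtoC (4 * (ln 2 - ln q))) * (- (2) * s * egamma (- s) * m))%C by field.
  rewrite HW.
  (* Of [2 ^ (6 s + 1)], the factor [2 ^ (2 s)] comes from the duplication formula and [2 ^ (4 s)]
     from the argument [(2 / q) ^ 4]. *)
  assert (E1 : (Rcpow 2 (6 * s + 1) * Rcpow q (- (4) * s))%C =
    (2 * (Cexp (2 * s * RtoC (ln 2)) * Cexp (s * RtoC (4 * (ln 2 - ln q)))))%C).
  { assert (E2 : (2 : C) = Cexp (RtoC (ln 2))) by (rewrite Cexp_R, exp_ln by lra; reflexivity).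
    rewrite E2 at 1. unfold Rcpow. rewrite <- !Cexp_plus. f_equal.
    rewrite RtoC_mult, RtoC_minus. destruct s as [s1 s2].
    apply injective_projections; simpl; ring. }
  replace (phi s * G * Rcpow 2 (6 * s + 1) * Rcpow q (- (4) * s))%C with
    (phi s * G * (Rcpow 2 (6 * s + 1) * Rcpow q (- (4) * s)))%C by ring.
  rewrite E1. replace (RtoC (- sqrt PI / 2)) with (- (RtoC (sqrt PI) * / 2))%C.
  - field.
  - rewrite RtoC_div, RtoC_opp by lra. unfold Cdiv. ring.
Qed.

(* By (1) and (3), these are the Taylor coefficients of [h] at the origin. *)
Definition tcoef (phi : C -> C) (m : nat) : C :=
  (phi (RtoC (INR m)) / RtoC (INR (fact m)) * RtoC ((-1) ^ m))%C.

Lemma tcoef_entire (delta K P B : R) (phi : C -> C) : 0 <= delta -> hardy_class delta K P B phi ->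
  entire_coef (tcoef phi) K (exp P).
Proof.
  intros Hd Hg. split; [apply (hardy_class_pos _ _ _ _ _ Hd Hg)|]. split; [left; apply exp_pos|].
  intros m. unfold tcoef. assert (Hf := INR_fact_lt_0 m).
  assert (H := proj2 Hg (RtoC (INR m)) ltac:(rewrite Re_RtoC; generalize (pos_INR m); lra)).
  rewrite Re_RtoC, Im_RtoC, Rabs_R0, Rmult_0_r, Rplus_0_r in H.
  rewrite Cmod_mult, Cmod_div, !Cmod_R, pow_1_abs, Rmult_1_r, (Rabs_pos_eq (INR (fact m))).
  - rewrite exp_pow. unfold Rdiv. rewrite <- Rmult_assoc. apply Rmult_le_compat_r.
    + left. apply Rinv_0_lt_compat, Hf.
    + rewrite (Rmult_comm (INR m)). exact H.
  - lra.
  - intros E0. apply RtoC_inj in E0. lra.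
Qed.

Lemma entire_mellin_barnes (delta K P B L : R) (phi : C -> C) : 0 < delta < 1 -> B < PI / 2 ->
  hardy_class delta K P B phi ->
  entire (tcoef phi) (RtoC (exp L)) = (mellin_barnes delta phi L / (2 * RtoC PI))%C.
Proof.
  intros Hd HB Hg.
  apply (Cconv_unique (fun m => (tcoef phi m * RtoC (exp L) ^ m)%C)).
  - apply (entire_conv _ K (exp P)). apply (tcoef_entire delta K P B); [lra|exact Hg].
  - apply Cconv_ext with (2 := mellin_barnes_series delta K P B L phi Hd HB Hg).
    intros m. unfold tcoef. rewrite Cpow_opp. unfold Cdiv. ring.
Qed.

(** The master theorem for [s * phi s]: its value at [m] supplies the factor [m] of the coefficients
    of [z d/dz]. *)
Lemma entire_der_mellin_barnes (delta K P B K' P' B' L : R) (phi : C -> C) : 0 < delta < 1 ->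
  hardy_class delta K P B phi ->
  B' < PI / 2 -> hardy_class delta K' P' B' (fun s => (s * phi s)%C) ->
  (RtoC (exp L) * entire_der (tcoef phi) (RtoC (exp L)))%C =
    (mellin_barnes delta (fun s => s * phi s) L / (2 * RtoC PI))%C.
Proof.
  intros Hd Hg HB' Hg'.
  apply (Cconv_unique (fun m => (RtoC (INR m) * tcoef phi m * RtoC (exp L) ^ m)%C)).
  - apply (entire_der_scal _ K (exp P)). apply (tcoef_entire delta K P B); [lra|exact Hg].
  - apply Cconv_ext with (2 := mellin_barnes_series delta K' P' B' L _ Hd HB' Hg').
    intros m. unfold tcoef. rewrite Cpow_opp. unfold Cdiv. ring.
Qed.

(** The bound [- delta <= alpha] keeps the contour in the half-plane on which the interpolation
    [phi] is given. [K] is the constant called [C] in the growth condition. *)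
Theorem theorem2 (q : R) (h : C -> C) (f : R -> C)
    (U : C -> Prop) (d delta K P B : R) (phi : C -> C)
    (hq : 0 < q)
    (hf : forall x : R, 0 <= x -> f x = h (RtoC (x ^ 4)))
    (* (1) *)
    (hU : is_domain U)
    (hU0 : forall x : R, 0 <= x -> U (RtoC x))
    (h_reg : regular_on U h)
    (h_taylor : locally (T := C_UniformSpace) (RtoC 0)
       (fun z : C => is_series (K := C_AbsRing) (V := C_NormedModule)
          (fun m : nat => (hbar h m / RtoC (INR (fact m)) * (- z) ^ m)%C) (h z)))
    (* (2) *)
    (hd : 1 / 8 < d)
    (h_decay : exists M X : R, 0 < X /\
       forall x : R, X <= x -> Cmod (h (RtoC x)) <= M * Rpower x (- d))
    (* (3) *)
    (hdelta : 1 / 8 < delta < 1 / 2)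
    (phi_reg : regular_on (halfplane delta) phi)
    (phi_interp : forall m : nat, phi (RtoC (INR m)) = hbar h m)
    (hB : B < PI / 2)
    (phi_growth : forall s : C, halfplane delta s ->
       Cmod (phi s) < K * exp (P * Re s + B * Rabs (Im s))) :
  exists A : C,
    is_hankel0 f q A /\
    forall alpha : R, - (1 / 2) < alpha < 0 -> - delta <= alpha ->
      exists I : C,
        is_vertical_int
          (fun s : C =>
             (phi s * (Gamma (2 * s + 1) / Gamma (1 / 2 - s))
              * Rcpow 2 (6 * s + 1) * Rcpow q (- (4) * s))%C)
          alpha I /\
        A = (1 / (RtoC (q ^ 2) * RtoC (sqrt PI) * Ci) * I)%C.
Proof.
  assert (HP := PI_RGT_0).
  assert (Hg : hardy_class delta K P B phi).
  { split.
    - intros s Hs. destruct (regular_cdiff _ _ phi_reg s Hs) as [r [Hr H]]. apply H.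
      replace (s - s)%C with (RtoC 0) by ring. rewrite Cmod_0. exact Hr.
    - intros s Hs. left. apply phi_growth, Hs. }
  destruct (hardy_class_mult_id delta K P B phi ltac:(lra) hB Hg) as [K1 [B1 [HB1 Hg1]]].
  set (phi1 := fun s => (s * phi s)%C) in *.
  set (c := tcoef phi).
  assert (Hc : entire_coef c K (exp P)) by (apply (tcoef_entire delta K P B); [lra|exact Hg]).
  (* The Taylor series represents [h] a priori only near 0. Its sum is entire by the growth
     condition, so the identity theorem carries the equality along the half-line. *)
  assert (Hh : forall x, 0 <= x -> h (RtoC x) = entire c (RtoC x)).
  { intros x Hx.
    destruct (identity_halfline (fun z => (h z - entire c z)%C)) with (x := x) as [eta [He H]]; [| |exact Hx|].
    - intros t Ht. destruct (regular_cdiff _ _ h_reg (RtoC t) (hU0 t Ht)) as [r [Hr H]].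
      exists r. split; [exact Hr|]. intros z Hz. apply cdiff_minus; [apply H, Hz|].
      eexists. apply (entire_cder c K (exp P) z Hc).
    - destruct (locally_Cmod _ _ h_taylor) as [r [Hr H]]. exists r. split; [exact Hr|].
      intros z Hz. replace (h z) with (entire c z); [ring|].
      apply (Cconv_unique (fun m => (c m * z ^ m)%C)); [apply (entire_conv c K (exp P) z Hc)|].
      apply (Cconv_ext (fun m => (hbar h m / RtoC (INR (fact m)) * (- z) ^ m)%C)).
      + intros m. unfold c, tcoef. rewrite phi_interp, Cpow_opp. unfold Cdiv. ring.
      + apply Cconv_of_is_series, H. replace (z - 0)%C with z by ring. exact Hz.
    - assert (E0 := H (RtoC x)). replace (RtoC x - RtoC x)%C with (RtoC 0) in E0 by ring.
      rewrite Cmod_0 in E0. specialize (E0 He).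
      replace (h (RtoC x)) with (h (RtoC x) - entire c (RtoC x) + entire c (RtoC x))%C by ring.
      rewrite E0. ring. }
  assert (Hrep0 : forall L, entire c (RtoC (exp L)) = (mellin_barnes delta phi L / (2 * RtoC PI))%C)
    by (intros L; apply (entire_mellin_barnes delta K P B); assumption || lra).
  assert (Hrep1 : forall L, (RtoC (exp L) * entire_der c (RtoC (exp L)))%C = (mellin_barnes delta phi1 L / (2 * RtoC PI))%C)
    by (intros L; apply (entire_der_mellin_barnes delta K P B K1 (P + 1) B1); assumption || lra).
  set (L := 4 * (ln 2 - ln q)).
  destruct (mellin_swap delta K1 (P + 1) B1 L phi1 hdelta HB1 Hg1) as [_ [Dm Ekm]].
  set (k := line (fun v => (RtoC (exp v * bk (exp v)) * mellin_barnes delta phi1 (L + 2 * v))%C)) in *.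
  (* The boundary term vanishes in the limit, and the integral of [hweight] enters the integration
     by parts with a minus sign. *)
  set (A := (- (RtoC (2 / (q ^ 2 * PI)) * k))%C).
  assert (Em : forall w, (mbker phi1 L ((- delta)%R, w) * line (bkker (2 * ((- delta)%R, w) + 1)))%C =
    (RtoC (- sqrt PI / 2) * hint phi q ((- delta)%R, w))%C)
    by (intros w; apply (Rcpow_hint phi q delta w hq); lra).
  assert (Hs : 0 < sqrt PI) by (apply sqrt_lt_R0, HP).
  assert (Hsn : RtoC (- sqrt PI / 2) <> 0%C) by (intros E0; apply RtoC_inj in E0; lra).
  assert (D0 : dexp (fun w => hint phi q ((- delta)%R, w))).
  { apply dexp_ext with (fun w => (/ RtoC (- sqrt PI / 2) *
      (mbker phi1 L ((- delta)%R, w) * line (bkker (2 * ((- delta)%R, w) + 1))))%C).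
    - intros w. rewrite Em. field. exact Hsn.
    - apply dexp_scal, Dm. }
  assert (Ek : k = (RtoC (- sqrt PI / 2) * line (fun w => hint phi q ((- delta)%R, w)))%C).
  { rewrite Ekm, (line_ext _ _ Em). apply line_scal, D0. }
  exists A. split.
  - apply (proj2 (filterlimi_locally (U := C_UniformSpace) _ _)). intros eps.
    assert (Heps : 0 < eps / 2) by (generalize (cond_pos eps); lra).
    destruct (hweight_int_limit delta K1 (P + 1) B1 q phi1 c K (exp P) hq hdelta HB1 Hg1 Hc Hrep1 _ Heps) as [T1 HT1].
    destruct (hbdry_limit delta K P B q phi c hq hdelta hB Hg Hrep0 _ Heps) as [T2 HT2].
    set (T := Rmax T1 T2).
    exists (fun a => a = 0) (fun b => 2 / q * exp (T / 2) < b).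
    + reflexivity.
    + exists (2 / q * exp (T / 2)). intros; assumption.
    + intros a b Ha Hb. cbn [fst snd]. subst a.
      assert (H2q : 0 < 2 / q) by (apply Rdiv_lt_0_compat; lra).
      assert (HeT := exp_pos (T / 2)).
      assert (Hb0 : 0 < b) by nra.
      (* The inverse of the substitution [b = (2 / q) * exp (v / 2)]. *)
      set (v := 2 * ln (b * q / 2)).
      assert (Hbv : b = 2 / q * exp (v / 2)).
      { unfold v. replace (2 * ln (b * q / 2) / 2) with (ln (b * q / 2)) by field.
        rewrite exp_ln by nra. field. lra. }
      assert (HTv : T <= v).
      { apply Rnot_lt_le. intros Hlt. rewrite Hbv in Hb.
        assert (exp (v / 2) < exp (T / 2)) by (apply exp_increasing; lra). nra. }
      exists (hbdry q c b - Cint (hweight q c) 0 b)%C. split.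
      * apply is_Cint_ext with (2 := hankel_by_parts q b c K (exp P) hq Hc).
        intros x Hx. rewrite Rmin_left in Hx by lra.
        rewrite hf, Hh by (try apply pow_le; lra). reflexivity.
      * apply Cmod_ball. unfold A. rewrite Hbv.
        specialize (HT1 v ltac:(eapply Rle_trans; [apply Rmax_l|exact HTv])).
        specialize (HT2 v ltac:(eapply Rle_trans; [apply Rmax_r|exact HTv])).
        fold L k in HT1.
        set (x := 2 / q * exp (v / 2)) in *.
        replace (hbdry q c x - Cint (hweight q c) 0 x - - (RtoC (2 / (q ^ 2 * PI)) * k))%C with
          (hbdry q c x + - (Cint (hweight q c) 0 x - RtoC (2 / (q ^ 2 * PI)) * k))%C by ring.
        eapply Rle_lt_trans; [apply Cmod_triangle|]. rewrite Cmod_opp. lra.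
  - intros alpha Ha1 Ha2.
    assert (HA : dexp (fun w => hint phi q (alpha, w)) /\
      line (fun w => hint phi q (alpha, w)) = line (fun w => hint phi q ((- delta)%R, w))).
    (* Moving the line needs a strip of positive width, so the edge itself is treated apart. *)
    { destruct (Req_dec alpha (- delta)) as [E0|Hn].
      - rewrite E0. split; [exact D0|reflexivity].
      - apply (hint_shift delta K P B); try assumption; lra. }
    destruct HA as [Da Ea].
    (* For [- (1 / 2) < alpha < 0] both [2 * s + 1] and [1 / 2 - s] have positive real part, so
       [Gamma] is Euler's integral at both. *)
    assert (EG : forall w, (hint phi q (alpha, w) * Ci)%C =
      ((phi (alpha, w) * (Gamma (2 * (alpha, w) + 1) / Gamma (1 / 2 - (alpha, w)))
        * Rcpow 2 (6 * (alpha, w) + 1) * Rcpow q (- (4) * (alpha, w))) * Ci)%C).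
    { intros w. unfold hint. rewrite C_half, !Gamma_egamma; [reflexivity| |].
      - reim. simpl Re. lra.
      - reim. simpl Re. lra. }
    assert (Dc : dexp (fun w => (hint phi q (alpha, w) * Ci)%C)).
    { apply dexp_ext with (fun w => (Ci * hint phi q (alpha, w))%C); [intros; ring|].
      apply dexp_scal, Da. }
    exists (Ci * line (fun w => hint phi q (alpha, w)))%C. split.
    + assert (Dg := dexp_ext _ _ EG Dc).
      assert (Hl := line_is _ Dg).
      rewrite <- (line_ext _ _ EG), (line_ext _ (fun w => (Ci * hint phi q (alpha, w))%C)) in Hl
        by (intros; ring).
      rewrite line_scal in Hl by exact Da. exact Hl.
    + unfold A. rewrite Ek, Ea.
      set (I0 := line (fun w => hint phi q ((- delta)%R, w))).
      assert (Hqn : RtoC (q ^ 2) <> 0%C).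
      { intros E0. apply RtoC_inj in E0. generalize (pow_lt q 2 hq). lra. }
      assert (Hsp : RtoC (sqrt PI) <> 0%C) by (intros E0; apply RtoC_inj in E0; lra).
      (* The [Ci] of [ds = i dw] cancels the one in the prefactor; what remains is [2 / (q ^ 2 * PI)
         * (sqrt PI / 2) = 1 / (q ^ 2 * sqrt PI)]. *)
      replace (1 / (RtoC (q ^ 2) * RtoC (sqrt PI) * Ci) * (Ci * I0))%C with
        (/ (RtoC (q ^ 2) * RtoC (sqrt PI)) * I0)%C.
      2: { field. repeat split; try assumption. apply Ci_neq_0. }
      replace (- (RtoC (2 / (q ^ 2 * PI)) * (RtoC (- sqrt PI / 2) * I0)))%C with
        (RtoC (2 / (q ^ 2 * PI) * (sqrt PI / 2)) * I0)%C.
      2: { rewrite RtoC_mult. replace (- sqrt PI / 2) with (- (sqrt PI / 2)) by field.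
           rewrite RtoC_opp. ring. }
      f_equal. rewrite <- RtoC_mult, <- RtoC_inv.
      * f_equal. assert (Hss : sqrt PI * sqrt PI = PI) by (apply sqrt_sqrt; lra).
        rewrite <- Hss at 1. field. split; lra.
      * assert (0 < q ^ 2) by (apply pow_lt, hq). nra.
Qed.
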